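(* Let $N\geq 2$, $\mathsf{A}=(A_1,\ldots,A_N)\in GL_d(\mathbb{R})^N$, and let $s$ be a real number with $0<s<d$. Let $k$ denote an integer. Then the following properties hold: (i) Suppose that $0\leq k<s\leq k+1<d$ and that $\mathsf{A}$ is $\ell$-irreducible for $\ell=k$, $\ell=k+1$ and $\ell=k+2$. Suppose also that $\mathsf{A}$ is $(k+1)$-proximal. If additionally $\mathsf{A}$ is strongly $\ell$-irreducible either for $\ell=k$, or for both $\ell=k+1$ and $\ell=k+2$, then $\mathsf{A}$ has a unique $\varphi^s$-equilibrium state $\mu$, and $\Lambda_{k+1}(\mathsf{A},\mu)>\Lambda_{k+2}(\mathsf{A},\mu)$. (ii) Suppose that $0<k\leq s<k+1\leq d$ and that $\mathsf{A}$ is $\ell$-irreducible for $\ell=k-1$, $\ell=k$ and $\ell=k+1$. Suppose also that $\mathsf{A}$ is $k$-proximal. If additionally $\mathsf{A}$ is strongly $\ell$-irreducible either for $\ell=k+1$, or for both $\ell=k-1$ and $\ell=k$, then $\mathsf{A}$ has a unique $\varphi^s$-equilibrium state $\mu$, and $\Lambda_k(\mathsf{A},\mu)>\Lambda_{k+1}(\mathsf{A},\mu)$.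
   Context: For $A\in M_d(\mathbb{R})$ let $\alpha_1(A)\geq\cdots\geq\alpha_d(A)$ be the singular values of $A$, i.e. the non-negative square roots of the eigenvalues of $A^TA$ in decreasing order. For $0\leq s\leq d$ define $\varphi^s(A):=\alpha_1(A)\cdots\alpha_{\lfloor s\rfloor}(A)\,\alpha_{\lceil s\rceil}(A)^{s-\lfloor s\rfloor}$ (when $s$ is an integer the last factor is $1$). One has $\varphi^s(AB)\leq\varphi^s(A)\varphi^s(B)$. Let $\Sigma_N:=\{1,\ldots,N\}^{\mathbb{N}}$ with the product topology, $\sigma\colon\Sigma_N\to\Sigma_N$ the shift $\sigma[(x_n)_{n=1}^\infty]:=(x_{n+1})_{n=1}^\infty$, and $\mathcal{M}_\sigma$ the set of $\sigma$-invariant Borel probability measures on $\Sigma_N$. For $\mathsf{A}\in GL_d(\mathbb{R})^N$, a measure $\nu\in\mathcal{M}_\sigma$ is a $\varphi^s$-equilibrium state of $\mathsf{A}$ if it maximises $$h(\mu)+\lim_{n\to\infty}\frac1n\int\log\varphi^s(A_{i_n}\cdots A_{i_1})\,d\mu[(i_k)_{k=1}^\infty]$$ over all $\mu\in\mathcal{M}_\sigma$, where $h(\mu)$ is the Kolmogorov–Sinai entropy of $\mu$ with respect to $\sigma$. The Lyapunov exponents of $\mathsf{A}$ with respect to $\mu\in\mathcal{M}_\sigma$ are $$\Lambda_j(\mathsf{A},\mu):=\lim_{n\to\infty}\frac1n\int\log\alpha_j(A_{i_n}\cdots A_{i_1})\,d\mu[(i_k)_{k=1}^\infty],\qquad j=1,\ldots,d.$$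 For $0\leq\ell\leq d$, $A^{\wedge\ell}$ denotes the linear map induced by $A$ on the $\ell$-th exterior power $\wedge^\ell\mathbb{R}^d$, i.e. $A^{\wedge\ell}(u_1\wedge\cdots\wedge u_\ell)=Au_1\wedge\cdots\wedge Au_\ell$; by convention $\wedge^0\mathbb{R}^d=\mathbb{R}$ and $A^{\wedge 0}$ is the identity. Write $\mathsf{A}^{\wedge\ell}=(A_1^{\wedge\ell},\ldots,A_N^{\wedge\ell})$. A tuple $(B_1,\ldots,B_N)$ of invertible linear maps of a finite-dimensional real vector space $E$ is irreducible if there is no proper nonzero subspace $V$ of $E$ with $B_iV\subseteq V$ for all $i$, and strongly irreducible if there is no (nonempty) finite union $W=\bigcup_{j=1}^mV_j$ of proper nonzero subspaces $V_j$ of $E$ with $B_iW\subseteq W$ for all $i$. (Thus every such tuple on a one-dimensional space is strongly irreducible.) $\mathsf{A}$ is $\ell$-irreducible (respectively strongly $\ell$-irreducible) if $\mathsf{A}^{\wedge\ell}$ is irreducible (respectively strongly irreducible). For $1\leq\ell\leq d-1$, $\mathsf{A}$ is $\ell$-proximal if there exist $n\geq1$ and $i_1,\ldots,i_n\in\{1,\ldots,N\}$ such that, when the eigenvalues of $A_{i_n}\cdots A_{i_1}$ are listed with multiplicity in decreasing order of absolute value, the $\ell$-th and $(\ell+1)$-st have distinct absolute values. *)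

(* Defs.v *)
From HB Require Import structures.
From mathcomp Require Import all_boot all_order all_fingroup all_algebra.
From mathcomp Require Import complex.
From mathcomp Require Import all_classical all_reals all_analysis.

Set Implicit Arguments.
Unset Strict Implicit.
Unset Printing Implicit Defensive.

Import Order.TTheory GRing.Theory Num.Theory.
Import numFieldNormedType.Exports.

Local Open Scope ring_scope.

Section Spectrum.
Context {R : realType} {d : nat}.
Implicit Types (A : 'M[R]_d) (j : nat) (s : R).

(* The complex eigenvalues of A, listed with algebraic multiplicity. *)
Definition eigenvalues A : seq R[i] :=
  sval (closed_field_poly_normal (char_poly (map_mx (real_complex R) A))).

Lemma eigenvaluesP A :
  char_poly (map_mx (real_complex R) A)
  = \prod_(z <- eigenvalues A) ('X - z%:P).
Proof.
rewrite /eigenvalues; case: closed_field_poly_normal => r /= {1}->.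
by rewrite (monicP (char_poly_monic _)) scale1r.
Qed.

Definition eigenvalue_moduli A : seq R :=
  sort >=%R [seq ComplexField.Normc.normc z | z <- eigenvalues A].

(* The eigenvalues of A^T A are real, so that taking real parts only casts them
   back from R[i] to R. *)
Definition singular_values A : seq R :=
  sort >=%R [seq Num.sqrt (complex.Re z) | z <- eigenvalues (A^T *m A)].

(* One-based, as in alpha_1 >= ... >= alpha_d; only 1 <= j <= d is meaningful. *)
Definition sing j A : R := (singular_values A)`_j.-1.

(* For integer s the last factor is x `^ 0 = 1, including the case s = 0, where
   its base is the junk value sing 0 A. *)
Definition phi s A : R :=
  (\prod_(1 <= j < (Num.truncn s).+1) sing j A)
  * (sing `|Num.ceil s|%N A) `^ (s - (Num.truncn s)%:R).

End Spectrum.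

Section ExteriorPower.
Context {R : realType}.
Implicit Types d l : nat.

(* The l-th exterior power of R^d in coordinates: the basis vector indexed by a
   subset I = {i_1 < ... < i_l} of 'I_d is e_{i_1} /\ ... /\ e_{i_l}. *)
Definition ext d l : Type := {ffun {I : {set 'I_d} | #|I| == l} -> R^o}.

HB.instance Definition _ d l := Vector.on (ext d l).

Section Wedge.
Context {d l : nat}.

Definition elt (I : {I : {set 'I_d} | #|I| == l}) (j : 'I_l) : 'I_d :=
  enum_val (cast_ord (esym (eqP (valP I))) j).

Definition wedge (u : 'I_l -> 'cV[R]_d) : ext d l :=
  [ffun I => \det (\matrix_(i < l, j < l) u j (elt I i) 0)].

(* The linear map sending the basis vector e_{i_1} /\ ... /\ e_{i_l} to
   A e_{i_1} /\ ... /\ A e_{i_l}. *)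
Definition extmap_fun (A : 'M[R]_d) (x : ext d l) : ext d l :=
  \sum_I x I *: wedge (fun j => col (elt I j) A).

Definition extmap (A : 'M[R]_d) : 'End(ext d l) := linfun (extmap_fun A).

End Wedge.
End ExteriorPower.

Arguments ext R d l : clear implicits.
Arguments extmap {R d} l A.

Section WedgeTheory.
Context {R : realType} {d l : nat}.
Local Notation idx := {I : {set 'I_d} | #|I| == l}.
Implicit Types (I J : idx) (A : 'M[R]_d) (u : 'I_l -> 'cV[R]_d).

Lemma elt_inj I : injective (@elt d l I).
Proof. by move=> i j /enum_val_inj/cast_ord_inj. Qed.

Lemma elt_imset I : [set elt I j | j in 'I_l] = val I.
Proof.
apply/eqP; rewrite eqEcard card_imset; last exact: elt_inj.
rewrite card_ord (eqP (valP I)) leqnn andbT.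
by apply/fintype.subsetP => _ /imsetP[j _ ->]; exact: enum_valP.
Qed.

Lemma elt_perm (f : {ffun 'I_l -> 'I_d}) : injective f ->
  exists (I : idx) (p : 'S_l), f = [ffun i => elt I (p i)].
Proof.
move=> f_inj.
have cI : #|[set f i | i in 'I_l]| == l by rewrite card_imset ?card_ord.
pose I : idx := exist (fun K : {set 'I_d} => is_true (#|K| == l)) _ cI.
have fE i : exists j, elt I j == f i.
  have : f i \in val I by rewrite imset_f.
  by rewrite -elt_imset => /imsetP[j _ ->]; exists j.
pose g i := xchoose (fE i).
have gE i : elt I (g i) = f i by apply/eqP; exact: (xchooseP (fE i)).
have g_inj : injective g by move=> i j gij; apply: f_inj; rewrite -!gE gij.
by exists I, (perm g_inj); apply/ffunP => i; rewrite ffunE permE gE.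
Qed.

(* Cauchy-Binet formula *)
Lemma det_mulmx_rect (X : 'M[R]_(l, d)) (Y : 'M[R]_(d, l)) :
  \det (X *m Y)
  = \sum_(I : idx) \det (colsub (elt I) X) * \det (rowsub (elt I) Y).
Proof.
transitivity (\sum_(f : {ffun 'I_l -> 'I_d})
    (\prod_i X i (f i)) * \det (rowsub f Y)).
  rewrite /determinant.
  under eq_bigr => s _ do under eq_bigr => i _ do rewrite mxE.
  under eq_bigr => s _ do rewrite bigA_distr_bigA /= big_distrr /=.
  rewrite exchange_big /=; apply: eq_bigr => f _.
  rewrite big_distrr /=; apply: eq_bigr => s _.
  rewrite mulrCA -big_split /=; congr (_ * _).
  by apply: eq_bigr => i _; rewrite !mxE.
pose h (Ip : idx * 'S_l) : {ffun 'I_l -> 'I_d} := [ffun i => elt Ip.1 (Ip.2 i)].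
have h_inj : injective h.
  move=> [I p] [J q] /ffunP hE.
  have e i : elt I (p i) = elt J (q i) by have := hE i; rewrite !ffunE.
  have IJ : I = J.
    apply: val_inj; rewrite -!elt_imset; apply/setP => x.
    apply/imsetP/imsetP => -[j _ ->].
      by exists (q ((p^-1)%g j)) => //; rewrite -e permKV.
    by exists (p ((q^-1)%g j)) => //; rewrite e permKV.
  by subst J; congr pair; apply/permP => i; exact: elt_inj (e i).
rewrite (bigID (mem [set h x | x in [set: idx * 'S_l]])) /= [X in _ + X]big1 ?addr0; last first.
  move=> f fh; have [/injectiveP f_inj|] := boolP (injectiveb f).
    have [I [p fE]] := elt_perm f_inj.
    by case/negP: fh; apply/imsetP; exists (I, p); rewrite ?inE.
  case/injectivePn => i [j ij fij].
  rewrite (determinant_alternate ij) ?mulr0 // => k.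
  by rewrite !mxE fij.
rewrite big_imset /=; last by move=> x y _ _; exact: h_inj.
rewrite (eq_bigl xpredT); last by move=> x; rewrite inE.
rewrite -(pair_bigA _ (fun I p => (\prod_i X i (h (I, p) i)) * \det (rowsub (h (I, p)) Y))) /=.
apply: eq_bigr => I _; rewrite [in RHS]/determinant big_distrl /=.
apply: eq_bigr => p _.
have -> : rowsub (h (I, p)) Y = row_perm p (rowsub (elt I) Y).
  by apply/matrixP => i j; rewrite !mxE ffunE.
rewrite row_permE det_mulmx det_perm mulrA; congr (_ * _).
rewrite mulrC; congr (_ * _); apply: eq_bigr => i _.
by rewrite !mxE ffunE.
Qed.

Lemma wedge_basis I :
  wedge (fun j => delta_mx (elt I j) 0) = [ffun J => (J == I)%:R] :> ext R d l.
Proof.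
apply/ffunP => J; rewrite !ffunE; case: eqVneq => [->|JI].
  rewrite -[RHS](det1 R l); congr (\det _); apply/matrixP => i j.
  by rewrite !mxE andbT (inj_eq (@elt_inj I)).
have [x xJ xI] : exists2 x, x \in val J & x \notin val I.
  apply/fintype.subsetPn; apply: contra JI => sJI.
  by rewrite -val_eqE eqEcard sJI (eqP (valP I)) (eqP (valP J)) /=.
move: xJ; rewrite -elt_imset => /imsetP[i _ xE].
rewrite (expand_det_row _ i) big1 // => j _; rewrite !mxE andbT.
case: eqP => [e|_]; last by rewrite mul0r.
by case/negP: xI; rewrite xE e; exact: enum_valP.
Qed.

Lemma extmap_fun_linear A : linear (@extmap_fun R d l A).
Proof.
move=> a x y; rewrite /extmap_fun scaler_sumr -big_split /=.
by apply: eq_bigr => I _; rewrite !ffunE scalerDl scalerA.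
Qed.

HB.instance Definition _ A :=
  GRing.isLinear.Build R (ext R d l) (ext R d l) _ (extmap_fun A)
    (extmap_fun_linear A).

Lemma extmap_wedge A u : extmap l A (wedge u) = wedge (fun j => A *m u j).
Proof.
rewrite lfunE /=; apply/ffunP => J; rewrite [RHS]ffunE sum_ffunE.
pose X := rowsub (elt J) A.
pose Y : 'M[R]_(d, l) := \matrix_(k < d, j < l) u j k 0.
have -> : \matrix_(i < l, j < l) (A *m u j) (elt J i) 0 = X *m Y.
  apply/matrixP => i j; rewrite !mxE; apply: eq_bigr => k _.
  by rewrite !mxE.
rewrite det_mulmx_rect; apply: eq_bigr => I _.
rewrite ffunE [wedge u I]ffunE ffunE [LHS]mulrC.
by congr (_ * _); congr (\det _); apply/matrixP => i j; rewrite !mxE.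
Qed.
End WedgeTheory.

Local Open Scope classical_set_scope.

Section Irreducibility.
Context {K : fieldType} {E : vectType K} {N : nat}.
Implicit Type B : 'I_N -> 'End(E).

Definition irreducible B : Prop :=
  ~ exists V : {vspace E},
      [/\ V != 0%VS, V != fullv & forall i, (B i @: V <= V)%VS].

Definition strongly_irreducible B : Prop :=
  ~ exists m (V : 'I_m -> {vspace E}),
      let W := \bigcup_j [set` V j] in
      [/\ (0 < m)%N,
          forall j, V j != 0%VS /\ V j != fullv
        & forall i, B i @` W `<=` W].

End Irreducibility.

Section MatrixTuples.
Context {R : realType} {N d : nat}.
Implicit Type A : 'I_N -> 'M[R]_d.

(* mxword A [:: i_1; ...; i_n] = A_{i_n} ... A_{i_1} *)
Definition mxword A (w : seq 'I_N) : 'M[R]_d :=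
  foldl (fun M i => A i *m M) 1%:M w.

Definition ext_irreducible l A : Prop :=
  irreducible (fun i => extmap l (A i)).

Definition strongly_ext_irreducible l A : Prop :=
  strongly_irreducible (fun i => extmap l (A i)).

(* Meaningful for 1 <= l <= d - 1. *)
Definition proximal l A : Prop :=
  exists2 w : seq 'I_N, w != [::] &
    let m := eigenvalue_moduli (mxword A w) in m`_l.-1 != m`_l.

End MatrixTuples.

Section Entropy.
Context {R : realType} {disp : measure_display} {T : measurableType disp}.
Variables (mu : probability T R) (f : T -> T).

Definition is_partition m (P : 'I_m -> set T) : Prop :=
  [/\ forall i, measurable (P i), trivIset setT P & \bigcup_i P i = setT].

Definition join_cell m (P : 'I_m -> set T) n (w : {ffun 'I_n -> 'I_m}) :=
  \bigcap_(k in [set: 'I_n]) iter k f @^-1` P (w k).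

(* The entropy of the join of f^{-k} P over 0 <= k < n; note 0 * ln 0 = 0. *)
Definition join_entropy m (P : 'I_m -> set T) n : R :=
  - \sum_(w : {ffun 'I_n -> 'I_m})
      let p := fine (mu (join_cell P w)) in p * ln p.

Definition partition_entropy m (P : 'I_m -> set T) : R :=
  limn (fun n => join_entropy P n / n%:R).

Definition ks_entropy : \bar R :=
  ereal_sup [set h | exists m (P : 'I_m -> set T),
    is_partition P /\ h = (partition_entropy P)%:E].

End Entropy.

(* The proof of 2 <= N is a parameter because measurable types have to be
   pointed.  Sequences are indexed from 0, so that i_n is x n.-1. *)
Definition Sigma N (N2 : (2 <= N)%N) : Type :=
  prod_topology (fun _ : nat => discrete_topology 'I_N).

Section FullShift.
Context {N : nat} {N2 : (2 <= N)%N}.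

HB.instance Definition _ := Topological.on (Sigma N2).
HB.instance Definition _ :=
  isPointed.Build (Sigma N2) (fun _ => Ordinal (ltnW N2)).

Definition borel_Sigma := g_sigma_algebraType (@open (Sigma N2)).

Definition fullshift (x : borel_Sigma) : borel_Sigma := fun n => x n.+1.

End FullShift.

Arguments borel_Sigma {N} N2.
Arguments fullshift {N} N2 x.

Section Thermodynamics.
Context {R : realType} {N : nat} {N2 : (2 <= N)%N} {d : nat}.
Implicit Types (mu nu : probability (borel_Sigma N2) R) (A : 'I_N -> 'M[R]_d).

Definition shift_invariant mu : Prop :=
  forall B, measurable B -> mu (fullshift N2 @^-1` B) = mu B.

(* lim (1/n) \int log F(A_{i_n} ... A_{i_1}) dmu *)
Definition growth_rate (F : 'M[R]_d -> R) A mu : R :=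
  limn (fun n => n%:R^-1 * \int[mu]_x ln (F (mxword A (mkseq x n)))).

Definition lyapunov j A mu : R := growth_rate (sing j) A mu.

Definition pressure_at s A mu : \bar R :=
  (ks_entropy mu (fullshift N2) + (growth_rate (phi s) A mu)%:E)%E.

Definition equilibrium_state s A nu : Prop :=
  shift_invariant nu /\
  forall mu, shift_invariant mu -> (pressure_at s A mu <= pressure_at s A nu)%E.

End Thermodynamics.

(* Main.v *)
(* Write N_l(w) for the entry-sum norm of the l-th compound of A_w, which is
   comparable to alpha_1 ... alpha_l.  In case (i) put X = N_k, Y = N_(k+1),
   Z = N_(k+2) and t = s - k; in case (ii) put X = N_(k+1), Y = N_k, Z = N_(k-1)
   and t = 1 - (s - k).  Then phi^s is comparable to Phi1 = X^(1-t) Y^t, which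
   dominates Phi2 = X^(1-t/2) Z^(t/2) up to a constant because X Z <= C Y^2.

   If one of two irreducible tuples is strongly irreducible, finitely many words
   connect any two words simultaneously for both norms: otherwise the orbit of a
   rank-one matrix x y^T would be covered by finitely many subspaces, and those
   of top dimension in a minimal cover would be permuted by the tuple.  Hence
   Phi1 and Phi2 are quasi-multiplicative.  A quasi-multiplicative potential has
   an invariant Gibbs measure, which attains the pressure.  Any other equilibrium
   state has bounded relative entropy with respect to it on cylinders, so it is
   absolutely continuous, and equal to it by ergodicity.

   If the exponents at the gap coincided, the equilibrium state of Phi1 would be
   one of Phi2 and hence Gibbs for both, so Phi1 <= C Phi2 and Y^2 <= C' X Z on
   all words.  But Y^2 / (X Z) is unbounded along powers of a proximal word. *)

Require Import Defs.
From HB Require Import structures.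
From mathcomp Require Import all_boot all_order all_algebra.
From mathcomp Require Import all_classical all_reals all_analysis.
From mathcomp Require Import ring lra zify perm complex.

Set Implicit Arguments.
Unset Strict Implicit.
Unset Printing Implicit Defensive.

Import Order.TTheory GRing.Theory Num.Theory.
Import numFieldNormedType.Exports.
Local Open Scope classical_set_scope.
Local Open Scope ring_scope.

(** * Connecting words *)

(** A potential matters only up to bounded factors, so entry-sum norms, sums over all minors and
    crude cardinality constants are good enough throughout. Choosing [X Z] as the competitor of
    [Y^2] keeps [X] in both products: strong irreducibility of [X], or of both [Y] and [Z], is
    exactly what puts a strongly irreducible tuple into each of the pairs (X, Y) and (X, Z). Covers
    by several subspaces arise because failure of simultaneous connection is a disjunction: each
    word kills one of two pairings, so the orbit of x y^T lies in a union of two subspaces and not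
    in a single one. On the measure side the obstacle is the passage from cylinders to Borel sets.
    The Gibbs measure is a limit of averaged word frequencies along an ultrafilter, realised by the
    digits of a uniform point; absolute continuity comes from a duality inequality on clopen sets,
    without densities or martingales. Entropy and growth rates are infima of their finite-stage
    averages, so equality with the pressure in the limit becomes a bound valid at every word
    length. *)

Section LinearCovers.
Context {K : fieldType} {E : vectType K}.
Implicit Types (O : set E) (V M : {vspace E}) (s : seq {vspace E}).

(** A subspace of largest dimension inside [P] absorbs every [v] with [P v], since adjoining [v] to
    it stays inside [P]. *)
Lemma vspace_of_closed (P : E -> Prop) : P 0 ->
  (forall a u v, P u -> P v -> P (a *: u + v)) ->
  exists V, forall v, v \in V <-> P v.
Proof.
move=> P0 PD.
pose q n := `[< exists V, (forall v, v \in V -> P v) /\ \dim V = n >].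
have q0 : exists n, q n.
  exists 0; apply/asboolP; exists 0%VS; rewrite dimv0; split=> // v.
  by rewrite memv0 => /eqP ->.
have qle n : q n -> (n <= dim E)%N.
  by move=> /asboolP [V [_ <-]]; rewrite -dimvf dimvS ?subvf.
case: (ex_maxnP q0 qle) => n /asboolP [V [VP dV]] nmax.
exists V => v; split; [exact: VP|move=> Pv].
have /nmax : q (\dim (V + <[v]>)%VS).
  apply/asboolP; exists (V + <[v]>)%VS; split=> // w.
  case/memv_addP => u uV [w' /vlineP [a ->] ->].
  by rewrite addrC; apply: PD => //; exact: VP.
rewrite -dV => le; have : (V + <[v]> <= V)%VS.
  by rewrite -(geq_leqif (dimv_leqif_sup (addvSl V <[v]>))).
by rewrite subv_add => /andP [_]; rewrite -memvE.
Qed.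

Definition linear_cover O s := forall o, O o -> exists2 V, V \in s & o \in V.

(* A cover minimising first the top dimension [D], then the number of members of
   that dimension: such members cannot be cut down by finitely many subspaces. *)
Lemma minimal_linear_cover O : O !=set0 ->
  exists D s, [/\ linear_cover O s, forall V, V \in s -> (\dim V <= D)%N,
    exists2 M, M \in s & \dim M = D
  & forall M L, M \in s -> \dim M = D ->
     linear_cover (O `&` [set` M]) L -> exists2 V, V \in L & (M <= V)%VS].
Proof.
case=> o1 Oo1.
pose p D s := linear_cover O s /\ all (fun V => \dim V <= D)%N s.
have ex0 : exists D, `[< exists s, p D s >].
  exists (dim E); apply/asboolP; exists [:: fullv]; split.
    by move=> o _; exists fullv; rewrite ?mem_head ?memvf.
  by rewrite /= dimvf leqnn.
case: (ex_minnP ex0) => D /asboolP [s0 ps0] Dmin.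
pose c s := count (fun V => \dim V == D) s.
have ex1 : exists r, `[< exists s, p D s /\ c s = r >].
  by exists (c s0); apply/asboolP; exists s0.
case: (ex_minnP ex1) => r /asboolP [s [[cs ds] cr]] rmin.
exists D, s; split=> //.
- by move=> V Vs; exact: (allP ds).
- have [/hasP [M Ms /eqP dM]|/hasPn nh] := boolP (has (fun V => \dim V == D) s).
    by exists M.
  have lt V : V \in s -> (\dim V < D)%N.
    by move=> Vs; rewrite ltn_neqAle nh //= (allP ds).
  have [D0|D0] := posnP D; first by have [V /lt] := cs _ Oo1; rewrite D0.
  suff : (D <= D.-1)%N by rewrite -ltnS prednK // ltnn.
  apply: Dmin; apply/asboolP; exists s; split=> //.
  by apply/allP => V /lt; rewrite -{1}(prednK D0) ltnS.
- move=> M L Ms dM cL; apply: contrapT => nL.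
  have {}nL V : V \in L -> (\dim (M :&: V)%VS < D)%N.
    move=> VL; rewrite -dM (ltn_leqif (dimv_leqif_sup (capvSl M V))).
    apply/negP => le; apply: nL; exists V => //.
    by apply: subv_trans le _; exact: capvSr.
  (* Replacing [M] by its proper slices [M :&: V] gives a cover with one member of dimension [D]
     fewer, against the minimality of [r]. *)
  pose s' := rem M s ++ [seq (M :&: V)%VS | V <- L].
  have : (r <= c s')%N.
    apply: rmin; apply/asboolP; exists s'; split=> //; split.
      move=> o Oo; have [V Vs oV] := cs _ Oo.
      have [VM|VM] := eqVneq V M.
        have [|W WL oW] := cL o; first by split=> //=; rewrite -VM.
        exists (M :&: W)%VS; last by rewrite memv_cap -VM oV.
        by rewrite mem_cat map_f ?orbT.
      exists V => //; rewrite mem_cat; apply/orP; left.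
      by move: Vs; rewrite (perm_mem (perm_to_rem Ms)) inE (negPf VM).
    rewrite all_cat; apply/andP; split.
      by apply/allP => V /mem_rem /(allP ds).
    by apply/allP => _ /mapP [V VL ->]; exact/ltnW/nL.
  rewrite /c count_cat (_ : count _ (map _ _) = 0%N); last first.
    apply/eqP; rewrite -leqn0 leqNgt -has_count; apply/hasPn => _ /mapP [V VL ->].
    by rewrite neq_ltn nL.
  move: cr; rewrite /c (seq.permP (perm_to_rem Ms)) /= dM eqxx add1n addn0 => <-.
  by rewrite ltnn.
Qed.

End LinearCovers.

Section LinearMaps.
Context {K : fieldType} {U V : vectType K} (f : U -> V) (f_lin : linear f).

Let f_mixin := GRing.isLinear.Build K U V *:%R f f_lin.
Let f_linear : {linear U -> V} := HB.pack f f_mixin.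

Definition lin_hom : 'Hom(U, V) := linfun f_linear.

Lemma lin_homE u : lin_hom u = f u. Proof. by rewrite lfunE. Qed.

End LinearMaps.

Lemma col_mulmx (R : pzSemiRingType) m n p (A : 'M[R]_(m, n)) (B : 'M[R]_(n, p)) j :
  col j (A *m B) = A *m col j B.
Proof. by apply/colP => i; rewrite !mxE; apply: eq_bigr => k _; rewrite mxE. Qed.

Section Words.
Context {R : realType} {N : nat}.

Lemma mxword_cat d (A : 'I_N -> 'M[R]_d) u v :
  mxword A (u ++ v) = mxword A v *m mxword A u.
Proof.
rewrite /mxword foldl_cat.
elim/last_ind: v => [|v i IH]; first by rewrite /= mul1mx.
by rewrite !foldl_rcons IH mulmxA.
Qed.

Lemma mxword1 d (A : 'I_N -> 'M[R]_d) i : mxword A [:: i] = A i.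
Proof. by rewrite /mxword /= mulmx1. Qed.

Lemma mxword_rcons d (A : 'I_N -> 'M[R]_d) w i :
  mxword A (rcons w i) = A i *m mxword A w.
Proof. by rewrite /mxword foldl_rcons. Qed.

Lemma mxword_cons d (A : 'I_N -> 'M[R]_d) i w :
  mxword A (i :: w) = mxword A w *m A i.
Proof. by rewrite -cat1s mxword_cat mxword1. Qed.

Lemma mxword_unit d (A : 'I_N -> 'M[R]_d) w :
  (forall i, A i \in unitmx) -> mxword A w \in unitmx.
Proof.
move=> Au; elim/last_ind: w => [|w i IH]; first exact: unitmx1.
by rewrite mxword_rcons unitmx_mul Au.
Qed.

End Words.

(** * Simultaneous orbits of two matrix tuples *)

Section JointOrbits.
Context {R : realType} {N a b : nat}.
Variables (X : 'I_N -> 'M[R]_a) (Y : 'I_N -> 'M[R]_b).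
Hypotheses (X_unit : forall i, X i \in unitmx) (Y_unit : forall i, Y i \in unitmx).
Hypothesis X_irr : irreducible (fun i => linfun (mulmx (X i) : 'cV_a -> 'cV_a)).
Hypothesis Y_irr :
  strongly_irreducible (fun i => linfun (mulmx (Y i) : 'cV_b -> 'cV_b)).

(** The vectors annihilated by all rows [f *m mxword X w] form an invariant subspace, which is not
    everything because [f] is nonzero. *)
Lemma irreducible_pairing (f : 'rV[R]_a) (x : 'cV[R]_a) :
  f != 0 -> x != 0 -> exists w, f *m mxword X w *m x != 0.
Proof.
move=> f0 x0; apply: contrapT => nw.
have {}nw w : f *m mxword X w *m x = 0.
  by apply: contrapT => /eqP h; apply: nw; exists w.
have [||Q QP] := @vspace_of_closed R 'cV[R]_a
    (fun v => forall w, f *m mxword X w *m v = 0).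
- by move=> w; rewrite mulmx0.
- by move=> c u v hu hv w; rewrite mulmxDr -scalemxAr hu hv scaler0 addr0.
apply: X_irr; exists Q; split.
- apply: contraNneq x0 => Q0; rewrite -memv0 -Q0; exact/QP.
- apply: contraNneq f0 => Qf; apply/eqP/rowP => j.
  have /QP/(_ [::]) : delta_mx j 0 \in Q by rewrite Qf memvf.
  by rewrite mulmx1 -colE => /matrixP/(_ 0 0); rewrite !mxE.
- move=> i; apply/subvP => _ /memv_imgP [v /QP hv ->]; apply/QP => w.
  by rewrite lfunE /= mulmxA -(mulmxA f) -mxword_cons hv.
Qed.

(** The tensor product action: a rank-one matrix x y^T goes to (X_i x)(Y_i y)^T, so one orbit of
    matrices records both orbits of vectors. *)
Let T_lin i : linear (fun M : 'M[R]_(a, b) => X i *m M *m (Y i)^T).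
Proof. by move=> c u v; rewrite mulmxDr mulmxDl -scalemxAr -scalemxAl. Qed.
Let T i : 'End('M[R]_(a, b)) := lin_hom (T_lin i).

Let TE i M : T i M = X i *m M *m (Y i)^T. Proof. exact: lin_homE. Qed.

Let T_inj i : lker (T i) == 0%VS.
Proof.
apply/lker0P => u v; rewrite !TE => /(congr1 (fun M => invmx (X i) *m M *m invmx (Y i)^T)).
by rewrite !mulmxA mulVmx // !mul1mx !mulmxK // unitmx_tr.
Qed.

Let rowf_lin r : linear (fun M : 'M[R]_(a, b) => (row r M)^T).
Proof. by move=> c u v; rewrite linearP /= linearP. Qed.
Let rowf r : 'Hom('M[R]_(a, b), 'cV[R]_b) := lin_hom (rowf_lin r).

(** The span of the rows of all members of [M]. Left multiplication by an invertible matrix does not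
    change it, so it moves under [Y] alone and strong irreducibility of [Y] can be applied to it. *)
Let rows (M : {vspace 'M[R]_(a, b)}) : {vspace 'cV[R]_b} :=
  (\sum_(r < a) rowf r @: M)%VS.

Let rowsP (M : {vspace 'M[R]_(a, b)}) m (f : 'rV_a) :
  m \in M -> (f *m m)^T \in rows M.
Proof.
move=> mM; rewrite mulmx_sum_row linear_sum /=; apply: memv_suml => r _.
rewrite linearZ /= memvZ //; apply: (subvP (sumv_sup r _ (subvv _))) => //.
by rewrite -(lin_homE (rowf_lin r)) memv_img.
Qed.

Let rows_ind (M : {vspace 'M[R]_(a, b)}) (V : {vspace 'cV[R]_b}) :
  (forall m r, m \in M -> (row r m)^T \in V) -> (rows M <= V)%VS.
Proof.
move=> h; apply/subv_sumP => r _; apply/subvP => _ /memv_imgP [m mM ->].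
by rewrite lin_homE; exact: h.
Qed.

(** If every word killed one of the pairings, take a minimal cover of the orbit of x y^T. Strong
    irreducibility of [Y] yields a top-dimensional member [M] whose rows span everything. [M] cannot
    lie in a kernel on the [Y] side, so it lies in all kernels on the [X] side, and a nonzero column
    of [M] contradicts irreducibility of [X]. *)
Lemma joint_orbit_pairing (f : 'rV[R]_a) (x : 'cV[R]_a) (g : 'rV[R]_b)
    (y : 'cV[R]_b) : f != 0 -> x != 0 -> g != 0 -> y != 0 ->
  exists w, f *m mxword X w *m x != 0 /\ g *m mxword Y w *m y != 0.
Proof.
move=> f0 x0 g0 y0; apply: contrapT => nw.
have {}nw w : f *m mxword X w *m x = 0 \/ g *m mxword Y w *m y = 0.
  apply: contrapT => /not_orP [/eqP h1 /eqP h2].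
  by apply: nw; exists w.
pose z w := mxword X w *m x *m (mxword Y w *m y)^T.
have zT w i : T i (z w) = z (rcons w i).
  by rewrite TE /z !mxword_rcons !trmx_mul !mulmxA.
have z0 : z [::] != 0.
  rewrite /z !mul1mx; apply: contra_neq x0 => xy.
  have [j yj] : exists j, y j 0 != 0.
    apply: contrapT => h; case/eqP: y0; apply/colP => j; rewrite !mxE.
    by apply: contrapT => /eqP yj; apply: h; exists j.
  apply/colP => i; move/matrixP/(_ i j)/eqP: xy; rewrite !mxE big_ord1 !mxE.
  by rewrite mulf_eq0 (negPf yj) orbF => /eqP.
have [|D [s [cs ds [M0 M0s dM0] smin]]] :=
  @minimal_linear_cover R 'M[R]_(a, b) [set z w | w in setT].
  by exists (z [::]); apply: imageT.
have D0 : (0 < D)%N.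
  have [|V Vs zV] := cs (z [::]); first exact: imageT.
  apply: leq_trans (ds _ Vs); rewrite lt0n dimv_eq0.
  by apply: contraNneq z0 => V0; rewrite V0 memv0 in zV.
(* The preimages under [T i] of the covering subspaces also cover the orbit, so by minimality one of
   them contains [M]; as [T i] is injective and [D] is the top dimension, the image of [M] is itself
   a member of the cover. *)
have sT i M : M \in s -> \dim M = D ->
    ((T i @: M)%VS \in s) /\ \dim (T i @: M) = D.
  move=> Ms dM; have dTM : \dim (T i @: M) = D by rewrite limg_dim_eq ?(eqP (T_inj i)) ?capv0.
  have [|V] := smin M [seq (T i @^-1: V)%VS | V <- s] Ms dM.
    move=> _ [[w _ <-] _]; have [|V Vs zV] := cs (z (rcons w i)).
      exact: imageT.
    exists (T i @^-1: V)%VS; first exact: map_f.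
    by rewrite -memv_preim zT.
  case/mapP => {}V Vs -> MV.
  have TMV : (T i @: M <= V)%VS.
    by apply/subvP => _ /memv_imgP [m mM ->]; rewrite memv_preim (subvP MV).
  split=> //; suff -> : (T i @: M)%VS = V by [].
  by apply/eqP; rewrite -(geq_leqif (dimv_leqif_eq TMV)) dTM ds.
pose J := [seq M <- s | \dim M == D].
have M0J : M0 \in J by rewrite mem_filter M0s dM0 eqxx.
have JP M : M \in J -> M \in s /\ \dim M = D.
  by rewrite mem_filter => /andP [/eqP].
(* Otherwise the row spans of the top-dimensional members would be finitely many proper nonzero
   subspaces whose union is mapped into itself by [Y]. *)
have [M [Ms dM] Mfull] : exists2 M, M \in s /\ \dim M = D & rows M = fullv.
  apply: contrapT => nfull; apply: Y_irr.
  exists (size J), (fun j => rows (nth M0 J j)); split.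
  - by case: (J) M0J.
  - move=> j; have /JP [Ms dM] : nth M0 J j \in J by apply: mem_nth; exact: ltn_ord.
    split; last by apply/eqP => h; apply: nfull; exists (nth M0 J j).
    apply: contraTneq D0 => r0; rewrite -dM -eqn0Ngt dimv_eq0 -subv0.
    apply/subvP => m mM; rewrite memv0; apply/eqP/row_matrixP => r.
    have := rowsP (delta_mx 0 r) mM.
    by rewrite -rowE r0 memv0 row0 => /eqP /(congr1 trmx); rewrite trmxK trmx0.
  - move=> i _ [v [j _ /= vj] <-].
    have /JP [Ms dM] : nth M0 J j \in J by apply: mem_nth; exact: ltn_ord.
    have [TMs dTM] := sT i _ Ms dM.
    have TJ : (T i @: nth M0 J j)%VS \in J by rewrite mem_filter TMs dTM eqxx.
    have jlt : (index (T i @: nth M0 J j)%VS J < size J)%N by rewrite index_mem.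
    exists (Ordinal jlt) => //=; rewrite nth_index //.
    rewrite lfunE /= -[Y i *m v](lfunE (mulmx (Y i))) /= memv_preim.
    apply: (subvP _ _ vj); apply: rows_ind => m r mM.
    rewrite -memv_preim lfunE /= -[Y i *m _]trmxK trmx_mul trmxK.
    (* Multiplying by [invmx (X i)] undoes the mixing of rows caused by [X i]. *)
    have -> : row r m *m (Y i)^T = row r (invmx (X i)) *m T i m.
      by rewrite TE -!row_mul -!mulmxA mulKmx.
    by apply: rowsP; exact: memv_img.
(* Applying the assumed disjunction to [w ++ u] covers the orbit points in [M] by two kernels, so
   minimality puts all of [M] into one of them; the second would force [g *m mxword Y u] to
   vanish. *)
have killed u m : m \in M -> f *m mxword X u *m m = 0.
  move=> mM.
  have lf : linear (fun m : 'M[R]_(a, b) => f *m mxword X u *m m).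
    by move=> c p q; rewrite mulmxDr -scalemxAr.
  have lg : linear (fun m : 'M[R]_(a, b) => g *m mxword Y u *m m^T).
    by move=> c p q; rewrite linearP /= mulmxDr -scalemxAr.
  have [|V] := smin M [:: lker (lin_hom lf); lker (lin_hom lg)] Ms dM.
    move=> _ [[w _ <-] _]; have [h|h] := nw (w ++ u).
      exists (lker (lin_hom lf)); first exact: mem_head.
      have e : f *m mxword X u *m (mxword X w *m x) = 0.
        by rewrite mulmxA -(mulmxA f) -mxword_cat.
      by rewrite memv_ker lin_homE /z mulmxA e mul0mx.
    exists (lker (lin_hom lg)); first by rewrite !inE eqxx orbT.
    have e : g *m mxword Y u *m (mxword Y w *m y) = 0.
      by rewrite mulmxA -(mulmxA g) -mxword_cat.
    by rewrite memv_ker lin_homE /z trmx_mul trmxK mulmxA e mul0mx.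
  rewrite !inE => /orP [] /eqP -> /subvP sub.
    by have := sub _ mM; rewrite memv_ker lin_homE => /eqP.
  have lh : linear (fun v : 'cV[R]_b => g *m mxword Y u *m v).
    by move=> c p q; rewrite mulmxDr -scalemxAr.
  have /subvP rowsK : (rows M <= lker (lin_hom lh))%VS.
    apply: rows_ind => p r /sub; rewrite !memv_ker !lin_homE => /eqP h.
    by rewrite tr_row -col_mulmx h col0.
  have gY (v : 'cV[R]_b) : g *m mxword Y u *m v = 0.
    by have := rowsK v; rewrite Mfull memvf memv_ker lin_homE => /(_ isT)/eqP.
  case/eqP: g0; rewrite -[g](mulmxK (mxword_unit u Y_unit)).
  suff -> : g *m mxword Y u = 0 by rewrite mul0mx.
  apply/rowP => j; have := gY (delta_mx j 0).
  by rewrite -colE => /colP/(_ 0); rewrite !mxE.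
have [m mM [c mc]] : exists2 m, m \in M & exists c, col c m != 0.
  apply: contrapT => h; move: D0; rewrite -dM lt0n dimv_eq0 => /eqP; apply.
  apply/eqP; rewrite -subv0; apply/subvP => m mM; rewrite memv0.
  apply/eqP/matrixP => p q; apply: contrapT => pq; apply: h; exists m => //.
  exists q; apply/eqP => /colP/(_ p); rewrite !mxE => e.
  by apply: pq; rewrite e mxE.
have [w] := irreducible_pairing f0 mc.
by rewrite -col_mulmx killed // col0 eqxx.
Qed.

End JointOrbits.

Section EntrySum.
Context {R : realType}.

Definition norm1 {m n} (M : 'M[R]_(m, n)) : R := \sum_i \sum_j `|M i j|.

Lemma norm1_ge0 m n (M : 'M[R]_(m, n)) : 0 <= norm1 M.
Proof. by apply: sumr_ge0 => i _; exact: sumr_ge0. Qed.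

Lemma ler_norm1 m n (M : 'M[R]_(m, n)) i j : `|M i j| <= norm1 M.
Proof.
rewrite /norm1 (bigD1 i) //= (bigD1 j) //= -addrA lerDl addr_ge0 //.
  exact: sumr_ge0.
by apply: sumr_ge0 => k _; exact: sumr_ge0.
Qed.

Lemma norm1_eq0 m n (M : 'M[R]_(m, n)) : norm1 M = 0 -> M = 0.
Proof.
move=> h; apply/matrixP => i j; rewrite mxE; apply/eqP.
by rewrite -normr_le0 -h ler_norm1.
Qed.

Lemma norm1_gt0 m n (M : 'M[R]_(m, n)) : M != 0 -> 0 < norm1 M.
Proof.
move=> M0; rewrite lt_def norm1_ge0 andbT.
by apply: contraNneq M0 => /norm1_eq0 ->.
Qed.

Lemma norm1M m n p (A : 'M[R]_(m, n)) (B : 'M[R]_(n, p)) :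
  norm1 (A *m B) <= norm1 A * norm1 B.
Proof.
rewrite /norm1 mulr_suml; apply: ler_sum => i _.
rewrite mulr_suml.
apply: (@le_trans _ _ (\sum_k \sum_j `|A i k| * `|B k j|)).
  rewrite exchange_big /=; apply: ler_sum => j _; rewrite mxE.
  apply: le_trans (ler_norm_sum _ _ _) _.
  by apply: ler_sum => k _; rewrite normrM.
apply: ler_sum => k _; rewrite -mulr_sumr ler_wpM2l //.
rewrite [leRHS](bigD1 k) //= lerDl; apply: sumr_ge0 => l _; exact: sumr_ge0.
Qed.

Lemma norm1_tr m n (M : 'M[R]_(m, n)) : norm1 M^T = norm1 M.
Proof.
rewrite /norm1 exchange_big; apply: eq_bigr => i _.
by apply: eq_bigr => j _; rewrite mxE.
Qed.

Lemma norm1_le m n (M : 'M[R]_(m, n)) : norm1 M <= (m * n)%:R * `|M|.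
Proof.
have h i j : `|M i j| <= `|M|.
  rewrite [leRHS]/Num.norm /= mx_normrE; apply/bigmax_geP; right => /=.
  by exists (i, j).
rewrite /norm1; apply: (@le_trans _ _ (\sum_(i < m) \sum_(j < n) `|M|)).
  by apply: ler_sum => i _; apply: ler_sum => j _; exact: h.
by rewrite !sumr_const !card_ord -mulrnA mulr_natl mulnC.
Qed.

Lemma mx_norm_entry m n (M : 'M[R]_(m, n)) : M != 0 ->
  exists i j, `|M| = `|M i j|.
Proof.
move=> M0; have /mx_norm_neq0 [[i j] /= h] : mx_norm M != 0.
  by apply: contra_neq M0; exact: mx_norm_eq0.
by exists i, j.
Qed.

End EntrySum.

(** * Uniform connecting words by compactness *)

Section QuasiMultiplicativity.
Context {R : realType} {N a b : nat}.
Variables (X : 'I_N -> 'M[R]_a) (Y : 'I_N -> 'M[R]_b).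
Hypotheses (a_gt0 : (0 < a)%N) (b_gt0 : (0 < b)%N).
Hypotheses (X_unit : forall i, X i \in unitmx) (Y_unit : forall i, Y i \in unitmx).
Hypothesis X_irr : irreducible (fun i => linfun (mulmx (X i) : 'cV_a -> 'cV_a)).
Hypothesis Y_irr :
  strongly_irreducible (fun i => linfun (mulmx (Y i) : 'cV_b -> 'cV_b)).

(** Both vectors are stored as rows, so that the same unit sphere is used for either of them. *)
Let pairing {n} (M : 'M[R]_n) (u : 'rV[R]_n * 'rV[R]_n) : R :=
  (u.1 *m M *m u.2^T) 0 0.

Let pairing_continuous n (M : 'M[R]_n) : continuous (pairing M).
Proof.
have -> : pairing M = fun u => \sum_j (\sum_k u.1 0 k * M k j) * u.2 0 j.
  by apply/funext => u; rewrite /pairing mxE; under eq_bigr do rewrite !mxE.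
move=> u; apply: (@continuous_big _ _ +%R 0).
  exact: add_continuous.
move=> j _ {}u; apply: continuousM; last first.
  apply: (@continuous_comp _ _ _ snd (fun v : 'rV[R]_n => v 0 j)).
    exact: cvg_snd.
  exact: coord_continuous.
apply: (@continuous_big _ _ +%R 0); first exact: add_continuous.
move=> k _ {}u; apply: continuousM; last exact: cst_continuous.
apply: (@continuous_comp _ _ _ fst (fun v : 'rV[R]_n => v 0 k)).
  exact: cvg_fst.
exact: coord_continuous.
Qed.

Let pairing_near n (M : 'M[R]_n) p (e : R) : e < `|pairing M p| ->
  \forall u \near p, e < `|pairing M u|.
Proof.
have c : `|pairing M u| @[u --> p] --> `|pairing M p|.
  by apply: (@cvg_norm _ R^o); exact: pairing_continuous.
by move=> h; refine (@cvgr_gt _ _ _ _ (fun u => `|pairing M u|) _ c _ h).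
Qed.

Let unit_vec n : set 'rV[R]_n := [set v | `|v| = 1].

Let unit_vec_compact n : compact (@unit_vec n).
Proof.
apply: bounded_closed_compact.
  by exists 1; split=> // x x1 v /= ->; exact: ltW.
rewrite (_ : @unit_vec n = (fun v : 'rV[R]_n => `|v|) @^-1` [set 1]) //.
apply: preimage_closed; last exact: closed_eq.
by move=> v _; exact: norm_continuous.
Qed.

(** A word that pairs nontrivially at one quadruple of unit vectors does so nearby; compactness of
    the product of spheres makes length and bound uniform, and homogeneity removes the
    normalisation. *)
Lemma uniform_joint_pairing : exists L (c : R), 0 < c /\
  forall (f x : 'rV[R]_a) (g y : 'rV[R]_b), exists w : seq 'I_N,
    [/\ (size w <= L)%N, c * (`|f| * `|x|) <= `|pairing (mxword X w) (f, x)|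
      & c * (`|g| * `|y|) <= `|pairing (mxword Y w) (g, y)|].
Proof.
pose K := ((@unit_vec a `*` @unit_vec a) `*` (@unit_vec b `*` @unit_vec b)).
have cK : compact K by do ![apply: compact_setX].
(* A single index controls both the word length and the lower bound, so that the covering form of
   compactness returns one number. *)
pose P n (u : ('rV[R]_a * 'rV[R]_a) * ('rV[R]_b * 'rV[R]_b)) :=
  exists2 w : seq 'I_N, (size w <= n)%N &
    n.+1%:R^-1 < `|pairing (mxword X w) u.1| /\ n.+1%:R^-1 < `|pairing (mxword Y w) u.2|.
have nP : \forall n \near \oo, K `<=` P n.
  move/compact_near_coveringP: cK; apply => -[[f x] [g y]] [[/= f1 x1] [/= g1 y1]].
  have n0 n (v : 'rV[R]_n) : unit_vec v -> v != 0.
    by rewrite /unit_vec /= => v1; rewrite -normr_eq0 v1 oner_eq0.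
  have n0' n (v : 'rV[R]_n) : unit_vec v -> v^T != 0.
    by move=> /n0; apply: contra_neq => /(congr1 trmx); rewrite trmxK trmx0.
  have [w [/eqP w1 /eqP w2]] := joint_orbit_pairing X_unit Y_unit X_irr Y_irr
    (n0 _ _ f1) (n0' _ _ x1) (n0 _ _ g1) (n0' _ _ y1).
  have p1 : 0 < `|pairing (mxword X w) (f, x)|.
    rewrite normr_gt0; apply/eqP => e; apply: w1; apply/matrixP => i j.
    by rewrite !ord1 -/(pairing _ (f, x)) e mxE.
  have p2 : 0 < `|pairing (mxword Y w) (g, y)|.
    rewrite normr_gt0; apply/eqP => e; apply: w2; apply/matrixP => i j.
    by rewrite !ord1 -/(pairing _ (g, y)) e mxE.
  pose m := Num.min `|pairing (mxword X w) (f, x)| `|pairing (mxword Y w) (g, y)|.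
  have m0 : 0 < m by rewrite lt_min p1 p2.
  pose e := m / 2; have e0 : 0 < e by rewrite divr_gt0.
  have em : e < m by rewrite ltr_pdivrMr // ltr_pMr // ltr1n.
  have e1 : e < `|pairing (mxword X w) (f, x)|.
    by apply: lt_le_trans em _; rewrite /m ge_min lexx.
  have e2 : e < `|pairing (mxword Y w) (g, y)|.
    by apply: lt_le_trans em _; rewrite /m ge_min lexx orbT.
  exists ([set u | e < `|pairing (mxword X w) u.1|] `&` [set u | e < `|pairing (mxword Y w) u.2|],
    [set n | (size w <= n)%N] `&` [set n | n.+1%:R^-1 < e]) => /=.
    split; last first.
      apply: filterI; first by exists (size w).
      exact: (near_infty_natSinv_lt (PosNum e0)).
    apply: filterI.
      exact: (cvg_fst (pairing_near e1)).
    exact: (cvg_snd (pairing_near e2)).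
  move=> [u n] [[/= u1 u2] [wn ne]]; exists w => //.
  by split; exact: lt_trans ne _.
have [L LP] : exists L, K `<=` P L.
  by near \oo => n; exists n; near: n.
exists L, L.+1%:R^-1; split; first by rewrite invr_gt0.
have nrm n (v : 'rV[R]_n) : (0 < n)%N ->
    exists2 u : 'rV[R]_n, unit_vec u & v = `|v| *: u.
  move=> n0; have [->|v0] := eqVneq v 0.
    (* For the zero vector any unit vector will do, as it gets scaled by 0. *)
    exists (const_mx 1); last by rewrite normr0 scale0r.
    have c0 : const_mx 1 != 0 :> 'rV[R]_n.
      by apply/eqP => /rowP/(_ (Ordinal n0))/eqP; rewrite !mxE oner_eq0.
    by have [i [j]] := mx_norm_entry c0; rewrite mxE normr1.
  exists (`|v|^-1 *: v); last by rewrite scalerA divff ?normr_eq0 // scale1r.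
  by rewrite /unit_vec /= normrZ normfV normr_id mulVf ?normr_eq0.
have pairZ n (M : 'M[R]_n) s t u v :
    pairing M (s *: u, t *: v) = s * t * pairing M (u, v).
  by rewrite /pairing /= linearZ /= -!scalemxAl -scalemxAr !mxE mulrA.
move=> f x g y.
have [f' f1 ->] := nrm _ f a_gt0; have [x' x1 ->] := nrm _ x a_gt0.
have [g' g1 ->] := nrm _ g b_gt0; have [y' y1 ->] := nrm _ y b_gt0.
have [|w wL [/= wf wg]] := LP ((f', x'), (g', y')); first by [].
rewrite /unit_vec /= in f1 x1 g1 y1.
exists w; split=> //.
  by rewrite pairZ !normrZ f1 x1 !mulr1 ?normrM !normr_id mulrC ler_wpM2l ?mulr_ge0 // ltW.
by rewrite pairZ !normrZ g1 y1 !mulr1 ?normrM !normr_id mulrC ler_wpM2l ?mulr_ge0 // ltW.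
Unshelve. all: by end_near. Qed.

(** Some row of [U] and some column of [V] carry a fixed proportion of the norms, and pairing them
    through a word produces an entry of the product. *)
Lemma joint_quasi_multiplicative : exists L (c : R), 0 < c /\
  forall (U1 V1 : 'M[R]_a) (U2 V2 : 'M[R]_b), exists w : seq 'I_N,
    [/\ (size w <= L)%N,
      c * (norm1 U1 * norm1 V1) <= norm1 (U1 *m mxword X w *m V1)
    & c * (norm1 U2 * norm1 V2) <= norm1 (U2 *m mxword Y w *m V2)].
Proof.
have [L [c [c0 h]]] := uniform_joint_pairing.
have row_norm n (U : 'M[R]_n) : (0 < n)%N ->
    exists i, norm1 U <= (n * n)%:R * `|row i U|.
  move=> n0; have [->|/mx_norm_entry [i [j e]]] := eqVneq U 0.
    exists (Ordinal n0); apply: le_trans (norm1_le _) _.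
    by rewrite normr0 mulr0 mulr_ge0.
  exists i; apply: le_trans (norm1_le _) _; rewrite ler_wpM2l // e.
  have -> : U i j = row i U 0 j by rewrite mxE.
  rewrite [leRHS]/Num.norm /= mx_normrE; apply/bigmax_geP; right => /=.
  by exists (0, j).
have col_norm n (U : 'M[R]_n) : (0 < n)%N ->
    exists j, norm1 U <= (n * n)%:R * `|(col j U)^T|.
  move=> n0; have [j hj] := row_norm _ U^T n0; exists j; rewrite tr_col.
  by rewrite -norm1_tr.
have entry n (U W V : 'M[R]_n) i j :
    `|pairing W (row i U, (col j V)^T)| <= norm1 (U *m W *m V).
  apply: le_trans (ler_norm1 _ i j); rewrite /pairing /= trmxK -row_mul -col_mulmx.
  by rewrite -row_mul 2!mxE.
pose D n : R := (n * n)%:R.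
have D0 n : 0 <= D n by [].
(* The sum dominates the loss in either dimension, so [c / q] serves both tuples. *)
pose q := D a * D a + D b * D b.
have bnd n c' (U W V : 'M[R]_n) i j : 0 < q -> 0 <= c' -> D n * D n <= q ->
    norm1 U <= D n * `|row i U| -> norm1 V <= D n * `|(col j V)^T| ->
    c' * (`|row i U| * `|(col j V)^T|) <= `|pairing W (row i U, (col j V)^T)| ->
    c' / q * (norm1 U * norm1 V) <= norm1 (U *m W *m V).
  move=> q0 c'0 Dq hU hV hp; apply: le_trans (entry _ _ _ _ i j).
  apply: le_trans hp; rewrite -mulrA ler_wpM2l // ler_pdivrMl //.
  apply: (le_trans (ler_pM (norm1_ge0 _) (norm1_ge0 _) hU hV)).
  by rewrite mulrACA ler_wpM2r // mulr_ge0.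
have q0 : 0 < q by rewrite addr_gt0 // mulr_gt0 // ltr0n muln_gt0 ?a_gt0 ?b_gt0.
exists L, (c / q); split; first by rewrite divr_gt0.
move=> U1 V1 U2 V2.
have [i1 hi1] := row_norm _ U1 a_gt0; have [j1 hj1] := col_norm _ V1 a_gt0.
have [i2 hi2] := row_norm _ U2 b_gt0; have [j2 hj2] := col_norm _ V2 b_gt0.
have [w [wL h1 h2]] := h (row i1 U1) (col j1 V1)^T (row i2 U2) (col j2 V2)^T.
exists w; split=> //.
  by apply: bnd hi1 hj1 h1 => //; [exact: ltW | rewrite lerDl mulr_ge0].
by apply: bnd hi2 hj2 h2 => //; [exact: ltW | rewrite lerDr mulr_ge0].
Qed.

End QuasiMultiplicativity.

(** * Minors and singular values *)

Section FunctionMinors.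
Context {K : comNzRingType} {l d : nat}.
Local Notation idxf := {ffun 'I_l -> 'I_d}.
Implicit Types (A B : 'M[K]_d) (f g h : idxf).

Definition fminor A f g : K := \det (mxsub f g A).

Lemma fminor_not_inj A f g : ~~ injectiveb f -> fminor A f g = 0.
Proof.
move=> /injectivePn [i [j ij fij]]; apply: (determinant_alternate ij) => k.
by rewrite !mxE fij.
Qed.

(* Summing over all index functions instead of subsets counts every minor l!
   times and spares the bookkeeping of signs. *)
Lemma fminorM A B f h :
  fminor (A *m B) f h *+ l`! = \sum_g fminor A f g * fminor B g h.
Proof.
have expand : fminor (A *m B) f h =
    \sum_(g : idxf) (\prod_i A (f i) (g i)) * fminor B g h.
  rewrite /fminor mxsub_mul /determinant.
  under eq_bigr => s _ do under eq_bigr => i _ do rewrite mxE.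
  under eq_bigr => s _ do rewrite bigA_distr_bigA /= big_distrr /=.
  rewrite exchange_big /=; apply: eq_bigr => g _.
  rewrite big_distrr /=; apply: eq_bigr => s _.
  rewrite mulrCA -big_split /=; congr (_ * _).
  by apply: eq_bigr => i _; rewrite !mxE.
rewrite {2}/fminor /determinant.
under eq_bigr => g _ do rewrite big_distrl /=.
rewrite exchange_big /= -card_Sn -sumr_const.
apply: eq_bigr => s _; rewrite expand.
pose c (g : idxf) : idxf := [ffun i => g (s i)].
have c_inj : injective c.
  move=> g g' /ffunP e; apply/ffunP => i; have := e ((s^-1)%g i).
  by rewrite !ffunE permKV.
rewrite [LHS](reindex_inj c_inj) /=; apply: eq_bigr => g _.
have -> : fminor B (c g) h = (-1) ^+ s * fminor B g h.
  rewrite /fminor; have -> : mxsub (c g) h B = row_perm s (mxsub g h B).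
    by apply/matrixP => i j; rewrite !mxE ffunE.
  by rewrite row_permE det_mulmx det_perm.
rewrite mulrA; congr (_ * _); rewrite mulrC; congr (_ * _).
by apply: eq_bigr => i _; rewrite !mxE ffunE.
Qed.

(** This is tr(AB) = tr(BA) for compound matrices, with every minor counted repeatedly. *)
Lemma sum_fminorC A B :
  \sum_f fminor (A *m B) f f *+ l`! = \sum_f fminor (B *m A) f f *+ l`!.
Proof.
under eq_bigr do rewrite fminorM; under [RHS]eq_bigr do rewrite fminorM.
rewrite exchange_big /=; apply: eq_bigr => f _; apply: eq_bigr => g _.
by rewrite mulrC.
Qed.

Lemma fminor_tr A f g : fminor A^T f g = fminor A g f.
Proof. by rewrite /fminor -det_tr; congr (\det _); apply/matrixP => i j; rewrite !mxE. Qed.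

(** As [f] need not be monotone, the submatrix need not be triangular. A nonzero Leibniz term still
    forces [f (s i) <= f i] for every [i]; both sides have the same sum, so [s] is the identity. *)
Lemma fminor_trig A f : is_trig_mx A -> injective f ->
  fminor A f f = \prod_i A (f i) (f i).
Proof.
move=> /is_trig_mxP A_trig f_inj; rewrite /fminor /determinant (bigD1 (1%g : 'S_l)) //=.
rewrite odd_perm1 expr0 mul1r [X in _ + X]big1 ?addr0.
  by apply: eq_bigr => i _; rewrite mxE perm1.
move=> s s1.
have [le|/forallPn [j]] := boolP [forall i, (f (s i) <= f i)%N]; last first.
  rewrite -ltnNge => lt; rewrite (bigD1 j) //= mxE A_trig // mul0r mulr0 //.
case/eqP: s1; apply/permP => i; rewrite perm1; apply: f_inj.
have eqs : \sum_i (f (s i) : nat) = \sum_i (f i : nat).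
  by rewrite [RHS](reindex_inj (@perm_inj _ s)).
have := @leqif_sum _ xpredT (fun i => f (s i) == f i)
  (fun i => f (s i) : nat) (fun i => f i : nat).
case=> [j _|_]; first by split; [exact: (forallP le) | rewrite -val_eqE].
by rewrite eqs eqxx => /esym/forallP/(_ i)/eqP.
Qed.

End FunctionMinors.

Section MinorSum.
Context {K : numFieldType} {l d : nat}.
Local Notation idxf := {ffun 'I_l -> 'I_d}.
Implicit Types (A B P : 'M[K]_d) (f g h : idxf).

(** Defined over a [numFieldType], because triangular forms live over [R[i]] while the tuples are
    real. *)
Definition minor_sum A : K := \sum_f \sum_g `|@fminor _ l _ A f g|.

Lemma minor_sum_ge0 A : 0 <= minor_sum A.
Proof. by apply: sumr_ge0 => f _; exact: sumr_ge0. Qed.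

Lemma fminor_le A f g : `|fminor A f g| <= minor_sum A.
Proof.
rewrite /minor_sum (bigD1 f) //= (bigD1 g) //= -addrA lerDl addr_ge0 //.
  exact: sumr_ge0.
by apply: sumr_ge0 => k _; exact: sumr_ge0.
Qed.

Lemma norm_fminorM A B f h :
  `|fminor (A *m B) f h| * l`!%:R <= \sum_g `|fminor A f g| * `|fminor B g h|.
Proof.
rewrite -[l`!%:R]ger0_norm // -normrM mulr_natr fminorM.
apply: le_trans (ler_norm_sum _ _ _) _.
by apply: ler_sum => g _; rewrite normrM.
Qed.

Lemma fact_ge1 : 1 <= l`!%:R :> K. Proof. by rewrite ler1n fact_gt0. Qed.

Lemma minor_sumM A B : minor_sum (A *m B) <= minor_sum A * minor_sum B.
Proof.
rewrite [in leRHS]/minor_sum mulr_suml; apply: ler_sum => f _.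
apply: (@le_trans _ _ (\sum_h \sum_g `|fminor A f g| * `|fminor B g h|)).
  apply: ler_sum => h _; apply: le_trans (norm_fminorM _ _ _ _).
  by rewrite ler_peMr // fact_ge1.
rewrite exchange_big /= mulr_suml; apply: ler_sum => g _.
rewrite -mulr_sumr ler_wpM2l //.
by rewrite /minor_sum [leRHS](bigD1 g) //= lerDl; apply: sumr_ge0 => k _; exact: sumr_ge0.
Qed.

(** After reindexing the columns by each permutation of the Leibniz expansion, the sum over all [g]
    factors into a product of row sums. *)
Lemma sum_norm_fminor_le A f :
  \sum_g `|fminor A f g| <= l`!%:R * \prod_i \sum_j `|A (f i) j|.
Proof.
apply: (@le_trans _ _ (\sum_(g : idxf) \sum_(s : 'S_l) \prod_i `|A (f i) (g (s i))|)).
  apply: ler_sum => g _; apply: le_trans (ler_norm_sum _ _ _) _.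
  apply: ler_sum => s _; rewrite normrM normrX normrN1 expr1n mul1r normr_prod.
  by under eq_bigr do rewrite mxE.
rewrite exchange_big /= -card_Sn -sum1_card natr_sum mulr_suml.
rewrite [leRHS](eq_bigl xpredT) /=; last by move=> s; rewrite inE.
apply: ler_sum => s _; rewrite mul1r bigA_distr_bigA /=.
pose c (g : idxf) : idxf := [ffun i => g (s i)].
have c_inj : injective c.
  move=> g g' /ffunP e; apply/ffunP => i; have := e ((s^-1)%g i).
  by rewrite !ffunE permKV.
rewrite [leRHS](reindex_inj c_inj) /= le_eqVlt; apply/orP; left; apply/eqP.
by apply: eq_bigr => g _; apply: eq_bigr => i _; rewrite ffunE.
Qed.

Fixpoint mxpow (A : 'M[K]_d) n : 'M[K]_d := if n is n'.+1 then A *m mxpow A n' else 1%:M.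

(** The l! lost in the row-sum bound cancels the l! of [fminorM], so each further factor costs
    exactly [r] and the constant does not compound with [n]. *)
Lemma minor_sum_pow_le A (r : K) n : 0 <= r ->
  (forall f, injective f -> \prod_i \sum_j `|A (f i) j| <= r) ->
  minor_sum (mxpow A n) <= minor_sum 1%:M * #|{: idxf}|%:R * r ^+ n.
Proof.
move=> r0 Ar.
suff h f : \sum_g `|fminor (mxpow A n) f g| <= minor_sum 1%:M * r ^+ n.
  rewrite /minor_sum; apply: le_trans (ler_sum _ (fun f _ => h f)) _.
  by rewrite sumr_const -[_ *+ _]mulr_natr mulrAC.
elim: n f => [|n IH] f /=.
  rewrite expr0 mulr1 /minor_sum [leRHS](bigD1 f) //= lerDl.
  by apply: sumr_ge0 => k _; exact: sumr_ge0.
have [/injectiveP f_inj|nf] := boolP (injectiveb f); last first.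
  rewrite big1 ?mulr_ge0 ?exprn_ge0 ?minor_sum_ge0 // => g _.
  by rewrite fminor_not_inj ?normr0.
have l0 : 0 < l`!%:R :> K by rewrite ltr0n fact_gt0.
rewrite -(ler_pM2r l0) mulr_suml.
apply: (le_trans (ler_sum _ (fun h _ => norm_fminorM _ _ _ _))).
rewrite exchange_big /=.
apply: (@le_trans _ _ (\sum_g `|fminor A f g| * (minor_sum 1%:M * r ^+ n))).
  by apply: ler_sum => g _; rewrite -mulr_sumr ler_wpM2l.
rewrite -mulr_suml exprSr mulrC -!mulrA ler_wpM2l ?minor_sum_ge0 //.
rewrite ler_wpM2l ?exprn_ge0 //.
apply: le_trans (sum_norm_fminor_le _ _) _.
by rewrite mulrC ler_wpM2r ?Ar // ltW.
Qed.

Lemma mxpow_similar P A B n : P \in unitmx -> A = invmx P *m B *m P ->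
  mxpow A n = invmx P *m mxpow B n *m P.
Proof.
move=> Pu AE; elim: n => [|n IH] /=; first by rewrite mulmx1 mulVmx.
by rewrite IH AE !mulmxA mulmxK.
Qed.

Lemma mxpow_trig A n : is_trig_mx A ->
  is_trig_mx (mxpow A n) /\ forall i, mxpow A n i i = A i i ^+ n.
Proof.
move=> /is_trig_mxP At; elim: n => [|n [/is_trig_mxP IH1 IH2]] /=.
  by split; [exact: scalar_mx_is_trig | move=> i; rewrite mxE eqxx].
split=> [|i].
  apply/is_trig_mxP => i j ij; rewrite mxE big1 // => k _.
  have [ik|ki] := ltnP i k; first by rewrite At // mul0r.
  by rewrite IH1 ?mulr0 // (leq_ltn_trans ki).
rewrite mxE (bigD1 i) //= big1 ?addr0 ?IH2 ?exprS // => k ki.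
have [ik|] := ltnP i k; first by rewrite At // mul0r.
by rewrite leq_eqVlt val_eqE (negPf ki) /= => kl; rewrite IH1 ?mulr0.
Qed.

End MinorSum.

Section RearrangedProducts.
Context {R : realType}.
Implicit Types (s : seq R) (t : seq nat).

(** By pigeonhole n + 1 distinct naturals include some [m >= n]; trade [F m] for [F n] and induct on
    the remaining list. *)
Lemma prod_uniq_le (F : nat -> R) d t :
  (forall i j, (i <= j < d)%N -> 0 <= F j <= F i) -> uniq t ->
  (forall i, i \in t -> (i < d)%N) ->
  \prod_(i <- t) F i <= \prod_(i < size t) F i.
Proof.
move=> Fdec; elim: {t}(size t) {-2}t (erefl (size t)) => [|n IH] t szt tU td.
  by rewrite (size0nil szt) big_nil big_ord0.
have [m mt nm] : exists2 m, m \in t & (n <= m)%N.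
  apply: contrapT => h; have : (size t <= size (iota 0 n))%N.
    apply: uniq_leq_size => // m mt; rewrite mem_iota /= add0n ltnNge.
    by apply/negP => nm; apply: h; exists m.
  by rewrite szt size_iota ltnn.
have szr : size (rem m t) = n by rewrite size_rem // szt.
rewrite szt (perm_big _ (perm_to_rem mt)) big_cons big_ord_recr /= mulrC.
have r0 i : i \in rem m t -> 0 <= F i.
  by move=> /mem_rem /td id; have /andP [] : 0 <= F i <= F i by apply: Fdec; rewrite leqnn.
have /andP [Fm0 Fmn] : 0 <= F m <= F n by rewrite Fdec // nm td.
apply: ler_pM => //; first by rewrite big_seq; apply: prodr_ge0 => i /r0.
have := IH (rem m t) szr; rewrite szr; apply; first exact: rem_uniq.
by move=> i /mem_rem /td.
Qed.

(** Applied to the diagonal of a triangular matrix, this finds the dominant principal minor of order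
    [l]. *)
Lemma top_products d (a : 'I_d -> R) s l : (forall i, 0 <= a i) ->
  sorted >=%R s -> perm_eq [seq a i | i <- enum 'I_d] s -> (l <= d)%N ->
  (forall f : {ffun 'I_l -> 'I_d}, injective f ->
     \prod_i a (f i) <= \prod_(j < l) s`_j) /\
  exists2 f : {ffun 'I_l -> 'I_d}, injective f & \prod_i a (f i) = \prod_(j < l) s`_j.
Proof.
move=> a0 s_sorted pas ld.
have szs : size s = d by rewrite -(perm_size pas) size_map size_enum_ord.
have /perm_iotaP -/(_ 0) [Is pIs aE] := pas.
have szI : size Is = d by rewrite (perm_size pIs) size_iota.
have aI (i : 'I_d) : a i = s`_(nth 0%N Is i).
  have := congr1 (fun q => q`_i) aE; rewrite (nth_map i) ?size_enum_ord //.
  by rewrite nth_ord_enum (nth_map 0%N) ?szI.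
have IU : uniq Is by rewrite (perm_uniq pIs) iota_uniq.
have Id (i : 'I_d) : (nth 0%N Is i < d)%N.
  have : nth 0%N Is i \in Is by rewrite mem_nth // szI.
  by rewrite (perm_mem pIs) mem_iota szs.
pose p (i : 'I_d) : 'I_d := Ordinal (Id i).
have p_inj : injective p.
  move=> i j /(congr1 val) /= e; apply/val_inj/eqP.
  have <- : (nth 0%N Is i == nth 0%N Is j) = (i == j :> nat) by rewrite nth_uniq ?szI.
  by rewrite e.
have sdec i j : (i <= j < d)%N -> 0 <= s`_j <= s`_i.
  move=> /andP [ij jd]; apply/andP; split.
    have /mapP [k _ ->] : s`_j \in [seq a i | i <- enum 'I_d].
      by rewrite (perm_mem pas) mem_nth // szs.
    exact: a0.
  have tr : transitive (>=%R : rel R) by move=> x y z xy yz; exact: le_trans yz xy.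
  by apply: (sorted_leq_nth tr (@lexx _ R) 0 s_sorted) => //;
    rewrite inE szs // (leq_ltn_trans ij).
split=> [f f_inj|].
  have -> : \prod_i a (f i) = \prod_(m <- [seq val (p (f i)) | i <- enum 'I_l]) s`_m.
    by rewrite big_map big_enum /=; apply: eq_bigr => i _; rewrite aI.
  apply: le_trans (prod_uniq_le sdec _ _) _.
  - rewrite map_inj_uniq ?enum_uniq // => i j e.
    by apply: f_inj; apply: p_inj; exact: val_inj.
  - by move=> _ /mapP [i _ ->]; exact: ltn_ord.
  - by rewrite size_map size_enum_ord.
pose q := perm p_inj.
exists [ffun i => (q^-1)%g (widen_ord ld i)].
  move=> i j; rewrite !ffunE => /perm_inj /(congr1 val) /= e; exact: val_inj.
apply: eq_bigr => i _; rewrite ffunE aI.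
have e : q ((q^-1)%g (widen_ord ld i)) = widen_ord ld i by rewrite permKV.
by move: e; rewrite permE => /(congr1 val) /= ->.
Qed.

End RearrangedProducts.

Lemma char_poly_conj (F : fieldType) n (P A : 'M[F]_n) : P \in unitmx ->
  char_poly (P *m A *m invmx P) = char_poly A.
Proof.
move=> Pu; rewrite /char_poly.
have -> : char_poly_mx (P *m A *m invmx P) =
    map_mx polyC P *m char_poly_mx A *m map_mx polyC (invmx P).
  rewrite /char_poly_mx mulmxBr mulmxBl !map_mxM; congr (_ - _).
  by rewrite scalar_mxC -mulmxA -map_mxM mulmxV // map_mx1 mulmx1.
rewrite !det_mulmx mulrC mulrA -det_mulmx -map_mxM mulVmx // map_mx1 det1.
by rewrite mul1r.
Qed.

Section ComplexMatrices.
Context {R : realType} {d : nat}.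
Local Notation rc := (real_complex R).
Implicit Types (A B : 'M[R]_d).

(** Schur triangularisation. Unitarity of [P] is what makes the triangular form of A^T A a Gram
    matrix again in [sum_fminor_sqr]. *)
Lemma triangular_form A : exists2 P : 'M[R[i]]_d, P \is unitarymx &
  exists2 T, is_trig_mx T & map_mx rc A = invmx P *m T *m P /\
    perm_eq [seq T i i | i <- enum 'I_d] (eigenvalues A).
Proof.
(* [Schur] asks for a positive dimension, so size 0 is treated by hand. *)
case: d A => [|n] A.
  have flat (M M' : 'M[R[i]]_0) : M = M' by apply/matrixP => -[].
  exists 1%:M; first by apply/unitarymxP/flat.
  exists 0; first by apply/is_trig_mxP => -[].
  split; first exact: flat.
  apply: prod_XsubC_eq; rewrite -eigenvaluesP big_map big_enum big_ord0.
  by rewrite /char_poly det_mx00.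
have [P Pu PT] := Schur (map_mx rc A) (ltn0Sn n).
exists P => //; exists (P *m map_mx rc A *m invmx P).
  by move: PT; rewrite /similar_to conjumx // unitarymx_unit.
split; first by rewrite !mulmxA mulVmx ?unitarymx_unit // mul1mx mulmxKV // unitarymx_unit.
apply: prod_XsubC_eq; rewrite big_map big_enum /= -eigenvaluesP -char_poly_trig.
  by rewrite char_poly_conj // unitarymx_unit.
by move: PT; rewrite /similar_to conjumx // unitarymx_unit.
Qed.

Lemma fminor_map l A f g : fminor (map_mx rc A) f g = rc (@fminor _ l _ A f g).
Proof. by rewrite /fminor -map_mxsub det_map_mx. Qed.

Lemma minor_sum_map l A : @minor_sum _ l _ (map_mx rc A) = rc (@minor_sum _ l _ A).
Proof.
rewrite /minor_sum rmorph_sum; apply: eq_bigr => f _; rewrite rmorph_sum.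
apply: eq_bigr => g _; rewrite fminor_map normc_def /= expr0n addr0.
by rewrite sqrtr_sqr.
Qed.

End ComplexMatrices.

Section SingularValues.
Context {R : realType} {d : nat}.
Local Notation rc := (real_complex R).
Implicit Types (A : 'M[R]_d).

Definition sing_prod l A : R := \prod_(j < l) sing j.+1 A.

Lemma sing_ge0 j A : 0 <= sing j A.
Proof.
rewrite /sing /singular_values; set s := [seq _ | _ <- _].
have [lt|le] := ltnP j.-1 (size s); last by rewrite nth_default // size_sort.
have : (sort >=%R s)`_j.-1 \in s by rewrite -(mem_sort >=%R) mem_nth // size_sort.
by case/mapP => z _ ->; exact: sqrtr_ge0.
Qed.

Lemma sing_dec i j A : (i <= j)%N -> (j < d)%N -> sing j.+1 A <= sing i.+1 A.
Proof.
move=> ij jd; rewrite /sing /=.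
have tr : transitive (>=%R : rel R) by move=> x y z xy yz; exact: le_trans yz xy.
have [lt|le] := ltnP j (size (singular_values A)); last first.
  by rewrite nth_default // (sing_ge0 i.+1).
apply: (sorted_leq_nth tr (@lexx _ R) 0) => //.
- by apply: sort_sorted => x y; exact: le_total.
- by rewrite inE (leq_ltn_trans ij).
Qed.

(** By Cauchy-Binet the sum of squared minors is l! times the sum of the principal minors of A^T A
    over index functions, hence a symmetric function of the squared singular values whose largest
    term is the square of [sing_prod]. The constant counts the terms. *)
Lemma sum_fminor_sqr l : (l <= d)%N -> exists2 c, 0 < c &
  forall A : 'M[R]_d,
  sing_prod l A ^+ 2 <= \sum_f \sum_g @fminor _ l d A f g ^+ 2 <= c * sing_prod l A ^+ 2.
Proof.
move=> ld; exists (l`! * #|{: {ffun 'I_l -> 'I_d}}|.+1)%:R.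
  by rewrite ltr0n muln_gt0 fact_gt0.
move=> A; have [P Pu [T Ttrig [AE pT]]] := triangular_form (A^T *m A).
have Punit := unitarymx_unit Pu.
pose M := map_mx rc A *m invmx P.
have PM : P *m map_mx rc A^T = (map_mx Num.conj M)^T.
  rewrite map_mxM trmx_mul invmx_unitary // -map_mx_comp; congr (_ *m _).
    by apply/matrixP => i j; rewrite !mxE /= conjCK.
  by apply/matrixP => i j; rewrite !mxE /=; apply/esym/conjc_real.
have TE : T = (map_mx Num.conj M)^T *m M.
  rewrite -PM /M !mulmxA -(mulmxA P) -map_mxM AE.
  by rewrite !mulmxA mulmxV // mul1mx mulmxK.
pose a i : R := Num.sqrt (complex.Re (T i i)).
(* As [T] is the Gram matrix of [M], its diagonal entries are squared column norms: real and
   nonnegative, so that taking real parts in [singular_values] loses nothing. *)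
have Taa i : T i i = rc (a i ^+ 2).
  have e : T i i = rc (\sum_k ComplexField.Normc.normc (M k i) ^+ 2).
    rewrite TE mxE rmorph_sum; apply: eq_bigr => k _; rewrite !mxE mulrC.
    by rewrite -normCK rmorphXn.
  by rewrite /a e /= sqr_sqrtr // sumr_ge0 // => k _; exact: sqr_ge0.
have sE : perm_eq [seq a i | i <- enum 'I_d] (singular_values A).
  rewrite perm_sym /singular_values (perm_trans (permEl (perm_sort _ _))) //.
  by rewrite perm_sym (map_comp (fun z => Num.sqrt (complex.Re z)) (fun i => T i i)) perm_map.
have [||top_le [f0 f0_inj f0E]] := @top_products _ d a (singular_values A) l _ _ sE ld.
- by move=> i; exact: sqrtr_ge0.
- by apply: sort_sorted => x y; exact: le_total.
(* The sum of principal minors is invariant under conjugation by [sum_fminorC], so it can be read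
   off the diagonal of [T]. *)
have sumE : \sum_f \sum_g @fminor _ l d A f g ^+ 2 =
    l`!%:R * \sum_(f : {ffun 'I_l -> 'I_d} | injectiveb f) (\prod_i a (f i)) ^+ 2.
  apply: (@complexI R); rewrite rmorphM rmorph_nat.
  transitivity (\sum_f @fminor _ l d (map_mx rc (A^T *m A)) f f *+ l`! : R[i]).
    rewrite exchange_big /= rmorph_sum; apply: eq_bigr => f _; rewrite fminor_map -rmorphMn fminorM.
    by congr (rc _); apply: eq_bigr => g _; rewrite fminor_tr expr2.
  rewrite AE -mulmxA sum_fminorC mulmxK // sumrMnl mulr_natl; congr (_ *+ _).
  rewrite (bigID (fun f : {ffun 'I_l -> 'I_d} => injectiveb f)) /=
    [X in _ + X]big1 ?addr0; last first.
    by move=> f; exact: fminor_not_inj.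
  rewrite rmorph_sum; apply: eq_bigr => f /injectiveP f_inj.
  rewrite fminor_trig // rmorphXn rmorph_prod -prodrXl; apply: eq_bigr => i _.
  by rewrite Taa rmorphXn.
have prod0 (f : {ffun 'I_l -> 'I_d}) : 0 <= \prod_i a (f i).
  by apply: prodr_ge0 => i _; exact: sqrtr_ge0.
have spE : sing_prod l A = \prod_i a (f0 i) by rewrite f0E.
rewrite sumE; apply/andP; split.
  apply: le_trans (_ : 1 * (\prod_i a (f0 i)) ^+ 2 <= _); first by rewrite mul1r spE.
  apply: ler_pM => //; rewrite ?sqr_ge0 ?fact_ge1 //.
  rewrite [leRHS](bigD1 f0) /=; last exact/injectiveP.
  by rewrite lerDl; apply: sumr_ge0 => f _; exact: sqr_ge0.
rewrite natrM -mulrA ler_wpM2l //.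
apply: (@le_trans _ _ (\sum_(f : {ffun 'I_l -> 'I_d} | injectiveb f) sing_prod l A ^+ 2)).
  apply: ler_sum => f /injectiveP f_inj; rewrite lerXn2r ?nnegrE //.
  - by rewrite spE.
  - exact: top_le.
rewrite sumr_const -[leLHS]mulr_natl ler_wpM2r ?sqr_ge0 // ler_nat.
by apply: leq_trans (max_card _) _; exact: leqnSn.
Qed.

End SingularValues.

Section Compound.
Context {R : realType} {d : nat}.
Local Notation idx l := {I : {set 'I_d} | #|I| == l}.
Implicit Types (A B : 'M[R]_d).

Definition compound l A : 'M[R]_#|{: idx l}| :=
  \matrix_(i, j) \det (mxsub (elt (enum_val i)) (elt (enum_val j)) A).

Lemma compoundM l A B : compound l (A *m B) = compound l A *m compound l B.
Proof.
apply/matrixP => i j; rewrite !mxE mxsub_mul det_mulmx_rect.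
rewrite (reindex (@enum_val (idx l) xpredT)) /=; last first.
  by apply: onW_bij; exact: enum_val_bij.
apply: eq_bigr => k _; rewrite !mxE.
by congr (_ * _); congr (\det _); apply/matrixP => p q; rewrite !mxE.
Qed.

Lemma compound1 l : compound l 1%:M = 1%:M.
Proof.
apply/matrixP => i j; rewrite !mxE -(inj_eq enum_val_inj).
have /ffunP/(_ (enum_val i)) := wedge_basis (R := R) (enum_val j).
rewrite !ffunE => <-; congr (\det _); apply/matrixP => p q.
by rewrite !mxE andbT.
Qed.

Lemma compound_unit l A : A \in unitmx -> compound l A \in unitmx.
Proof.
move=> Au; apply: (@mulmx1_unit _ _ _ (compound l (invmx A)) _).1.
by rewrite -compoundM mulmxV // compound1.
Qed.

(** Sorting the index functions turns a minor into an entry of the compound up to sign; a repeated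
    index makes it vanish. *)
Lemma fminor_compound l A f g : `|@fminor _ l d A f g| <= norm1 (compound l A).
Proof.
have [/injectiveP f_inj|nf] := boolP (injectiveb f); last first.
  by rewrite fminor_not_inj // normr0 norm1_ge0.
have [/injectiveP g_inj|ng] := boolP (injectiveb g); last first.
  by rewrite -fminor_tr fminor_not_inj // normr0 norm1_ge0.
have [I [p fE]] := elt_perm f_inj; have [J [q gE]] := elt_perm g_inj.
have -> : fminor A f g = (-1) ^+ p * ((-1) ^+ q * \det (mxsub (elt I) (elt J) A)).
  rewrite /fminor fE gE; have -> : mxsub [ffun i => elt I (p i)] [ffun i => elt J (q i)] A =
      row_perm p (col_perm q (mxsub (elt I) (elt J) A)).
    by apply/matrixP => i j; rewrite !mxE !ffunE.
  by rewrite row_permE col_permE !det_mulmx !det_perm odd_permV [_ * (-1) ^+ q]mulrC.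
rewrite !normrM !normrX normrN1 !expr1n !mul1r.
by have := ler_norm1 (compound l A) (enum_rank I) (enum_rank J); rewrite mxE !enum_rankK.
Qed.

Lemma norm1_compound_le l A : norm1 (compound l A) <=
  #|{: idx l}|%:R ^+ 2 * minor_sum (l := l) A.
Proof.
rewrite /norm1.
apply: (@le_trans _ _ (\sum_(i < #|{: idx l}|) \sum_(j < #|{: idx l}|) minor_sum (l := l) A)).
  apply: ler_sum => i _; apply: ler_sum => j _; rewrite mxE.
  have -> : mxsub (elt (enum_val i)) (elt (enum_val j)) A =
      mxsub [ffun k => elt (enum_val i) k] [ffun k => elt (enum_val j) k] A.
    by apply/matrixP => p q; rewrite !mxE !ffunE.
  exact: fminor_le.
by rewrite !sumr_const !card_ord -mulrnA -[leLHS]mulr_natl natrM expr2.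
Qed.

Lemma minor_sum_compound_le l A : minor_sum (l := l) A <=
  #|{: {ffun 'I_l -> 'I_d}}|%:R ^+ 2 * norm1 (compound l A).
Proof.
apply: (@le_trans _ _ (\sum_(f : {ffun 'I_l -> 'I_d})
    \sum_(g : {ffun 'I_l -> 'I_d}) norm1 (compound l A))).
  by apply: ler_sum => f _; apply: ler_sum => g _; exact: fminor_compound.
by rewrite !sumr_const -mulrnA -[leLHS]mulr_natl natrM expr2.
Qed.

Lemma compound_sing l : (l <= d)%N -> exists2 c, 0 < c & forall A,
  sing_prod l A <= c * norm1 (compound l A) /\ norm1 (compound l A) <= c * sing_prod l A.
Proof.
move=> ld; have [c c0 h] := @sum_fminor_sqr R d l ld.
pose D : R := #|{: {ffun 'I_l -> 'I_d}}|%:R; pose E : R := #|{: idx l}|%:R.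
have sp0 A : 0 <= sing_prod l A by apply: prodr_ge0 => i _; exact: sing_ge0.
have D0 : 0 <= D by []. have E0 : 0 <= E by [].
have k0 : 0 <= E ^+ 2 * (D ^+ 2 * (c + 1)).
  by rewrite !mulr_ge0 ?exprn_ge0 // addr_ge0 // ltW.
(* [D] serves the first inequality and the last summand the second, where [c + 1] stands in for the
   square root of [c]; the 1 ensures positivity. *)
exists (D + 1 + E ^+ 2 * (D ^+ 2 * (c + 1))).
  by rewrite -addrA ltr_wpDl // ltr_pwDl.
move=> A; have /andP [h1 h2] := h A; split.
  apply: (@le_trans _ _ (D * norm1 (compound l A))); last first.
    by rewrite ler_wpM2r ?norm1_ge0 // -addrA lerDl addr_ge0.
  rewrite -(@ler_pXn2r _ 2) ?nnegrE ?mulr_ge0 ?norm1_ge0 //.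
  apply: le_trans h1 _.
  apply: (@le_trans _ _ (\sum_(f : {ffun 'I_l -> 'I_d})
      \sum_(g : {ffun 'I_l -> 'I_d}) norm1 (compound l A) ^+ 2)).
    apply: ler_sum => f _; apply: ler_sum => g _.
    rewrite -real_normK ?num_real // lerXn2r ?nnegrE ?norm1_ge0 //.
    exact: fminor_compound.
  by rewrite !sumr_const -mulrnA -[leLHS]mulr_natl natrM exprMn expr2.
apply: (@le_trans _ _ (E ^+ 2 * (D ^+ 2 * (c + 1)) * sing_prod l A)); last first.
  by rewrite ler_wpM2r ?sp0 // lerDr addr_ge0.
apply: le_trans (norm1_compound_le _ _) _; rewrite -mulrA ler_wpM2l ?exprn_ge0 //.
apply: (@le_trans _ _ (\sum_(f : {ffun 'I_l -> 'I_d})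
    \sum_(g : {ffun 'I_l -> 'I_d}) ((c + 1) * sing_prod l A))).
  apply: ler_sum => f _; apply: ler_sum => g _.
  have c1 : 0 <= c + 1 by rewrite addr_ge0 // ltW.
  rewrite -(@ler_pXn2r _ 2) ?nnegrE ?mulr_ge0 // real_normK ?num_real //.
  apply: (@le_trans _ _ (c * sing_prod l A ^+ 2)).
    apply: le_trans h2; rewrite (bigD1 f) //= (bigD1 g) //= -addrA lerDl addr_ge0 //.
      by apply: sumr_ge0 => k _; exact: sqr_ge0.
    by apply: sumr_ge0 => k _; apply: sumr_ge0 => k' _; exact: sqr_ge0.
  by rewrite exprMn ler_wpM2r ?sqr_ge0 //; nra.
by rewrite !sumr_const -mulrnA -[leLHS]mulr_natl natrM -expr2 mulrA.
Qed.

End Compound.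

(** * Eigenvalue gaps *)

Section SpectralGrowth.
Context {R : realType} {d : nat}.
Local Notation rc := (real_complex R).
Implicit Types (B : 'M[R]_d).

Lemma real_complex_norm (z : R[i]) : `|z| = rc (ComplexField.Normc.normc z).
Proof. by []. Qed.

Lemma map_mxpow B n : map_mx rc (mxpow B n) = mxpow (map_mx rc B) n.
Proof. by elim: n => [|n IH] /=; rewrite ?map_mx1 // map_mxM IH. Qed.

Lemma moduli_form B : exists2 P : 'M[R[i]]_d, P \in unitmx &
  exists2 T, is_trig_mx T & map_mx rc B = invmx P *m T *m P /\
    perm_eq [seq ComplexField.Normc.normc (T i i) | i <- enum 'I_d] (eigenvalue_moduli B).
Proof.
have [P Pu [T Tt [BE pT]]] := triangular_form B.
exists P; first exact: unitarymx_unit; exists T => //; split=> //.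
rewrite perm_sym /eigenvalue_moduli (perm_trans (permEl (perm_sort _ _))) //.
by rewrite perm_sym (map_comp (@ComplexField.Normc.normc R) (fun i => T i i)) perm_map.
Qed.

Lemma size_moduli B : size (eigenvalue_moduli B) = d.
Proof.
have [P _ [T _ [_ p]]] := moduli_form B.
by rewrite -(perm_size p) size_map size_enum_ord.
Qed.

Lemma moduli_sorted B : sorted >=%R (eigenvalue_moduli B).
Proof. by apply: sort_sorted => x y; exact: le_total. Qed.

Lemma moduli_dec B i j : (i <= j < d)%N ->
  (eigenvalue_moduli B)`_j <= (eigenvalue_moduli B)`_i.
Proof.
move=> /andP [ij jd].
have tr : transitive (>=%R : rel R) by move=> x y z xy yz; exact: le_trans yz xy.
by apply: (sorted_leq_nth tr (@lexx _ R) 0 (moduli_sorted B)) => //;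
  rewrite inE size_moduli // (leq_ltn_trans ij).
Qed.

Lemma moduli_gt0 B j : B \in unitmx -> (j < d)%N -> 0 < (eigenvalue_moduli B)`_j.
Proof.
move=> Bu jd; have [P Pu [T Tt [BE p]]] := moduli_form B.
have : (eigenvalue_moduli B)`_j \in eigenvalue_moduli B by rewrite mem_nth // size_moduli.
rewrite -(perm_mem p) => /mapP [i _ ->].
rewrite -(@ltcR R) -real_complex_norm normr_gt0.
have : T \in unitmx.
  have <- : P *m map_mx rc B *m invmx P = T.
    by rewrite BE !mulmxA mulmxV // mul1mx mulmxK.
  by rewrite !unitmx_mul Pu unitmx_inv Pu map_unitmx Bu.
rewrite unitmxE det_trig // unitfE; apply: contraNneq => Tii.
by rewrite (bigD1 i) //= Tii mul0r.
Qed.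

(** One principal minor of the n-th power of the triangular form is the n-th power of the [l]
    leading eigenvalues; conjugation changes [minor_sum] by a bounded factor only. *)
Lemma minor_sum_pow_lower B l : (l <= d)%N -> exists2 K, 0 <= K &
  forall n, (\prod_(j < l) (eigenvalue_moduli B)`_j) ^+ n
    <= K * @minor_sum _ l _ (mxpow B n).
Proof.
move=> ld; have [P Pu [T Tt [BE pT]]] := moduli_form B.
pose a i := ComplexField.Normc.normc (T i i).
have a0 i : 0 <= a i by rewrite -(@lecR R) -real_complex_norm normr_ge0.
have [_ [f f_inj fE]] := top_products a0 (moduli_sorted B) pT ld.
(* [k] is a nonnegative element of [R[i]], hence real; [normc] recovers it as an element of [R]. *)
pose k := @minor_sum _ l _ P * @minor_sum _ l _ (invmx P).
exists (ComplexField.Normc.normc k).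
  by rewrite -(@lecR R) -real_complex_norm normr_ge0.
have kE : rc (ComplexField.Normc.normc k) = k.
  by rewrite -real_complex_norm ger0_norm // mulr_ge0 ?minor_sum_ge0.
move=> n; rewrite -(@lecR R) rmorphM /= kE.
rewrite -minor_sum_map map_mxpow rmorphXn -fE.
have [TnT TnE] := mxpow_trig n Tt.
apply: (@le_trans _ _ (@minor_sum _ l _ (mxpow T n))).
  apply: le_trans (fminor_le _ f f); rewrite fminor_trig // normr_prod.
  rewrite rmorph_prod -prodrXl le_eqVlt; apply/orP; left; apply/eqP.
  by apply: eq_bigr => i _; rewrite TnE normrX real_complex_norm.
have -> : mxpow T n = P *m mxpow (map_mx rc B) n *m invmx P.
  by rewrite (mxpow_similar n Pu BE) !mulmxA mulmxV // mul1mx mulmxK.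
apply: le_trans (minor_sumM _ _) _; rewrite /k mulrAC ler_wpM2r ?minor_sum_ge0 //.
exact: minor_sumM.
Qed.

(** Jordan blocks can add polynomial factors to the eigenvalue growth. The slack [e] absorbs them: a
    suitable conjugate has row sums at most the eigenvalue modulus plus [e]. *)
Lemma minor_sum_pow_upper B l e : (l <= d)%N -> 0 < e -> exists2 K, 0 <= K &
  forall n, @minor_sum _ l _ (mxpow B n) <=
    K * (\prod_(j < l) ((eigenvalue_moduli B)`_j + e)) ^+ n.
Proof.
move=> ld e0; have [P Pu [T Tt [BE pT]]] := moduli_form B.
pose a i := ComplexField.Normc.normc (T i i).
have a0 i : 0 <= a i by rewrite -(@lecR R) -real_complex_norm normr_ge0.
pose t := norm1 (map_mx (@ComplexField.Normc.normc R) T).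
(* Conjugating by diag(1, delta, delta^2, ...) shrinks the entries below the
   diagonal. *)
have [delta /andP [dl0 dl1] dle] : exists2 delta : R, 0 < delta <= 1 &
    d%:R * (delta * t) <= e.
  have t0 : 0 <= t by exact: norm1_ge0.
  have dt0 : 0 <= d%:R * t by rewrite mulr_ge0.
  have s0 : 0 < e + d%:R * t by rewrite ltr_wpDr.
  exists (e / (e + d%:R * t)).
    by rewrite divr_gt0 // ler_pdivrMr // mul1r lerDl.
  by rewrite mulrCA mulrAC ler_pdivrMr // ler_wpM2l ?(ltW e0) // lerDr ltW.
pose D : 'M[R[i]]_d := diag_mx (\row_i rc (delta ^+ i)).
pose D' : 'M[R[i]]_d := diag_mx (\row_i rc (delta ^- i)).
have DD' : D *m D' = 1%:M.
  apply/matrixP => i j; rewrite mul_diag_mx !mxE.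
  case: eqVneq => [->|_]; last by rewrite mulr0n mulr0.
  by rewrite mulr1n -rmorphM divff // expf_neq0 // lt0r_neq0.
have Du : D \in unitmx by have [] := mulmx1_unit DD'.
have D'E : D' = invmx D by rewrite -[RHS]mulmx1 -DD' mulKmx.
pose T' := D *m T *m D'.
have BE' : map_mx rc B = invmx (D *m P) *m T' *m (D *m P).
  have -> : invmx (D *m P) = invmx P *m invmx D.
    have e1 : D *m P *m (invmx P *m invmx D) = 1%:M by rewrite mulmxA mulmxK // mulmxV.
    by rewrite -[LHS]mulmx1 -e1 mulKmx // unitmx_mul Du.
  by rewrite BE /T' D'E !mulmxA !mulmxKV.
have T'row i : \sum_j `|T' i j| <= rc (a i + e).
  have T'E j : `|T' i j| = rc (delta ^+ i * ComplexField.Normc.normc (T i j) / delta ^+ j).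
    have rcn x : 0 <= x -> `|rc x| = rc x by move=> x0; rewrite ger0_norm // lecR.
    rewrite /T' mul_mx_diag mul_diag_mx !mxE !normrM !rcn ?invr_ge0 ?exprn_ge0 ?(ltW dl0) //.
    by rewrite !rmorphM.
  apply: (@le_trans _ _ (\sum_(j < d) rc (a i *+ (j == i) + delta * t))).
    apply: ler_sum => j _; rewrite T'E lecR.
    have [->|ji] := eqVneq j i.
      rewrite mulrAC divff ?mul1r ?mulr1n ?expf_neq0 ?lt0r_neq0 //.
      by rewrite lerDl mulr_ge0 ?norm1_ge0 // ltW.
    rewrite mulr0n add0r; have [ij|jlei] := ltnP i j.
      move/is_trig_mxP: Tt => ->//.
      by rewrite ComplexField.Normc.normc0 mulr0 mul0r mulr_ge0 ?norm1_ge0 // ltW.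
    have jlti : (j < i)%N by rewrite ltn_neqAle jlei andbT.
    rewrite mulrAC -expfB //; apply: ler_pM.
    - by rewrite exprn_ge0 // ltW.
    - by rewrite -(@lecR R) -real_complex_norm normr_ge0.
    - have -> : (i - j = (i - j).-1.+1)%N by rewrite prednK // subn_gt0.
      by rewrite exprS ler_piMr ?exprn_ile1 ?(ltW dl0).
    - have := ler_norm1 (map_mx (@ComplexField.Normc.normc R) T) i j.
      by apply: le_trans; rewrite mxE ler_norm.
  rewrite -rmorph_sum lecR big_split /= (bigD1 i) //= eqxx big1 => [|j /negPf -> //].
  by rewrite addr0 lerD2l sumr_const card_ord -mulr_natl.
pose r := \prod_(j < l) ((eigenvalue_moduli B)`_j + e).
have m0 j : (j < d)%N -> 0 <= (eigenvalue_moduli B)`_j.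
  move=> jd; have : (eigenvalue_moduli B)`_j \in eigenvalue_moduli B.
    by rewrite mem_nth // size_moduli.
  by rewrite -(perm_mem pT) => /mapP [i _ ->]; exact: a0.
have r0 : 0 <= r.
  apply: prodr_ge0 => j _; have jd : (j < d)%N := leq_trans (ltn_ord j) ld.
  by rewrite addr_ge0 ?(ltW e0) ?m0.
have T'r (f : {ffun 'I_l -> 'I_d}) : injective f ->
    \prod_i \sum_j `|T' (f i) j| <= rc r.
  move=> f_inj; apply: (@le_trans _ _ (\prod_i rc (a (f i) + e))).
    by apply: ler_prod => i _; rewrite sumr_ge0 //= T'row.
  rewrite -rmorph_prod lecR.
  have [|||h _] := @top_products _ d (fun i => a i + e)
      [seq x + e | x <- eigenvalue_moduli B] l _ _ _ ld.
  - by move=> i; rewrite addr_ge0 // ltW.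
  - rewrite sorted_map; apply: sub_sorted (moduli_sorted B) => x y.
    by rewrite /relpre /= lerD2r.
  - by rewrite (map_comp (fun x => x + e) a) perm_map.
  apply: le_trans (h f f_inj) _; rewrite le_eqVlt; apply/orP; left; apply/eqP.
  apply: eq_bigr => j _; rewrite (nth_map 0) // size_moduli.
  exact: leq_trans (ltn_ord j) ld.
pose k := @minor_sum _ l _ (invmx (D *m P)) * (@minor_sum _ l _ (1%:M : 'M[R[i]]_d) *
  #|{: {ffun 'I_l -> 'I_d}}|%:R) * @minor_sum _ l _ (D *m P).
have k0 : 0 <= k by rewrite !mulr_ge0 ?minor_sum_ge0.
exists (ComplexField.Normc.normc k).
  by rewrite -(@lecR R) -real_complex_norm normr_ge0.
have kE : rc (ComplexField.Normc.normc k) = k by rewrite -real_complex_norm ger0_norm.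
move=> n; rewrite -(@lecR R) rmorphM /= kE.
rewrite -minor_sum_map map_mxpow rmorphXn (mxpow_similar n _ BE'); last first.
  by rewrite unitmx_mul Du.
apply: le_trans (minor_sumM _ _) _; rewrite /k mulrAC ler_wpM2r ?minor_sum_ge0 //.
apply: le_trans (minor_sumM _ _) _; rewrite -mulrA ler_wpM2l ?minor_sum_ge0 //.
by apply: minor_sum_pow_le => //; rewrite -(@lecR R) in r0.
Qed.

End SpectralGrowth.

Section Proximality.
Context {R : realType} {d : nat}.
Implicit Types (B : 'M[R]_d).

(** Bernoulli's inequality. *)
Lemma geometric_unbounded (q K : R) : 1 < q -> exists n, K < q ^+ n.
Proof.
move=> q1; have q0 : 0 < q - 1 by rewrite subr_gt0.
pose n := Num.bound `|K / (q - 1)|.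
exists n; apply: (@lt_le_trans _ _ (1 + n%:R * (q - 1))).
  apply: (@lt_le_trans _ _ (n%:R * (q - 1))); last by rewrite lerDr.
  by rewrite -ltr_pdivrMr // (le_lt_trans (ler_norm _)) // archi_boundP.
elim: (n) => [|k IH]; first by rewrite mul0r addr0.
rewrite exprS; apply: (@le_trans _ _ (q * (1 + k%:R * (q - 1)))); last first.
  by rewrite ler_wpM2l // ltW // (lt_trans _ q1).
rewrite -natr1 -subr_ge0.
have -> : q * (1 + k%:R * (q - 1)) - (1 + (k%:R + 1) * (q - 1)) = k%:R * (q - 1) ^+ 2.
  by ring.
by rewrite mulr_ge0 // sqr_ge0.
Qed.

(** Per power of [B] the squared l-th norm gains on the competing product by the factor [rho], the
    ratio of the moduli at the gap, up to an error (1 + eta)^(2 l) that is made smaller than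
    [rho]. *)
Lemma moduli_gap_unbounded B l (C : R) : B \in unitmx -> (0 < l < d)%N ->
  (eigenvalue_moduli B)`_l.-1 != (eigenvalue_moduli B)`_l ->
  exists n, C * (norm1 (compound l.-1 (mxpow B n)) * norm1 (compound l.+1 (mxpow B n)))
    < norm1 (compound l (mxpow B n)) ^+ 2.
Proof.
move=> Bu /andP [l0 ld] gap; pose m j := (eigenvalue_moduli B)`_j.
have m0 j : (j < d)%N -> 0 < m j by exact: moduli_gt0.
have l1d : (l.-1 < d)%N by apply: leq_trans ld; rewrite prednK // leqnn.
have lt_m : m l < m l.-1.
  by rewrite lt_neqAle eq_sym gap moduli_dec // leq_pred.
pose rho := m l.-1 / m l.
have rho1 : 1 < rho by rewrite ltr_pdivlMr ?mul1r // m0.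
(* Chosen so that (1 + eta)^(2 l + 1) = rho; one power fewer is then strictly below [rho]. *)
pose eta := expR (ln rho / (2 * l).+1%:R) - 1.
have lnrho : 0 < ln rho by rewrite ln_gt0.
have eta0 : 0 < eta by rewrite subr_gt0 expR_gt1 divr_gt0.
have eta1 : (1 + eta) ^+ (2 * l) < rho.
  rewrite addrC subrK -expRM_natl -[ltRHS]lnK ?posrE ?(lt_trans ltr01) //.
  by rewrite ltr_expR mulrCA gtr_pMr // ltr_pdivrMr // mul1r ltr_nat.
(* Scaling by the smallest modulus makes the additive slack [e] at most a relative slack [eta] on
   every modulus. *)
pose e := eta * m d.-1.
have d1 : (d.-1 < d)%N by rewrite ltn_predL (leq_trans _ ld).
have e0 : 0 < e by rewrite mulr_gt0 // m0.
pose mu i := \prod_(j < i) m j.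
have mu0 i : (i <= d)%N -> 0 < mu i.
  by move=> id; apply: prodr_gt0 => j _; apply: m0; exact: leq_trans id.
have upper i : (i <= d)%N -> \prod_(j < i) (m j + e) <= (1 + eta) ^+ i * mu i.
  move=> id; rewrite -[in X in X * _](card_ord i) -prodr_const -big_split /=.
  apply: ler_prod => j _; have jd : (j < d)%N := leq_trans (ltn_ord j) id.
  rewrite addr_ge0 ?(ltW e0) ?(ltW (m0 _ _)) //= mulrDl mul1r lerD2l ler_wpM2l ?(ltW eta0) //.
  by apply: moduli_dec; rewrite d1 andbT -ltnS prednK // (leq_trans _ ld).
have [Ka Ka0 ha] := minor_sum_pow_upper B (ltnW l1d) e0.
have [Kc Kc0 hc] := minor_sum_pow_upper B ld e0.
have [Kb Kb0 hb] := minor_sum_pow_lower B (ltnW ld).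
apply: contrapT => nex.
have {}nex n : norm1 (compound l (mxpow B n)) ^+ 2 <=
    C * (norm1 (compound l.-1 (mxpow B n)) * norm1 (compound l.+1 (mxpow B n))).
  by rewrite leNgt; apply/negP => h; apply: nex; exists n.
pose D i : R := #|{: {ffun 'I_i -> 'I_d}}|%:R ^+ 2.
pose E i : R := #|{: {I : {set 'I_d} | #|I| == i}}|%:R ^+ 2.
have DE0 i : 0 <= D i /\ 0 <= E i by rewrite !exprn_ge0.
pose K := (Kb * D l) ^+ 2 * (`|C| * (E l.-1 * Ka * (E l.+1 * Kc))).
have q1 : 1 < rho / (1 + eta) ^+ (2 * l).
  by rewrite ltr_pdivlMr ?mul1r // exprn_gt0 // addr_gt0.
have [n] := geometric_unbounded K q1; apply/negP; rewrite -leNgt.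
set x := fun i => norm1 (compound i (mxpow B n)) in nex *.
have x0 i : 0 <= x i by exact: norm1_ge0.
have [Dl0 _] := DE0 l; have [_ Ea0] := DE0 l.-1; have [_ Ec0] := DE0 l.+1.
pose M := mu l.-1 * mu l.+1; pose g := (1 + eta) ^+ (2 * l).
have eta2 : 0 < 1 + eta by rewrite addr_gt0.
have M0 : 0 < M by rewrite mulr_gt0 // mu0 // ltnW.
have muE : mu l ^+ 2 = rho * M.
  have muS i : mu i.+1 = mu i * m i by rewrite /mu big_ord_recr.
  rewrite /M /rho expr2 muS; have {1}-> : mu l = mu l.-1 * m l.-1 by rewrite -muS prednK.
  by field; rewrite gt_eqF // m0.
have xb : mu l ^+ n <= Kb * D l * x l.
  apply: le_trans (hb n) _; rewrite -mulrA ler_wpM2l //.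
  exact: minor_sum_compound_le.
have xi i Ki : 0 <= Ki -> (i <= d)%N ->
    minor_sum (l := i) (mxpow B n) <= Ki * (\prod_(j < i) (m j + e)) ^+ n ->
    x i <= E i * Ki * ((1 + eta) ^+ i * mu i) ^+ n.
  move=> Ki0 id h; have [_ E0] := DE0 i.
  apply: le_trans (norm1_compound_le _ _) _; rewrite -mulrA ler_wpM2l //.
  apply: le_trans h _; rewrite ler_wpM2l // lerXn2r ?nnegrE ?upper //.
    apply: prodr_ge0 => j _; have jd : (j < d)%N := leq_trans (ltn_ord j) id.
    by rewrite addr_ge0 ?(ltW e0) ?(ltW (m0 _ _)).
  by rewrite mulr_ge0 ?exprn_ge0 ?(ltW eta2) ?(ltW (mu0 _ _)).
have xa := xi _ _ Ka0 (ltnW l1d) (ha n); have xc := xi _ _ Kc0 ld (hc n).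
rewrite -(@ler_pM2r _ ((g * M) ^+ n)); last by rewrite exprn_gt0 // mulr_gt0 ?exprn_gt0.
rewrite -exprMn mulrA divfK ?gt_eqF ?exprn_gt0 // -muE -exprM mulnC exprM.
apply: (@le_trans _ _ ((Kb * D l) ^+ 2 * x l ^+ 2)).
  rewrite -exprMn lerXn2r ?nnegrE ?mulr_ge0 ?exprn_ge0 ?(ltW (mu0 _ _)) // ltnW //.
rewrite /K -[leRHS]mulrA ler_wpM2l ?sqr_ge0 //; apply: le_trans (nex n) _.
apply: (@le_trans _ _ (`|C| * (x l.-1 * x l.+1))).
  by rewrite ler_wpM2r ?ler_norm ?(mulr_ge0 (x0 _) (x0 _)).
rewrite -[leRHS]mulrA ler_wpM2l //; apply: (le_trans (ler_pM (x0 _) (x0 _) xa xc)).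
rewrite le_eqVlt; apply/orP; left; apply/eqP.
rewrite mulrACA -exprMn; congr (_ * _ ^+ _).
rewrite /g /M mulrACA -exprD; congr (_ ^+ _ * _).
by rewrite mul2n -addnn -{3}(prednK l0) addnS addSn.
Qed.

End Proximality.

Section ProximalWords.
Context {R : realType} {N d : nat}.
Variable A : 'I_N -> 'M[R]_d.
Hypothesis A_unit : forall i, A i \in unitmx.

Lemma mxword_repeat w n : mxword A (flatten (nseq n w)) = mxpow (mxword A w) n.
Proof.
elim: n => [|n IH] //; rewrite [RHS]/= -IH -[LHS]/(mxword A (w ++ flatten (nseq n w))).
rewrite mxword_cat; elim: {IH} n => [|n IH]; first by rewrite /mxword /= mul1mx mulmx1.
by rewrite -[flatten _]/(w ++ flatten (nseq n w)) mxword_cat mulmxA -IH.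
Qed.

Lemma proximal_unbounded l (C : R) : (0 < l < d)%N -> proximal l A ->
  exists w, C * (norm1 (compound l.-1 (mxword A w)) * norm1 (compound l.+1 (mxword A w)))
    < norm1 (compound l (mxword A w)) ^+ 2.
Proof.
move=> ld [w _ gap]; have wu := mxword_unit w A_unit.
have [n hn] := moduli_gap_unbounded C wu ld gap.
by exists (flatten (nseq n w)); rewrite mxword_repeat.
Qed.

End ProximalWords.

(** * Irreducibility of exterior powers in compound coordinates *)

Section Transfer.
Context {K : fieldType} {E F : vectType K} {N : nat}.
Variables (B : 'I_N -> 'End(E)) (B' : 'I_N -> 'End(F)) (g : 'Hom(E, F)) (h : F -> E).
Hypothesis hK : forall y, g (h y) = y.
Hypothesis gB : forall i x, g (B i x) = B' i (g x).

Let preim_neq0 V : V != 0%VS -> (g @^-1: V)%VS != 0%VS.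
Proof.
apply: contra_neq => V0; apply/eqP; rewrite -subv0; apply/subvP => y yV.
have : h y \in (g @^-1: V)%VS by rewrite -memv_preim hK.
by rewrite V0 !memv0 => /eqP hy; rewrite -(hK y) hy linear0.
Qed.

Let preim_neqf V : V != fullv -> (g @^-1: V)%VS != fullv.
Proof.
apply: contra_neq => Vf; apply/eqP; rewrite eqEsubv subvf; apply/subvP => y _.
have : h y \in (g @^-1: V)%VS by rewrite Vf memvf.
by rewrite -memv_preim hK.
Qed.

(** Invariant subspaces pull back along the surjective intertwiner [g], and the section [h] shows
    that they stay nonzero and proper. *)
Lemma irreducible_transfer : irreducible B -> irreducible B'.
Proof.
move=> irr [V [V0 Vf VB]]; apply: irr; exists (g @^-1: V)%VS; split.
- exact: preim_neq0.
- exact: preim_neqf.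
- move=> i; apply/subvP => _ /memv_imgP [x xV ->].
  by rewrite -memv_preim gB (subvP (VB i)) // memv_img // memv_preim.
Qed.

Lemma strongly_irreducible_transfer :
  strongly_irreducible B -> strongly_irreducible B'.
Proof.
move=> irr [m [V [m0 V0 VB]]]; apply: irr.
exists m, (fun j => (g @^-1: V j)%VS); split=> //.
- by move=> j; have [? ?] := V0 j; rewrite preim_neq0 // preim_neqf.
- move=> i _ [x [j _ /= xV] <-].
  have [|k _ /= kV] := VB i (g (B i x)).
    by exists (g x); [exists j => //=; rewrite memv_preim | rewrite gB].
  by exists k => //=; rewrite -memv_preim.
Qed.

End Transfer.

Section CompoundIrreducible.
Context {R : realType} {N d : nat}.
Variables (A : 'I_N -> 'M[R]_d) (l : nat).
Local Notation idx := {I : {set 'I_d} | #|I| == l}.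

Definition compound_maps (i : 'I_N) : 'End('cV[R]_#|{: idx}|) :=
  linfun (mulmx (compound l (A i)) : 'cV_#|{: idx}| -> 'cV_#|{: idx}|).

Let g_fun (x : ext R d l) : 'cV[R]_#|{: idx}| := \col_i x (enum_val i).
Let g_lin : linear g_fun.
Proof. by move=> c x y; apply/colP => i; rewrite !mxE !ffunE. Qed.
Let g := lin_hom g_lin.
Let h (y : 'cV[R]_#|{: idx}|) : ext R d l := [ffun I => y (enum_rank I) 0].

Let hK y : g (h y) = y.
Proof.
by rewrite /g lin_homE; apply/colP => i; rewrite mxE ffunE enum_valK.
Qed.

Let gB i x : g (extmap l (A i) x) = compound_maps i (g x).
Proof.
have gE y : g y = g_fun y by exact: lin_homE.
rewrite !gE /compound_maps !lfunE /=; apply/colP => j; rewrite !mxE.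
rewrite /extmap_fun sum_ffunE (reindex (@enum_val idx xpredT)) /=; last first.
  by apply: onW_bij; exact: enum_val_bij.
apply: eq_bigr => k _; rewrite !ffunE !mxE [LHS]mulrC; congr (_ * _).
by congr (\det _); apply/matrixP => p q; rewrite !mxE.
Qed.

Lemma compound_irreducible : ext_irreducible l A -> irreducible compound_maps.
Proof. exact: (@irreducible_transfer _ _ _ _ (fun i => extmap l (A i)) _ _ _ hK gB). Qed.

Lemma compound_strongly_irreducible :
  strongly_ext_irreducible l A -> strongly_irreducible compound_maps.
Proof. exact: (@strongly_irreducible_transfer _ _ _ _ (fun i => extmap l (A i)) _ _ _ hK gB). Qed.

Lemma mxword_compound w :
  mxword (fun i => compound l (A i)) w = compound l (mxword A w).
Proof.
elim/last_ind: w => [|w i IH]; first by rewrite /mxword /= compound1.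
by rewrite !mxword_rcons IH compoundM.
Qed.

End CompoundIrreducible.

Section CompoundNorms.
Context {R : realType} {d : nat}.
Implicit Types (A : 'M[R]_d).

Definition cnorm l A : R := norm1 (compound l A).

Lemma compound_card_gt0 l : (l <= d)%N -> (0 < #|{: {I : {set 'I_d} | #|I| == l}}|)%N.
Proof.
move=> ld; rewrite card_sig; have := card_draws 'I_d l.
by rewrite cardsE card_ord => ->; rewrite bin_gt0.
Qed.

Lemma cnorm_gt0 l A : (l <= d)%N -> A \in unitmx -> 0 < cnorm l A.
Proof.
move=> ld Au; apply: norm1_gt0; apply: contraTneq (compound_unit l Au) => ->.
have := compound_card_gt0 ld; case: #|_| => // n _.
by rewrite unitmxE det0 unitr0.
Qed.

(** In terms of singular values the two sides differ by the ratio of [sing l.+1] to [sing l], which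
    is at most 1. *)
Lemma cnorm_log_concave l : (0 < l < d)%N -> exists2 c, 0 < c &
  forall A, cnorm l.-1 A * cnorm l.+1 A <= c * cnorm l A ^+ 2.
Proof.
move=> /andP [l0 ld].
have [c1 c10 h1] := @compound_sing R d l.-1 (leq_trans (leq_pred l) (ltnW ld)).
have [c2 c20 h2] := @compound_sing R d l (ltnW ld).
have [c3 c30 h3] := @compound_sing R d l.+1 ld.
exists (c1 * c3 * c2 ^+ 2); first by rewrite !mulr_gt0 ?exprn_gt0.
move=> A; have [_ a1] := h1 A; have [a2 _] := h2 A; have [_ a3] := h3 A.
have sp0 i : 0 <= sing_prod i A by apply: prodr_ge0 => j _; exact: sing_ge0.
apply: (@le_trans _ _ (c1 * c3 * sing_prod l A ^+ 2)).
  apply: (le_trans (ler_pM (norm1_ge0 _) (norm1_ge0 _) a1 a3)).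
  rewrite mulrACA ler_wpM2l ?mulr_ge0 ?(ltW c10) ?(ltW c30) //.
  have spS i : sing_prod i.+1 A = sing_prod i A * sing i.+1 A.
    by rewrite /sing_prod big_ord_recr.
  have e : sing_prod l A = sing_prod l.-1 A * sing l A by rewrite -{1 3}(prednK l0) spS prednK.
  rewrite spS expr2 {3}e !mulrA [_ * sing_prod l A]mulrC ler_wpM2l //.
    by rewrite mulr_ge0.
  by rewrite -{2}(prednK l0) sing_dec // leq_pred.
rewrite -[leRHS]mulrA ler_wpM2l ?mulr_ge0 ?(ltW c10) ?(ltW c30) // -exprMn.
by rewrite lerXn2r ?nnegrE ?sp0 // mulr_ge0 ?norm1_ge0 // ltW.
Qed.

(** The compound of an invertible matrix is nonzero, so the product of the first [j.+1] singular
    values, and with it the last factor, is nonzero. *)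
Lemma sing_gt0 A j : A \in unitmx -> (j < d)%N -> 0 < sing j.+1 A.
Proof.
move=> Au jd; have [c c0 h] := @compound_sing R d j.+1 jd.
have : 0 < sing_prod j.+1 A.
  have := cnorm_gt0 jd Au; have [_] := h A.
  rewrite -(pmulr_rgt0 (sing_prod j.+1 A) c0) => h1 h2; exact: lt_le_trans h2 h1.
rewrite /sing_prod big_ord_recr /=; set p := \prod_(i < j) _ => p0.
by rewrite lt_def sing_ge0 andbT; apply: contraTneq p0 => ->; rewrite mulr0 ltxx.
Qed.

End CompoundNorms.

(** * Entropy of finite partitions *)

Section RealProbability.
Context {R : realType} {disp : measure_display} {T : measurableType disp}.
Variable mu : probability T R.
Implicit Types (A B : set T).

Definition prb A : R := fine (mu A).

Lemma prbE A : measurable A -> mu A = (prb A)%:E.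
Proof. by move=> mA; rewrite /prb fineK // fin_num_measure. Qed.

Lemma prb_ge0 A : 0 <= prb A. Proof. exact: fine_ge0. Qed.

Lemma prb0 : prb set0 = 0. Proof. by rewrite /prb measure0. Qed.

Lemma prbT : prb setT = 1. Proof. by rewrite /prb probability_setT. Qed.

Lemma prb_le A B : measurable A -> measurable B -> A `<=` B -> prb A <= prb B.
Proof.
move=> mA mB AB; rewrite fine_le ?fin_num_measure //.
by apply: le_measure; rewrite ?inE.
Qed.

Lemma prb_le1 A : measurable A -> prb A <= 1.
Proof. by move=> mA; rewrite -prbT; exact: prb_le. Qed.

Lemma prbU A B : measurable A -> measurable B -> A `&` B = set0 ->
  prb (A `|` B) = prb A + prb B.
Proof.
move=> mA mB AB; rewrite /prb measureU // fineD ?fin_num_measure //.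
Qed.

Lemma prbC A : measurable A -> prb (~` A) = 1 - prb A.
Proof.
move=> mA; have mC := measurableC mA.
rewrite -prbT -(setUv A) prbU // ?setICr //; ring.
Qed.

Lemma prbD A B : measurable A -> measurable B -> prb A = prb (A `&` B) + prb (A `\` B).
Proof.
move=> mA mB; rewrite -prbU ?setUIDK //; [exact: measurableI|exact: measurableD|].
by rewrite setDE setIACA setICr setI0.
Qed.

Lemma prbU_le A B : measurable A -> measurable B -> prb (A `|` B) <= prb A + prb B.
Proof.
move=> mA mB; have mAB := measurableU _ _ mA mB.
rewrite (prbD mAB mA) setUK lerD2l; apply: prb_le => //; first exact: measurableD.
by move=> x [[Ax|//] nAx].
Qed.

Lemma prb_bigU (I : finType) (s : seq I) (P : pred I) (F : I -> set T) : uniq s ->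
  (forall i, measurable (F i)) -> (forall i j x, F i x -> F j x -> i = j) ->
  prb (\big[setU/set0]_(i <- s | P i) F i) = \sum_(i <- s | P i) prb (F i).
Proof.
move=> + mF dF; elim: s => [|i s IH] /=; first by rewrite !big_nil prb0.
move=> /andP [ins us]; rewrite !big_cons; case: ifP => [Pi|_]; last exact: IH.
rewrite prbU ?IH //; first exact: bigsetU_measurable.
rewrite -subset0 -bigcup_seq_cond => x [Fix [j /= /andP [js _] Fjx]].
by move: ins; rewrite (dF _ _ _ Fix Fjx) js.
Qed.

End RealProbability.

Section FiniteEntropy.
Context {R : realType} {disp : measure_display} {T : measurableType disp}.
Variable mu : probability T R.
Implicit Types I J K : finType.
Local Notation prb := (prb mu).

(** Finite partitions are handled as labellings [X : T -> I]: joining them is pairing and coarsening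
    is composition. *)
Definition fmeas I (X : T -> I) := forall i, measurable (X @^-1` [set i]).

Definition pr I (X : T -> I) i : R := prb (X @^-1` [set i]).

Definition entropy I (X : T -> I) : R := - \sum_i pr X i * ln (pr X i).

Lemma fmeas_set I (X : T -> I) (P : pred I) : fmeas X -> measurable [set x | P (X x)].
Proof.
move=> mX; have -> : [set x | P (X x)] = \big[setU/set0]_(i | P i) (X @^-1` [set i]).
  rewrite -bigcup_seq_cond; apply/seteqP; split=> [x /= PX|x [i /= /andP [_ Pi] ->] //].
  by exists (X x) => //=; rewrite mem_index_enum.
exact: bigsetU_measurable.
Qed.

Lemma fmeas_comp I J (X : T -> I) (g : I -> J) : fmeas X -> fmeas (g \o X).
Proof.
move=> mX j; rewrite (_ : _ @^-1` _ = [set x | g (X x) == j]).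
  exact: (fmeas_set (fun i => g i == j)).
by apply/seteqP; split=> x /= /eqP.
Qed.

Lemma fmeas_pair I J (X : T -> I) (Y : T -> J) : fmeas X -> fmeas Y ->
  fmeas (fun x => (X x, Y x)).
Proof.
move=> mX mY [i j]; rewrite (_ : _ @^-1` _ = X @^-1` [set i] `&` Y @^-1` [set j]).
  exact: measurableI.
by apply/seteqP; split=> x /= [-> ->].
Qed.

Lemma prb_fset I (X : T -> I) (P : pred I) : fmeas X ->
  prb [set x | P (X x)] = \sum_(i | P i) pr X i.
Proof.
move=> mX; have -> : [set x | P (X x)] = \big[setU/set0]_(i | P i) (X @^-1` [set i]).
  rewrite -bigcup_seq_cond; apply/seteqP; split=> [x /= PX|x [i /= /andP [_ Pi] ->] //].
  by exists (X x) => //=; rewrite mem_index_enum.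
by apply: prb_bigU => // [|i j x /= -> //]; exact: index_enum_uniq.
Qed.

Lemma pr_comp I J (X : T -> I) (g : I -> J) j : fmeas X ->
  pr (g \o X) j = \sum_(i | g i == j) pr X i.
Proof.
move=> mX; rewrite -prb_fset //; congr prb.
by apply/seteqP; split=> x /= /eqP.
Qed.

Lemma pr_ge0 I (X : T -> I) i : 0 <= pr X i. Proof. exact: prb_ge0. Qed.

Lemma pr_le1 I (X : T -> I) i : fmeas X -> pr X i <= 1.
Proof. by move=> mX; exact: prb_le1. Qed.

Lemma pr_sum I (X : T -> I) : fmeas X -> \sum_i pr X i = 1.
Proof.
move=> mX; rewrite -(prbT mu) -(prb_fset xpredT) //; congr prb.
by apply/seteqP; split.
Qed.

Lemma pr_marginal I K (V : T -> I * K) k : fmeas V ->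
  \sum_i pr V (i, k) = pr (snd \o V) k.
Proof.
move=> mV; rewrite pr_comp // (eq_bigl (fun u => xpredT u.1 && (u.2 == k))) //.
rewrite (eq_bigr (fun u => pr V (u.1, u.2))); last by case.
rewrite -(pair_big xpredT (pred1 k) (fun i k => pr V (i, k))) /=.
by apply: eq_bigr => i _; rewrite big_pred1_eq.
Qed.

Lemma sum_pr_comp I J (X : T -> I) (g : I -> J) (F : J -> R) : fmeas X ->
  \sum_j pr (g \o X) j * F j = \sum_i pr X i * F (g i).
Proof.
move=> mX; rewrite (partition_big g xpredT) //=; apply: eq_bigr => j _.
by rewrite pr_comp // mulr_suml; apply: eq_bigr => i /eqP ->.
Qed.

Lemma pr_comp_le I J (X : T -> I) (g : I -> J) i : fmeas X -> pr X i <= pr (g \o X) (g i).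
Proof.
move=> mX; rewrite pr_comp // (bigD1 i) //= lerDl; apply: sumr_ge0 => j _; exact: pr_ge0.
Qed.

Lemma pr_comp_gt0 I J (X : T -> I) (g : I -> J) i : fmeas X -> pr X i != 0 ->
  0 < pr (g \o X) (g i).
Proof.
move=> mX Xi; apply: lt_le_trans (pr_comp_le g i mX).
by rewrite lt_def Xi pr_ge0.
Qed.

Lemma entropy_comp_le I J (X : T -> I) (g : I -> J) : fmeas X ->
  entropy (g \o X) <= entropy X.
Proof.
move=> mX; rewrite /entropy lerN2 (sum_pr_comp g (fun j => ln (pr (g \o X) j))) //.
apply: ler_sum => i _; have [->|Xi] := eqVneq (pr X i) 0; first by rewrite !mul0r.
rewrite ler_wpM2l ?pr_ge0 // ler_ln ?posrE ?pr_comp_le ?pr_comp_gt0 //.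
by rewrite lt_def Xi pr_ge0.
Qed.

Lemma entropy_ge0 I (X : T -> I) : fmeas X -> 0 <= entropy X.
Proof.
move=> mX; rewrite /entropy oppr_ge0; apply: sumr_le0 => i _.
by rewrite mulr_ge0_le0 ?pr_ge0 // ln_le0 // pr_le1.
Qed.

(** Termwise ln x <= x - 1 with x = q / p. *)
Lemma gibbs_inequality I (p q : I -> R) : (forall i, 0 <= p i) -> (forall i, 0 <= q i) ->
  (forall i, q i = 0 -> p i = 0) -> \sum_i q i <= \sum_i p i ->
  \sum_i p i * ln (q i) <= \sum_i p i * ln (p i).
Proof.
move=> p0 q0 qp sqp; rewrite -subr_le0 -sumrB.
apply: (@le_trans _ _ (\sum_i (q i - p i))); last by rewrite sumrB subr_le0.
apply: ler_sum => i _; have [->|pi] := eqVneq (p i) 0.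
  by rewrite !mul0r subrr subr0.
have pi0 : 0 < p i by rewrite lt_def pi p0.
have qi0 : 0 < q i by rewrite lt_def q0 andbT; apply: contra_neq pi; exact: qp.
rewrite -mulrBr -ln_div ?posrE //.
have -> : q i - p i = p i * (q i / p i - 1) by rewrite mulrBr mulr1 mulrCA divff ?mulr1.
rewrite ler_wpM2l //; rewrite -[X in ln X](subrKC 1); apply: le_ln1Dx.
by rewrite ltrBrDl addrN divr_gt0.
Qed.

(** Gibbs' inequality against the law [q] that makes [X] and [Y] conditionally independent given
    [Z]. *)
Lemma strong_subadditivity I J K (X : T -> I) (Y : T -> J) (Z : T -> K) :
  fmeas X -> fmeas Y -> fmeas Z ->
  entropy (fun x => (X x, Y x, Z x)) + entropy Z <=
  entropy (fun x => (X x, Z x)) + entropy (fun x => (Y x, Z x)).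
Proof.
move=> mX mY mZ; pose W x := (X x, Y x, Z x).
have mW : fmeas W by apply: fmeas_pair => //; exact: fmeas_pair.
pose f1 (w : I * J * K) := (w.1.1, w.2); pose f2 (w : I * J * K) := (w.1.2, w.2).
pose f3 (w : I * J * K) := w.2.
have -> : (fun x => (X x, Z x)) = f1 \o W by [].
have -> : (fun x => (Y x, Z x)) = f2 \o W by [].
have -> : Z = f3 \o W by [].
pose q w := pr (f1 \o W) (f1 w) * pr (f2 \o W) (f2 w) / pr (f3 \o W) (f3 w).
have gb : \sum_w pr W w * ln (q w) <= \sum_w pr W w * ln (pr W w).
  apply: gibbs_inequality.
  - by move=> w; exact: pr_ge0.
  - by move=> w; rewrite divr_ge0 ?mulr_ge0 ?pr_ge0.
  - move=> w /eqP; apply: contraTeq => pw.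
    by rewrite gt_eqF // divr_gt0 ?mulr_gt0 ?pr_comp_gt0.
  rewrite (pr_sum mW) /q -(pair_bigA _ (fun ij k =>
    pr (f1 \o W) (ij.1, k) * pr (f2 \o W) (ij.2, k) / pr (f3 \o W) k)) /=.
  rewrite exchange_big /=.
  have mZ' : fmeas (f3 \o W) by exact: fmeas_comp.
  rewrite -(pr_sum mZ'); apply: ler_sum => k _.
  rewrite -(pair_bigA _ (fun i j => pr (f1 \o W) (i, k) * pr (f2 \o W) (j, k) / pr (f3 \o W) k)) /=.
  have s1 : \sum_i pr (f1 \o W) (i, k) = pr (f3 \o W) k by exact/pr_marginal/fmeas_comp.
  have s2 : \sum_j pr (f2 \o W) (j, k) = pr (f3 \o W) k by exact/pr_marginal/fmeas_comp.
  under eq_bigr => i _ do rewrite -mulr_suml -mulr_sumr s2.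
  rewrite -!mulr_suml s1; have [->|k0] := eqVneq (pr (f3 \o W) k) 0.
    by rewrite !mul0r.
  by rewrite mulfK.
rewrite /entropy -!opprD lerN2.
rewrite (sum_pr_comp f1 (fun j => ln (pr (f1 \o W) j))) //.
rewrite (sum_pr_comp f2 (fun j => ln (pr (f2 \o W) j))) //.
rewrite (sum_pr_comp f3 (fun j => ln (pr (f3 \o W) j))) //.
rewrite -lerBlDr; apply: le_trans gb; rewrite -big_split /= -sumrB.
rewrite le_eqVlt; apply/orP; left; apply/eqP; apply: eq_bigr => w _.
have [->|w0] := eqVneq (pr W w) 0; first by rewrite !mul0r addr0 subr0.
rewrite -mulrDr -mulrBr /q ln_div ?lnM ?posrE ?mulr_gt0 ?pr_comp_gt0 //.
Qed.

End FiniteEntropy.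

(** * Fekete's lemma *)

Section Fekete.
Context {R : realType}.
Implicit Types (a : nat -> R).

Lemma subadditive_mul a k r q : (forall m n, a (m + n)%N <= a m + a n) ->
  a (q * k + r)%N <= q%:R * a k + a r.
Proof.
move=> sub; elim: q => [|q IH]; first by rewrite mul0n mul0r !add0r.
rewrite mulSn -addnA; apply: le_trans (sub _ _) _.
by rewrite -natr1 mulrDl mul1r -addrA addrCA lerD2l.
Qed.

Lemma subadditive_limit a c : (forall m n, a (m + n)%N <= a m + a n) ->
  (forall n, - c * n%:R <= a n) ->
  cvgn (fun n => a n / n%:R) /\ forall k, (0 < k)%N -> limn (fun n => a n / n%:R) <= a k / k%:R.
Proof.
move=> sub lb; pose S := [set a k / k%:R | k in [set k | (0 < k)%N]].
have infS : has_inf S.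
  split; first by exists (a 1%N / 1%:R), 1%N.
  exists (- c) => _ [k /= k0 <-]; rewrite ler_pdivlMr ?ltr0n //.
suff cv : (fun n => a n / n%:R) @ \oo --> inf S.
  split; first by apply/cvg_ex; exists (inf S).
  move=> k k0; rewrite (cvg_lim _ cv) //; apply: ge_inf; first exact: (infS.2).
  by exists k.
apply/cvgrPdist_le => e e0.
have e20 : 0 < e / 2 by rewrite divr_gt0.
have [_ [k /= k0 <-] kS] := inf_adherent e20 infS.
(* For n = q k + r the first term pays for replacing [q] by n / k, the sum for the remainder
   [a r]. *)
pose M := `|a k| + \sum_(r < k) `|a r|.
have M0 : 0 <= M by rewrite addr_ge0 // sumr_ge0.
near=> n.
have n0 : (0 < n)%N by near: n; exists 1%N.
have nM : M / n%:R <= e / 2.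
  rewrite ler_pdivrMr ?ltr0n // -ler_pdivrMl //.
  near: n; exists (Num.bound `|(e / 2)^-1 * M|) => // n /= hn.
  apply: (le_trans (ler_norm _)); apply/ltW; apply: lt_le_trans (archi_boundP (normr_ge0 _)) _.
  by rewrite ler_nat.
have low : inf S <= a n / n%:R by apply: ge_inf; [exact: infS.2 | exists n].
rewrite distrC ger0_norm ?subr_ge0 // lerBlDl.
have kR : 0 < k%:R :> R by rewrite ltr0n.
have nR : 0 < n%:R :> R by rewrite ltr0n.
apply: (@le_trans _ _ (a k / k%:R + M / n%:R)); last first.
  by apply: le_trans (lerD (ltW kS) nM) _; rewrite -addrA -mulrDl -mulr2n -[e *+ 2]mulr_natr mulfK.
rewrite ler_pdivrMr // mulrDl divfK ?gt_eqF //.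
rewrite {1}(divn_eq n k); apply: le_trans (subadditive_mul _ _ _ sub) _.
have rk : (n %% k < k)%N by rewrite ltn_mod.
have ar : a (n %% k)%N <= \sum_(r < k) `|a r|.
  apply: le_trans (ler_norm _) _; rewrite (bigD1 (Ordinal rk)) //= lerDl.
  exact: sumr_ge0.
rewrite /M [X in _ <= X]addrA lerD //.
have nE : n%:R = (n %/ k)%:R * k%:R + (n %% k)%:R :> R by rewrite -natrM -natrD -divn_eq.
rewrite nE mulrDr mulrCA divfK ?gt_eqF // -addrA lerDl.
rewrite mulrAC -mulrA.
have : `|a k * ((n %% k)%:R / k%:R)| <= `|a k|.
  rewrite normrM ler_piMr // ger0_norm // ler_pdivrMr // mul1r ler_nat ltnW //.
by rewrite ler_norml => /andP [+ _]; lra.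
Unshelve. all: by end_near. Qed.

End Fekete.

Section Relabelling.
Context {R : realType} {disp : measure_display} {T : measurableType disp}.
Variable mu : probability T R.
Implicit Types I J K : finType.
Local Notation entropy := (entropy mu).

Lemma entropy_unit (X : T -> unit) : fmeas X -> entropy X = 0.
Proof.
move=> mX; rewrite /entropy; apply/eqP; rewrite oppr_eq0; apply/eqP.
apply: big1 => -[] _; have := pr_sum mu mX.
by rewrite (bigD1 tt) //= big1 ?addr0 => [->|[]//]; rewrite ln1 mulr0.
Qed.

Lemma entropy_eq I J (X : T -> I) (Y : T -> J) (g : I -> J) (h : J -> I) :
  fmeas X -> fmeas Y -> Y = g \o X -> X = h \o Y -> entropy X = entropy Y.
Proof.
move=> mX mY YE XE; apply/eqP; rewrite eq_le {1}XE entropy_comp_le // YE.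
by rewrite entropy_comp_le.
Qed.

Lemma entropy_pair_le I J (X : T -> I) (Y : T -> J) : fmeas X -> fmeas Y ->
  entropy (fun x => (X x, Y x)) <= entropy X + entropy Y.
Proof.
move=> mX mY; pose Z (x : T) := tt.
have mZ : fmeas Z.
  move=> i; rewrite (_ : _ @^-1` _ = setT) //.
  by apply/seteqP; split=> x //=; case: i.
have := strong_subadditivity mu mX mY mZ; rewrite entropy_unit // addr0.
rewrite (_ : entropy (fun x => (X x, Z x)) = entropy X); last first.
  by apply: (@entropy_eq _ _ _ _ fst (fun i => (i, tt))) => //; exact: fmeas_pair.
rewrite (_ : entropy (fun x => (Y x, Z x)) = entropy Y); last first.
  by apply: (@entropy_eq _ _ _ _ fst (fun i => (i, tt))) => //; exact: fmeas_pair.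
rewrite (_ : entropy (fun x => (X x, Y x, Z x)) = entropy (fun x => (X x, Y x))) //.
apply: (@entropy_eq _ _ _ _ fst (fun i => (i, tt))) => //.
- by apply: fmeas_pair => //; exact: fmeas_pair.
- exact: fmeas_pair.
Qed.

(** Strong subadditivity with a third label that is a function of the second: conditioning on less
    information raises conditional entropy. *)
Lemma cond_entropy_comp_le I J K (X : T -> I) (Y : T -> J) (g : J -> K) :
  fmeas X -> fmeas Y ->
  entropy (fun x => (X x, Y x)) - entropy Y <=
  entropy (fun x => (X x, g (Y x))) - entropy (g \o Y).
Proof.
move=> mX mY; have mZ : fmeas (g \o Y) by exact: fmeas_comp.
have := strong_subadditivity mu mX mY mZ.
rewrite (_ : entropy (fun x => (Y x, (g \o Y) x)) = entropy Y); last first.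
  by apply: (@entropy_eq _ _ _ _ fst (fun j => (j, g j))) => //; exact: fmeas_pair.
rewrite (_ : entropy (fun x => (X x, Y x, (g \o Y) x)) = entropy (fun x => (X x, Y x))); last first.
  apply: (@entropy_eq _ _ _ _ fst (fun u => (u, g u.2))) => //.
  - by apply: fmeas_pair => //; exact: fmeas_pair.
  - exact: fmeas_pair.
by move=> h; rewrite lerBlDr addrAC lerBrDr.
Qed.

(** From ln (1/u) <= 1/u with t = u^2; a modulus of continuity at 0 that is easy to invert. *)
Lemma xlnx_le (t : R) : 0 <= t -> - (t * ln t) <= 2 * Num.sqrt t.
Proof.
rewrite le_eqVlt => /predU1P [<-|t0]; first by rewrite mul0r oppr0 sqrtr0 mulr0.
set u := Num.sqrt t; have u0 : 0 < u by rewrite sqrtr_gt0.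
have -> : t = u ^+ 2 by rewrite sqr_sqrtr // ltW.
rewrite lnXn // -mulNr mulrnAr -mulr_natl ler_pM2l // mulNr -mulrN -lnV ?posrE //.
rewrite expr2 -mulrA -[leRHS]mulr1 ler_pM2l // -(@ler_pM2l _ u^-1) ?invr_gt0 //.
by rewrite mulKf ?gt_eqF // mulr1; apply/ltW/ln_sublinear; rewrite invr_gt0.
Qed.

(* A Fano-type bound on H(X | Z). *)
Lemma cond_entropy_small I (X Z : T -> I) (e : R) : fmeas X -> fmeas Z -> 0 <= e ->
  (forall i j, i != j -> pr mu (fun x => (X x, Z x)) (i, j) <= e) ->
  entropy (fun x => (X x, Z x)) - entropy Z <= #|I|%:R ^+ 2 * (2 * Num.sqrt e + e).
Proof.
move=> mX mZ e0 small; pose W x := (X x, Z x).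
have mW : fmeas W by exact: fmeas_pair.
rewrite /entropy opprK addrC -sumrN.
have -> : Z = snd \o W by [].
rewrite (sum_pr_comp mu snd (fun j => ln (pr mu (snd \o W) j))) // -/W -big_split /=.
apply: (@le_trans _ _ (\sum_(w : I * I) (2 * Num.sqrt e + e))); last first.
  by rewrite sumr_const card_prod -[leLHS]mulr_natl natrM expr2.
(* Each off-diagonal cell pays for its own term, at most 2 sqrt e, and for its share, at most [e],
   of the defect [q j - p (j, j)] that bounds the diagonal term. *)
pose b (w : I * I) : R := if w.1 == w.2 then 0 else 2 * Num.sqrt e + e.
have s0 : 0 <= Num.sqrt e by exact: sqrtr_ge0.
apply: (@le_trans _ _ (\sum_(w : I * I) b w)); last first.
  by apply: ler_sum => w _; rewrite /b; case: ifP => // _; lra.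
pose p w := pr mu W w; pose q j := pr mu (snd \o W) j.
have p0 w : 0 <= p w by exact: pr_ge0.
have pq w : p w <= q w.2 by exact: pr_comp_le.
pose c (w : I * I) : R := if w.1 == w.2 then q w.2 - p w else 2 * Num.sqrt e.
apply: (@le_trans _ _ (\sum_(w : I * I) c w)).
  apply: ler_sum => w _; rewrite -/(p w) -/(q w.2) /c.
  have [pw|pw] := eqVneq (p w) 0.
    have := pq w; rewrite pw !mul0r oppr0 addr0 => q0.
    by case: ifP => _; rewrite ?addr0 // mulr_ge0.
  have pw0 : 0 < p w by rewrite lt_def pw p0.
  have qw0 : 0 < q w.2 := lt_le_trans pw0 (pq w).
  case: ifPn => [_|wne].
    rewrite -mulrBr -ln_div ?posrE //.
    have -> : q w.2 - p w = p w * (q w.2 / p w - 1) by rewrite mulrBr mulr1 mulrCA divff ?mulr1.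
    rewrite ler_wpM2l //; rewrite -[X in ln X](subrKC 1); apply: le_ln1Dx.
    by rewrite ltrBrDl addrN divr_gt0.
  apply: (@le_trans _ _ (- (p w * ln (p w)))).
    by rewrite gerDr mulr_ge0_le0 // ln_le0 // pr_le1 //; exact: fmeas_comp.
  apply: le_trans (xlnx_le (p0 w)) _; rewrite ler_pM2l // ler_sqrt //.
  by case: w wne {pw pw0 qw0} => i j /= ij; exact: small.
have swap (F : I * I -> R) : \sum_w F w = \sum_j \sum_i F (i, j).
  rewrite exchange_big /= (pair_bigA _ (fun i j => F (i, j))) /=.
  by apply: eq_bigr => -[].
rewrite !swap; apply: ler_sum => j _.
rewrite (bigD1 j) //= [leRHS](bigD1 j) //= /c /b /= eqxx add0r.
have -> : q j - p (j, j) = \sum_(i | i != j) p (i, j).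
  by rewrite /q -pr_marginal // (bigD1 j) //= addrAC subrr add0r.
rewrite -big_split /=; apply: ler_sum => i /negPf ij; rewrite ij addrC lerD2l.
by apply: small; rewrite ij.
Qed.

End Relabelling.

Lemma cvg_div_nat (R : realType) (c : R) : (fun n => c / n%:R) @ \oo --> (0 : R).
Proof.
rewrite -(@cvg_shiftS _ (fun n => c / n%:R)) /=.
have h : c * harmonic n @[n --> \oo] --> c * 0.
  by apply: cvgM; [exact: cvg_cst | exact: cvg_harmonic].
by rewrite mulr0 in h.
Qed.

(** * Entropy rates and generating partitions *)

Section Itineraries.
Context {R : realType} {disp : measure_display} {T : measurableType disp}.
Variables (mu : probability T R) (f : T -> T).
Hypothesis f_meas : measurable_fun setT f.
Hypothesis f_inv : forall B, measurable B -> mu (f @^-1` B) = mu B.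
Implicit Types I J : finType.
Local Notation entropy := (entropy mu).

Definition itinerary I (X : T -> I) n (x : T) : {ffun 'I_n -> I} :=
  [ffun k : 'I_n => X (iter k f x)].

Lemma preimage_measurable B : measurable B -> measurable (f @^-1` B).
Proof. by move=> mB; rewrite -[_ @^-1` _]setTI; exact: f_meas. Qed.

Lemma fmeas_shift I (X : T -> I) : fmeas X -> fmeas (X \o f).
Proof. by move=> mX i; exact: (preimage_measurable (mX i)). Qed.

Lemma entropy_shift I (X : T -> I) : fmeas X -> entropy (X \o f) = entropy X.
Proof.
move=> mX; rewrite /entropy; congr (- _); apply: eq_bigr => i _.
by rewrite /pr /prb /= -(f_inv (mX i)).
Qed.

Lemma fmeas_iter I (X : T -> I) n : fmeas X -> fmeas (fun x => X (iter n f x)).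
Proof.
move=> mX; elim: n => [|n IH] //; have := fmeas_shift IH.
by congr fmeas; apply/funext => x /=; rewrite -iterSr.
Qed.

Lemma entropy_iter I (X : T -> I) n : fmeas X ->
  entropy (fun x => X (iter n f x)) = entropy X.
Proof.
move=> mX; elim: n => [|n IH] //; rewrite -{}IH -(entropy_shift (fmeas_iter n mX)).
by congr entropy; apply/funext => x /=; rewrite -iterSr.
Qed.

Lemma fmeas_ffun I n (X : 'I_n -> T -> I) : (forall k, fmeas (X k)) ->
  fmeas (fun x => [ffun k => X k x]).
Proof.
move=> mX u; rewrite (_ : _ @^-1` _ = \bigcap_(k in [set: 'I_n]) (X k @^-1` [set u k])).
  by apply: fin_bigcap_measurable => // k _; exact: mX.
apply/seteqP; split=> x /=; first by move=> <- k _ /=; rewrite ffunE.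
by move=> h; apply/ffunP => k; rewrite ffunE; exact: h.
Qed.

Lemma fmeas_itinerary I (X : T -> I) n : fmeas X -> fmeas (itinerary X n).
Proof.
by move=> mX; apply: (@fmeas_ffun _ _ (fun k x => X (iter k f x))) => k; exact: fmeas_iter.
Qed.

Lemma entropy_itineraryD I (X : T -> I) m n : fmeas X ->
  entropy (itinerary X (m + n)) <= entropy (itinerary X m) + entropy (itinerary X n).
Proof.
move=> mX; have mm := @fmeas_itinerary _ X m mX; have mn := @fmeas_itinerary _ X n mX.
rewrite -(entropy_iter m mn); apply: le_trans (entropy_pair_le _ mm (fmeas_iter m mn)).
pose g (uv : {ffun 'I_m -> I} * {ffun 'I_n -> I}) : {ffun 'I_(m + n) -> I} :=
  [ffun k => match fintype.split k with inl i => uv.1 i | inr j => uv.2 j end].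
rewrite (_ : itinerary X (m + n) = g \o (fun x => (itinerary X m x, itinerary X n (iter m f x)))).
  by apply/entropy_comp_le/fmeas_pair => //; exact: fmeas_iter.
apply/funext => x; apply/ffunP => k; rewrite !ffunE /=.
by case: splitP => j ->; rewrite ffunE // -iterD addnC.
Qed.

Definition entropy_rate I (X : T -> I) : R := limn (fun n => entropy (itinerary X n) / n%:R).

Lemma entropy_rate_cvg I (X : T -> I) : fmeas X ->
  cvgn (fun n => entropy (itinerary X n) / n%:R) /\
  forall n, (0 < n)%N -> entropy_rate X <= entropy (itinerary X n) / n%:R.
Proof.
move=> mX; apply: (@subadditive_limit _ (fun n => entropy (itinerary X n)) 0).
  by move=> m n; exact: entropy_itineraryD.
by move=> n; rewrite oppr0 mul0r; apply: entropy_ge0; exact: fmeas_itinerary.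
Qed.

Section Generator.
Context {I J : finType}.
Variables (X : T -> I) (C : T -> J) (n : nat) (e : R).
Hypotheses (mX : fmeas X) (mC : fmeas C).
Hypothesis approx :
  entropy (fun x => (X x, itinerary C n x)) - entropy (itinerary C n) <= e.

(** Given the [C]-itinerary, each label of [X] costs at most [e]: peel off the first label,
    conditioning on a longer itinerary than [approx] does, and shift the rest back by invariance. *)
Lemma itinerary_refine m :
  entropy (fun x => (itinerary X m x, itinerary C (m + n) x)) <=
  entropy (itinerary C (m + n)) + m%:R * e.
Proof.
elim: m => [|m IH].
  rewrite mul0r addr0.
  pose g (w : {ffun 'I_(0 + n) -> J}) : {ffun 'I_0 -> I} * {ffun 'I_(0 + n) -> J} :=
    (ffun0 (card_ord 0), w).
  rewrite (_ : (fun x => _) = g \o itinerary C (0 + n)); last first.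
    by apply/funext => x; congr pair; apply/ffunP => -[].
  by apply: entropy_comp_le; exact: fmeas_itinerary.
pose U := itinerary X m; pose V := itinerary C (m + n); pose V' := itinerary C (m.+1 + n).
have mU : fmeas U by exact: fmeas_itinerary. have mV : fmeas V by exact: fmeas_itinerary.
have mV' : fmeas V' by exact: fmeas_itinerary.
have mUf : fmeas (U \o f) by exact: fmeas_shift.
have mVf : fmeas (V \o f) by exact: fmeas_shift.
have le1 : entropy (fun x => (itinerary X m.+1 x, V' x)) <=
    entropy (fun x => (X x, (U \o f) x, V' x)).
  pose g (t : I * {ffun 'I_m -> I} * {ffun 'I_(m.+1 + n) -> J}) :
      {ffun 'I_m.+1 -> I} * {ffun 'I_(m.+1 + n) -> J} :=
    ([ffun k : 'I_m.+1 => if unlift ord0 k is Some j then t.1.2 j else t.1.1], t.2).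
  rewrite (_ : (fun x => (itinerary X m.+1 x, V' x)) =
      g \o (fun x => (X x, (U \o f) x, V' x))).
    by apply: entropy_comp_le; apply: fmeas_pair => //; exact: fmeas_pair.
  apply/funext => x; congr pair; apply/ffunP => k; rewrite !ffunE /=.
  by case: unliftP => [j ->|->] //=; rewrite ffunE -iterSr.
have le2 := strong_subadditivity mu mX mUf mV'.
have le3 : entropy (fun x => (X x, V' x)) - entropy V' <= e.
  pose g (w : {ffun 'I_(m.+1 + n) -> J}) : {ffun 'I_n -> J} :=
    [ffun k : 'I_n => w (widen_ord (leq_addl m.+1 n) k)].
  have gE : g \o V' = itinerary C n by apply/funext => x; apply/ffunP => k; rewrite !ffunE.
  apply: le_trans (cond_entropy_comp_le mu g mX mV') _; rewrite gE.
  by rewrite (_ : (fun x => (X x, g (V' x))) = (fun x => (X x, itinerary C n x))) // -gE.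
(* [V'] is the letter [C] followed by [V \o f]. The induction hypothesis covers the shifted pair,
   and strong subadditivity given [V \o f] reattaches the letter. *)
have le4 : entropy (fun x => ((U \o f) x, V' x)) <=
    entropy (fun x => ((U \o f) x, C x, (V \o f) x)).
  pose g (t : {ffun 'I_m -> I} * J * {ffun 'I_(m + n) -> J}) :
      {ffun 'I_m -> I} * {ffun 'I_(m.+1 + n) -> J} :=
    (t.1.1, [ffun k : 'I_(m.+1 + n) => if unlift ord0 k is Some j then t.2 j else t.1.2]).
  rewrite (_ : (fun x => ((U \o f) x, V' x)) = g \o (fun x => ((U \o f) x, C x, (V \o f) x))).
    by apply: entropy_comp_le; apply: fmeas_pair => //; exact: fmeas_pair.
  apply/funext => x; congr pair; apply/ffunP => k; rewrite !ffunE /=.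
  by case: unliftP => [j ->|->] //=; rewrite ffunE -iterSr.
have le5 := strong_subadditivity mu mUf mC mVf.
have le6 : entropy (fun x => (C x, (V \o f) x)) <= entropy V'.
  pose g (w : {ffun 'I_(m.+1 + n) -> J}) : J * {ffun 'I_(m + n) -> J} :=
    (w ord0, [ffun k => w (lift ord0 k)]).
  rewrite (_ : (fun x => (C x, (V \o f) x)) = g \o V'); first exact: entropy_comp_le.
  apply/funext => x; rewrite /g /= ffunE; congr pair; apply/ffunP => k.
  by rewrite !ffunE /= -iterSr.
have e1 : entropy (V \o f) = entropy V by exact: entropy_shift.
have e2 : entropy (fun x => ((U \o f) x, (V \o f) x)) = entropy (fun x => (U x, V x)).
  exact: (entropy_shift (fmeas_pair mU mV)).
rewrite e1 e2 in le5; rewrite -/V' -natr1 mulrDl mul1r.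
rewrite -/U -/V in IH.
lra.
Qed.

(** The [n] extra letters contribute a fixed entropy, which vanishes after division by [m]. *)
Lemma entropy_rate_generator : entropy_rate X <= entropy_rate C + e.
Proof.
have [cX _] := entropy_rate_cvg mX; have [cC _] := entropy_rate_cvg mC.
have mCn k : fmeas (itinerary C k) by exact: fmeas_itinerary.
have mXn k : fmeas (itinerary X k) by exact: fmeas_itinerary.
have bound m : entropy (itinerary X m) <=
    entropy (itinerary C m) + entropy (itinerary C n) + m%:R * e.
  apply: le_trans (le_trans (itinerary_refine m) _); last first.
    by rewrite lerD2r; exact: entropy_itineraryD.
  rewrite (_ : itinerary X m = fst \o (fun x => (itinerary X m x, itinerary C (m + n) x))) //.
  by apply: entropy_comp_le; exact: fmeas_pair.
have lim_rhs : (fun m => entropy (itinerary C m) / m%:R + entropy (itinerary C n) / m%:R + e) @ \oo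
    --> entropy_rate C + 0 + e.
  apply: cvgD; last exact: cvg_cst; apply: cvgD => //.
  exact: cvg_div_nat.
rewrite -[entropy_rate C]addr0; apply: ler_cvg_to cX lim_rhs _.
near=> m.
have m0 : (0 < m)%N by near: m; exists 1%N.
rewrite ler_pdivrMr ?ltr0n // !mulrDl !divfK ?pnatr_eq0 -?lt0n // [e * _]mulrC.
exact: bound.
Unshelve. all: by end_near. Qed.

End Generator.

End Itineraries.

(** * Cylinders and measures on the shift space *)

Section Cylinders.
Context {N : nat} {N2 : (2 <= N)%N}.
Local Notation S := (borel_Sigma N2).
Local Notation letter := 'I_N.
Implicit Types (x y : S) (w : seq letter).

Definition cylinder w : set S := [set x | mkseq x (size w) = w].
Local Notation cyl := cylinder.

Lemma mkseqP x y n : (forall k, (k < n)%N -> x k = y k) <-> mkseq x n = mkseq y n.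
Proof.
split=> [h|h k kn].
  by apply/eq_in_map => k; rewrite mem_iota; exact: h.
have := congr1 (fun s => nth (x k) s k) h.
by rewrite !nth_mkseq.
Qed.

Lemma open_cylinder (U : set (Sigma N2)) x : open U -> U x ->
  exists n, forall y, mkseq y n = mkseq x n -> U y.
Proof.
move=> oU Ux.
(* The filter generated by the cylinders around [x] converges to [x] in each coordinate, hence in
   the product topology. *)
pose F : set_system (Sigma N2) :=
  [set A | exists n, forall y : S, mkseq y n = mkseq x n -> A y].
have FF : Filter F.
  split.
  - by exists 0%N.
  - move=> A B [n An] [m Bm]; exists (maxn n m) => y /mkseqP h.
    by split; [apply: An | apply: Bm]; apply/mkseqP => k km; apply: h;
      rewrite leq_max km ?orbT.
  - by move=> A B AB [n An]; exists n => y /An; exact: AB.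
suff : F --> (x : Sigma N2) by apply; exact: open_nbhs_nbhs.
apply/cvg_sup => i A; rewrite nbhsE => -[B [[C _ <-] Bx] BA].
exists i.+1 => y /mkseqP h; apply: BA => /=; rewrite (h i) //.
Qed.

Lemma cyl_nil : cyl [::] = setT.
Proof. by apply/seteqP; split. Qed.

Lemma cyl_rcons w i : cyl (rcons w i) = cyl w `&` [set x | x (size w) = i].
Proof.
apply/seteqP; split=> x; rewrite /cyl /= size_rcons mkseqS.
  by move=> /rcons_inj [].
by case=> -> ->.
Qed.

Lemma coord_open k i : open ([set x | x k = i] : set (Sigma N2)).
Proof.
have h := @proj_continuous nat (fun=> discrete_topology letter) k.
apply: (@open_comp _ _ _ [set i]); last exact: discrete_open.
by move=> x _; exact: h.
Qed.

Lemma cyl_open w : open (cyl w : set (Sigma N2)).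
Proof.
elim/last_ind: w => [|w i IH]; first by rewrite cyl_nil; exact: openT.
by rewrite cyl_rcons; apply: openI => //; exact: coord_open.
Qed.

Lemma cyl_measurable w : measurable (cyl w).
Proof. by apply: sub_sigma_algebra; exact: cyl_open. Qed.

Lemma clopen_bigcup n (P : pred (seq letter)) :
  [set x : S | P (mkseq x n)] = \bigcup_(t in [set t : n.-tuple letter | P t]) cyl t.
Proof.
apply/seteqP; split=> x /= [].
  move=> Px; have sz : size (mkseq x n) == n by rewrite size_mkseq.
  by exists (Tuple sz) => //=; rewrite /cyl /= size_mkseq.
by move=> t Pt; rewrite /cyl /= size_tuple => ->.
Qed.

Lemma clopen_measurable n (P : pred (seq letter)) : measurable [set x : S | P (mkseq x n)].
Proof.
rewrite clopen_bigcup; apply: fin_bigcup_measurable => // t _; exact: cyl_measurable.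
Qed.

Lemma borel_ind (G : set (set S)) : sigma_algebra setT G -> (forall w, G (cyl w)) ->
  forall B, measurable B -> G B.
Proof.
move=> sG Gc B mB; apply: (smallest_sub sG _ mB) => U oU.
(* Words are countable, so an open set is a countable union of the cylinders it contains, enumerated
   by [unpickle] and padded with empty sets. *)
pose F n : set S := if unpickle n is Some w then
    if `[< cyl w `<=` U >] then cyl w else set0 else set0.
have -> : U = \bigcup_n F n.
  apply/seteqP; split=> x.
    move=> Ux; have [n h] := open_cylinder oU Ux.
    exists (pickle (mkseq x n)) => //; rewrite /F pickleK.
    have : cyl (mkseq x n) `<=` U by move=> y; rewrite /cyl /= size_mkseq; exact: h.
    by move/asboolP => ->; rewrite /cyl /= size_mkseq.
  by case=> n _; rewrite /F; case: unpickle => // w; case: asboolP => // sub /sub.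
have [G0 GC GU] := sG; apply: (GU F) => n; rewrite /F; case: unpickle => [w|] //.
by case: ifP.
Qed.

Lemma shift_measurable : measurable_fun setT (fullshift N2).
Proof.
move=> _ B mB; rewrite setTI.
pose G : set (set S) := [set B | measurable (fullshift N2 @^-1` B)].
apply: (@borel_ind G) mB; last first.
  move=> w; rewrite /G /= (_ : _ @^-1` _ = \bigcup_(i : letter) cyl (i :: w)).
    by apply: fin_bigcup_measurable => // i _; exact: cyl_measurable.
  apply/seteqP; split=> x; rewrite /cyl /=.
    by move=> <-; exists (x 0%N) => //=; rewrite size_mkseq /mkseq /= -[1%N]addn0 iotaDl -map_comp.
  by case=> i _ [_]; rewrite -[1%N]addn0 iotaDl -map_comp.
split.
- by rewrite /G /= preimage_set0.
- move=> A mA; move: mA; rewrite /G /= setTD preimage_setC => mA; apply: measurableC; exact: mA.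
- move=> A mA; rewrite /G /= preimage_bigcup; apply: bigcup_measurable => i _; exact: mA.
Qed.

Lemma coord_fmeas : fmeas (fun x : S => x 0%N : letter).
Proof.
move=> i; rewrite (_ : _ @^-1` _ = cyl [:: i]); first exact: cyl_measurable.
by apply/seteqP; split=> x; rewrite /cyl /=; rewrite /mkseq /=; [move=> <- | case].
Qed.

Lemma iter_shift n x k : iter n (fullshift N2) x k = x (n + k)%N.
Proof. by elim: n k => [|n IH] k //=; rewrite /fullshift IH addSnnS. Qed.

End Cylinders.

Section CylinderMeasures.
Context {R : realType} {N : nat} {N2 : (2 <= N)%N}.
Local Notation S := (borel_Sigma N2).
Local Notation letter := 'I_N.
Local Notation cyl := (@cylinder N N2).
Implicit Types (mu nu : probability S R).

Lemma prb_clopen mu n (P : pred (seq letter)) :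
  prb mu [set x | P (mkseq x n)] = \sum_(t : n.-tuple letter | P t) prb mu (cyl t).
Proof.
rewrite clopen_bigcup.
have -> : \bigcup_(t in [set t : n.-tuple letter | P t]) cyl t =
    \big[setU/set0]_(t : n.-tuple letter | P t) (cyl t : set S).
  rewrite -bigcup_seq_cond; apply: eq_bigcupl; split=> t /=; first by rewrite mem_index_enum.
  by case/andP.
apply: prb_bigU; first exact: index_enum_uniq.
  by move=> t; exact: cyl_measurable.
move=> s t x; rewrite /cyl /= !size_tuple => es et; apply: val_inj.
by rewrite /= -es -et.
Qed.

Lemma sum_cyl mu n : \sum_(t : n.-tuple letter) prb mu (cyl t) = 1.
Proof. by rewrite -(prb_clopen mu n xpredT) -(prbT mu); congr prb; apply/seteqP; split. Qed.

(** Uniqueness of extension from the pi-system of sets decided by finitely many letters. *)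
Lemma measure_cyl_unique mu nu : (forall w, prb mu (cyl w) = prb nu (cyl w)) ->
  forall B, measurable B -> mu B = nu B.
Proof.
move=> h.
pose G : set (set S) := [set B | exists n (P : pred (seq letter)), B = [set x | P (mkseq x n)]].
have GT : G setT by exists 0%N, xpredT; apply/seteqP; split.
apply: (measure_unique G (fun=> setT)) => //.
- apply/seteqP; split=> B.
    apply: borel_ind; first exact: smallest_sigma_algebra.
    move=> w; apply: sub_sigma_algebra; exists (size w), (pred1 w).
    by apply/seteqP; split=> x; rewrite /cylinder /= => /eqP.
  apply: smallest_sub; first exact: sigma_algebra_measurable.
  by move=> _ [n [P ->]]; exact: clopen_measurable.
- move=> _ _ [n [P ->]] [m [Q ->]].
  exists (maxn n m), (fun s => P (take n s) && Q (take m s)).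
  have tk (x : S) k l : (k <= l)%N -> take k (mkseq x l) = mkseq x k.
    by move=> kl; rewrite /mkseq -map_take take_iota (minn_idPl kl).
  apply/seteqP; split=> x /=; rewrite !tk ?leq_maxl ?leq_maxr //.
    by case=> -> ->.
  by case/andP.
- by rewrite bigcup_const.
- move=> _ [n [P ->]].
  apply: (etrans (prbE mu (clopen_measurable n P))); apply: esym.
  apply: (etrans (prbE nu (clopen_measurable n P))).
  by rewrite !prb_clopen; congr (_%:E); apply: eq_bigr => t _; rewrite h.
- by move=> _; apply: (@le_lt_trans _ _ 1%E); [exact: probability_le1 | exact: ltry].
Qed.

Lemma shift_invariant_cyl mu : (forall w, \sum_i prb mu (cyl (i :: w)) = prb mu (cyl w)) ->
  shift_invariant mu.
Proof.
move=> h.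
have pre w : fullshift N2 @^-1` (cyl w) = \big[setU/set0]_(i : letter) cyl (i :: w).
  rewrite -bigcup_seq; apply/seteqP; split=> x; rewrite /cylinder /=.
    move=> <-; exists (x 0%N); first by rewrite /= mem_index_enum.
    by rewrite /= size_mkseq /mkseq /= -[1%N]addn0 iotaDl -map_comp.
  by case=> i _ [_]; rewrite -[1%N]addn0 iotaDl -map_comp.
pose sh : {mfun S >-> S} := HB.pack (fullshift N2)
  (isMeasurableFun.Build _ _ _ _ (fullshift N2) (@shift_measurable N N2)).
move=> B mB.
apply: (@measure_cyl_unique (distribution mu sh) mu) => // w.
rewrite -h [LHS](_ : _ = prb mu (fullshift N2 @^-1` cyl w)) // pre prb_bigU //.
- exact: index_enum_uniq.
- by move=> i; exact: cyl_measurable.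
- by move=> i j x; rewrite /cylinder /= => -[<- _] [<- _].
Qed.

Lemma shift_invariant_prb mu B : shift_invariant mu -> measurable B ->
  prb mu (fullshift N2 @^-1` B) = prb mu B.
Proof. by move=> h mB; rewrite /prb h. Qed.

Lemma prb_bigcup_tail mu (A : nat -> set S) e : (forall n, measurable (A n)) -> 0 < e ->
  exists n, prb mu (\bigcup_i A i `\` \big[setU/set0]_(i < n) A i) < e.
Proof.
move=> mA e0; pose U n := \big[setU/set0]_(i < n) A i.
have mU n : measurable (U n) by exact: bigsetU_measurable.
have mUA : measurable (\bigcup_i A i) by exact: bigcup_measurable.
have UA : \bigcup_n U n = \bigcup_i A i.
  apply/seteqP; split=> x [n _].
    by rewrite /U -bigcup_mkord => -[i _ Ai]; exists i.
  by move=> An; exists n.+1 => //; rewrite /U -bigcup_mkord; exists n => //=.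
have ndU : nondecreasing_seq U.
  move=> n m nm; apply/subsetPset; rewrite /U -!bigcup_mkord => x [i /= lt Ai].
  by exists i => //=; exact: leq_trans nm.
have cv : (EFin \o (fun n => prb mu (U n))) @ \oo --> (prb mu (\bigcup_i A i))%:E.
  rewrite -(prbE mu mUA) (_ : EFin \o _ = mu \o U); last first.
    by apply/funext => n /=; rewrite -prbE.
  by rewrite -UA; apply: nondecreasing_cvg_mu => //; rewrite UA.
have /fine_cvgP [_ /cvgrPdist_lt /(_ e e0) [n _ /(_ n (leqnn n)) /= h]] := cv.
exists n; have h1 := prbD mu mUA (mU n).
have h2 : \bigcup_i A i `&` U n = U n.
  by apply/setIidr => x; rewrite -UA => Ux; exists n.
rewrite h2 in h1; rewrite -/(U n).
have -> : prb mu (\bigcup_i A i `\` U n) = prb mu (\bigcup_i A i) - prb mu (U n).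
  by rewrite h1 addrAC subrr add0r.
exact: le_lt_trans (ler_norm _) h.
Qed.

(** The sets that can be approximated within every [e] form a sigma-algebra containing the
    cylinders; a countable union is first cut to a finite one by [prb_bigcup_tail]. *)
Lemma clopen_approx mu (B : set S) (e : R) : measurable B -> 0 < e ->
  exists n (P : pred (seq letter)), let F := [set x : S | P (mkseq x n)] in
    prb mu (B `\` F) < e /\ prb mu (F `\` B) < e.
Proof.
move=> mB; suff [_ h] : measurable B /\ forall e : R, 0 < e ->
    exists n (P : pred (seq letter)), let F := [set x : S | P (mkseq x n)] in
    prb mu (B `\` F) < e /\ prb mu (F `\` B) < e by exact: h.
pose G : set (set S) := [set B | measurable B /\ forall e : R, 0 < e ->
    exists n (P : pred (seq letter)), let F := [set x : S | P (mkseq x n)] in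
    prb mu (B `\` F) < e /\ prb mu (F `\` B) < e].
apply: (@borel_ind _ _ G) mB; last first.
  move=> w; split=> [|{}e e0]; first exact: cyl_measurable.
  exists (size w), (pred1 w); have -> : cyl w = [set x : S | pred1 w (mkseq x (size w))].
    by apply/seteqP; split=> x; rewrite /cylinder /= => /eqP.
  by rewrite /= setDv prb0.
split.
- split=> // {}e e0; exists 0%N, pred0.
  rewrite /= set0D; split; rewrite ?prb0 // (_ : [set x | false] = set0) ?set0D ?prb0 //.
    by apply/seteqP; split.
- move=> A [mA hA]; rewrite setTD; split=> [|{}e e0]; first exact: measurableC.
  have [n [P /= [h1 h2]]] := hA e e0; exists n, (predC P).
  have -> : [set x : S | predC P (mkseq x n)] = ~` [set x : S | P (mkseq x n)].
    by apply/seteqP; split=> x /= /negP.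
  by rewrite /= !setDE !setCK ![~` _ `&` _]setIC -!setDE.
- move=> A hA; have mA n : measurable (A n) by have [] := hA n.
  split=> [|{}e e0]; first exact: bigcup_measurable.
  have e20 : 0 < e / 2 by rewrite divr_gt0.
  have prb_tri X Y Z : measurable X -> measurable Y -> measurable Z ->
      prb mu (X `\` Z) <= prb mu (X `\` Y) + prb mu (Y `\` Z).
    move=> mX mY mZ; have mXY := measurableD mX mY; have mYZ := measurableD mY mZ.
    apply: le_trans (prbU_le mu mXY mYZ); apply: prb_le.
    - exact: measurableD.
    - exact: measurableU.
    - by move=> x [Xx nZ]; have [Yx|nY] := pselect (Y x); [right | left].
  have GU X Y : G X -> G Y -> G (X `|` Y).
    move=> [mX hX] [mY hY]; split=> [|f f0]; first exact: measurableU.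
    have f20 : 0 < f / 2 by rewrite divr_gt0.
    have [n [P /= [p1 p2]]] := hX _ f20; have [m [Q /= [q1 q2]]] := hY _ f20.
    exists (maxn n m), (fun s => P (take n s) || Q (take m s)) => /=.
    have tk (x : S) k l : (k <= l)%N -> take k (mkseq x l) = mkseq x k.
      by move=> kl; rewrite /mkseq -map_take take_iota (minn_idPl kl).
    have -> : [set x : S | P (take n (mkseq x (maxn n m))) || Q (take m (mkseq x (maxn n m)))] =
        [set x : S | P (mkseq x n)] `|` [set x : S | Q (mkseq x m)].
      by apply/seteqP; split=> x /=; rewrite !tk ?leq_maxl ?leq_maxr // => /orP.
    have mP := @clopen_measurable N N2 n P; have mQ := @clopen_measurable N N2 m Q.
    have sp : f = f / 2 + f / 2 by rewrite -mulrDl -mulr2n -[f *+ 2]mulr_natr mulfK.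
    split; rewrite [ltRHS]sp.
      apply: le_lt_trans (ltrD p1 q1).
      have m1 := measurableD mX mP; have m2 := measurableD mY mQ.
      apply: le_trans (prbU_le mu m1 m2); apply: prb_le.
      - by apply: measurableD; exact: measurableU.
      - exact: measurableU.
      - by move=> x [[?|?] /not_orP [? ?]]; [left | right].
    apply: le_lt_trans (ltrD p2 q2).
    have m1 := measurableD mP mX; have m2 := measurableD mQ mY.
    apply: le_trans (prbU_le mu m1 m2); apply: prb_le.
    - by apply: measurableD; exact: measurableU.
    - exact: measurableU.
    - by move=> x [[?|?] /not_orP [? ?]]; [left | right].
  have [n hn] := prb_bigcup_tail mu mA e20.
  have G0 : G set0.
    split=> // f f0; exists 0%N, pred0.
    rewrite /= set0D; split; rewrite ?prb0 // (_ : [set x | false] = set0) ?set0D ?prb0 //.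
    by apply/seteqP; split.
  have [mU hU] : G (\big[setU/set0]_(i < n) A i) by apply: big_ind => // i _; exact: hA.
  have [m [P /= [p1 p2]]] := hU _ e20; exists m, P => /=.
  have mP := @clopen_measurable N N2 m P.
  have mUA : measurable (\bigcup_i A i) by exact: bigcup_measurable.
  split.
    apply: le_lt_trans (prb_tri _ _ _ mUA mU mP) _.
    rewrite [ltRHS](_ : e = e / 2 + e / 2) ?ltrD //.
    by rewrite -mulrDl -mulr2n -[e *+ 2]mulr_natr mulfK.
  apply: le_lt_trans (lt_trans p2 _); last by rewrite ltr_pdivrMr // ltr_pMr // ltr1n.
  apply: prb_le; try exact: measurableD.
  move=> x [Px nA]; split=> // UA; apply: nA.
  by move: UA; rewrite -bigcup_mkord => -[i _ Ai]; exists i.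
Qed.

End CylinderMeasures.

(** * Kolmogorov-Sinai entropy of the full shift *)

Section KolmogorovSinai.
Context {R : realType} {N : nat} {N2 : (2 <= N)%N}.
Local Notation S := (borel_Sigma N2).
Local Notation letter := 'I_N.
Local Notation cyl := (@cylinder N N2).
Local Notation shift := (fullshift N2).
Variable mu : probability S R.
Hypothesis mu_inv : shift_invariant mu.

Definition coord (x : S) : letter := x 0%N.

Lemma mkseq_itinerary n x : [seq itinerary shift coord n x i | i <- enum 'I_n] = mkseq x n.
Proof.
rewrite /mkseq -val_enum_ord -map_comp; apply/eq_map => k.
by rewrite /= ffunE /coord iter_shift addn0.
Qed.

Lemma partition_label m (P : 'I_m -> set S) : is_partition P ->
  exists2 X : S -> 'I_m, fmeas X & forall i, P i = X @^-1` [set i].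
Proof.
move=> [mP tP cP].
have ex x : exists i, P i x.
  by have : [set: S] x by []; rewrite -cP => -[i _ Pi]; exists i.
pose X x := projT1 (cid (ex x)); have XP x : P (X x) x := projT2 (cid (ex x)).
have PE i : P i = X @^-1` [set i].
  apply/seteqP; split=> x /= => [Pix|<-]; last exact: XP.
  by apply: (tP (X x) i) => //; exists x.
by exists X => // i; rewrite -PE.
Qed.

Lemma join_entropy_itinerary m (P : 'I_m -> set S) X n : (forall i, P i = X @^-1` [set i]) ->
  join_entropy mu shift P n = entropy mu (itinerary shift X n).
Proof.
move=> PX; congr (- _); apply: eq_bigr => w _ /=.
suff -> : join_cell shift P w = itinerary shift X n @^-1` [set w] by [].
apply/seteqP; split=> x; rewrite /join_cell /=.
  by move=> h; apply/ffunP => k; rewrite ffunE; have := h k I; rewrite /= PX.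
by move=> <- k _ /=; rewrite PX /= ffunE.
Qed.

Lemma coord_generates m (X : S -> 'I_m) (e : R) : fmeas X -> 0 < e -> exists n,
  entropy mu (fun x => (X x, itinerary shift coord n x)) -
    entropy mu (itinerary shift coord n) <= e.
Proof.
move=> mX e0.
have sm := @shift_measurable N N2; have mC : fmeas coord := coord_fmeas.
pose q : R := #|'I_m|%:R ^+ 2; have q0 : 0 <= q by rewrite exprn_ge0.
(* With error u^2 the bound of [cond_entropy_small] is q (2 u + u^2), at most 3 q u as u <= 1, hence
   at most [e]. The error is split equally between two exceptional sets, whence [d]. *)
pose u := Num.min 1 (e / (3 * q + 1)).
have s0 : 0 < 3 * q + 1 by rewrite ltr_wpDl // mulr_ge0.
have u0 : 0 < u by rewrite lt_min ltr01 divr_gt0.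
have u1 : u <= 1 by rewrite ge_min lexx.
have ue : u * (3 * q + 1) <= e by rewrite -ler_pdivlMr // ge_min lexx orbT.
pose d := u ^+ 2 / 2; have d0 : 0 < d by rewrite divr_gt0 // exprn_gt0.
have /choice [nP nPh] : forall i, exists nP : nat * pred (seq letter),
    let F := [set x : S | nP.2 (mkseq x nP.1)] in
    prb mu (X @^-1` [set i] `\` F) < d /\ prb mu (F `\` X @^-1` [set i]) < d.
  by move=> i; have [n [P h]] := clopen_approx mu (mX i) d0; exists (n, P).
pose n := (\max_i (nP i).1)%N; exists n.
have tk i (x : S) : take (nP i).1 (mkseq x n) = mkseq x (nP i).1.
  rewrite /mkseq -map_take take_iota; congr (map _ (iota _ _)).
    by apply/minn_idPl; exact: leq_bigmax.
pose hit i (s : seq letter) := (nP i).2 (take (nP i).1 s).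
(* [g] guesses the label from the first [n] letters: some index whose clopen approximation contains
   the point, and a default label if there is none. *)
pose g (w : {ffun 'I_n -> letter}) : 'I_m :=
  odflt (X point) [pick i | hit i [seq w k | k <- enum 'I_n]].
have mI : fmeas (itinerary shift coord n) by exact: fmeas_itinerary.
apply: le_trans (cond_entropy_comp_le mu g mX mI) _.
apply: (@le_trans _ _ (q * (2 * Num.sqrt (u ^+ 2) + u ^+ 2))); last first.
  by rewrite sqrtr_sqr ger0_norm ?ltW //; nra.
apply: (cond_entropy_small mX (fmeas_comp g mI)); first by rewrite exprn_ge0 // ltW.
move=> i j ij.
have mF k : measurable [set x : S | (nP k).2 (mkseq x (nP k).1)] by exact: clopen_measurable.
(* A wrong guess [j] for the label [i] means that the point lies in the approximation of cell [j]
   but not in the cell, or in cell [i] but not in its approximation. *)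
apply: (@le_trans _ _ (prb mu (([set x : S | (nP j).2 (mkseq x (nP j).1)] `\` X @^-1` [set j]) `|`
   (X @^-1` [set i] `\` [set x : S | (nP i).2 (mkseq x (nP i).1)])))).
  apply: prb_le.
  - exact: (fmeas_pair mX (fmeas_comp g mI)).
  - by apply: measurableU; apply: measurableD => //; exact: mX.
  - move=> x /= [Xi]; rewrite /g mkseq_itinerary; case: pickP => [k hk|none] /=.
      move=> kj; left; rewrite -kj; split; first by rewrite -tk.
      by rewrite /= Xi kj; apply/eqP.
    by move=> _; right; split=> //; have := none i; rewrite /hit tk => ->.
have mA : measurable ([set x : S | (nP j).2 (mkseq x (nP j).1)] `\` X @^-1` [set j]).
  by apply: measurableD => //; exact: mX.
have mB : measurable (X @^-1` [set i] `\` [set x : S | (nP i).2 (mkseq x (nP i).1)]).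
  by apply: measurableD => //; exact: mX.
apply: le_trans (prbU_le mu mA mB) _.
have [a1 _] := nPh i; have [_ b2] := nPh j.
rewrite (_ : u ^+ 2 = d + d); first exact: lerD (ltW b2) (ltW a1).
by rewrite /d -mulrDl -mulr2n -[_ *+ 2]mulr_natr mulfK.
Qed.

(** Sinai's generator theorem for the partition by the first letter. *)
Lemma ks_entropy_coord : ks_entropy mu shift = (entropy_rate mu shift coord)%:E.
Proof.
have sm := @shift_measurable N N2; have mC : fmeas coord := coord_fmeas.
have rateE m (P : 'I_m -> set S) X : (forall i, P i = X @^-1` [set i]) ->
    partition_entropy mu shift P = entropy_rate mu shift X.
  move=> PX; rewrite /partition_entropy /entropy_rate.
  by under eq_fun do rewrite (join_entropy_itinerary _ PX).
apply/eqP; rewrite eq_le; apply/andP; split.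
  apply: ge_ereal_sup => _ [m [P [pP ->]]]; have [X mX PX] := partition_label pP.
  rewrite (rateE _ _ _ PX) lee_fin; apply/ler_addgt0Pr => e e0.
  have [n hn] := coord_generates mX e0.
  exact: (entropy_rate_generator sm mu_inv mX mC hn).
apply: ereal_sup_ubound; exists N, (fun i => coord @^-1` [set i]); split.
  split; [exact: mC| |].
    by move=> i j _ _ [x [/= <- <-]].
  by apply/seteqP; split=> // x _; exists (coord x).
by rewrite (rateE _ _ coord).
Qed.

Lemma entropy_words n : entropy mu (itinerary shift coord n) =
  - \sum_(t : n.-tuple letter) prb mu (cyl t) * ln (prb mu (cyl t)).
Proof.
congr (- _).
pose h (t : n.-tuple letter) : {ffun 'I_n -> letter} := [ffun i => tnth t i].
have hbij : bijective h.
  exists (fun w : {ffun 'I_n -> letter} => [tuple w i | i < n]) => [t|w].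
    by apply: eq_from_tnth => i; rewrite tnth_mktuple ffunE.
  by apply/ffunP => i; rewrite ffunE tnth_mktuple.
rewrite (reindex h) /=; last exact: onW_bij.
apply: eq_bigr => t _; rewrite /pr.
suff -> : itinerary shift coord n @^-1` [set h t] = cyl t by [].
have tE : [seq h t i | i <- enum 'I_n] = t.
  by rewrite -[RHS](map_tnth_enum t); apply/eq_map => i; rewrite ffunE.
apply/seteqP; split=> x; rewrite /cylinder /= size_tuple.
  by move=> e; rewrite -mkseq_itinerary e tE.
rewrite -mkseq_itinerary -[in RHS]tE => /eq_in_map e; apply/ffunP => k.
by apply: e; rewrite mem_enum.
Qed.

End KolmogorovSinai.

Section CylinderIntegrals.
Context {R : realType} {N : nat} {N2 : (2 <= N)%N}.
Local Notation S := (borel_Sigma N2).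
Local Notation letter := 'I_N.
Local Notation cyl := (@cylinder N N2).
Variable mu : probability S R.

Lemma integral_words n (F : seq letter -> R) :
  \int[mu]_x F (mkseq x n) = \sum_(t : n.-tuple letter) prb mu (cyl t) * F t.
Proof.
have mc (t : n.-tuple letter) : measurable (cyl t) by exact: cyl_measurable.
pose f (t : n.-tuple letter) (x : S) : \bar R := ((F t)%:E * (\1_(cyl t) x)%:E)%E.
have fi t : mu.-integrable setT (f t).
  by apply: integrableZl => //; exact: integrable_indic.
rewrite /Rintegral (eq_integral (fun x => \sum_t f t x)%E); last first.
  move=> x _; have sz : size (mkseq x n) == n by rewrite size_mkseq.
  rewrite (bigD1 (Tuple sz)) //= big1 ?adde0.
    by rewrite /f /= indicE mem_set ?mule1 //= /cylinder /= size_mkseq.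
  move=> t tx; rewrite /f indicE memNset ?mule0 //= /cylinder /= size_tuple => e.
  by case/eqP: tx; apply: val_inj; rewrite /= e.
rewrite integral_sum //.
rewrite (eq_bigr (fun t : n.-tuple letter => (prb mu (cyl t) * F t)%:E)) ?sumEFin //= => t _.
rewrite integralZl //; last exact: integrable_indic.
by rewrite integral_indic // setIT EFinM muleC -prbE.
Qed.

End CylinderIntegrals.

Section UnitInterval.
Context {R : realType}.

Definition unit_lebesgue : set (measurableTypeR R) -> \bar R :=
  mrestr lebesgue_measure (measurable_itv `[0 : R, 1[).

HB.instance Definition _ := Measure.on unit_lebesgue.

Lemma unit_lebesgue_setT : unit_lebesgue setT = 1%E.
Proof.
by rewrite /unit_lebesgue /mrestr setTI lebesgue_measure_itv /= lte_fin ltr01 sube0.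
Qed.

HB.instance Definition _ := Measure_isProbability.Build _ _ _ unit_lebesgue unit_lebesgue_setT.

End UnitInterval.

(* A consistent weight p on words cuts [0, 1) into nested intervals of lengths
   p w; reading off the digits of a uniform point realises p as a measure. *)
Section CylinderWeights.
Context {R : realType} {N : nat} {N2 : (2 <= N)%N}.
Local Notation S := (borel_Sigma N2).
Local Notation letter := 'I_N.
Local Notation cyl := (@cylinder N N2).
Variable p : seq letter -> R.
Hypotheses (p_ge0 : forall w, 0 <= p w) (p_nil : p [::] = 1).
Hypothesis p_rcons : forall w, \sum_i p (rcons w i) = p w.
Implicit Types (w : seq letter) (t : R).

Let offset w k : R := \sum_(j < N | (j < k)%N) p (rcons w j).

Let offset_le w k l : (k <= l)%N -> offset w k <= offset w l.
Proof.
move=> kl; rewrite /offset big_mkcond [leRHS]big_mkcond /=; apply: ler_sum => j _.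
case: ifP => jk; first by rewrite (leq_trans jk kl).
by case: ifP.
Qed.

Let offset0 w : offset w 0 = 0.
Proof. by rewrite /offset big1. Qed.

Let offsetS w (i : letter) : offset w i.+1 = offset w i + p (rcons w i).
Proof.
rewrite /offset (bigD1 i) //= addrC; congr (_ + _); apply: eq_bigl => j.
by rewrite ltnS andbC -val_eqE ltn_neqAle.
Qed.

Let offsetN w : offset w N = p w.
Proof. by rewrite -p_rcons /offset; apply: eq_bigl => j; rewrite ltn_ord. Qed.

(** Left endpoint of the interval of [rev w]. The recursion is on the reversed word because
    subdivision appends letters at the end. *)
Fixpoint lend_rev w : R :=
  if w is i :: w' then lend_rev w' + \sum_(j < N | (j < i)%N) p (rcons (rev w') j) else 0.

Let lend w := lend_rev (rev w).

Let lend_rcons w i : lend (rcons w i) = lend w + offset w i.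
Proof. by rewrite /lend rev_rcons /= revK. Qed.

Let int w t := (lend w <= t < lend w + p w).

Let int_nil t : int [::] t = (0 <= t < 1).
Proof. by rewrite /int /lend /= p_nil add0r. Qed.

Let int_rcons w i t :
  int (rcons w i) t = (lend w + offset w i <= t < lend w + offset w i.+1).
Proof. by rewrite /int lend_rcons offsetS addrA. Qed.

Let int_sub w i t : int (rcons w i) t -> int w t.
Proof.
rewrite int_rcons /int => /andP [h1 h2]; apply/andP; split.
  by apply: le_trans h1; rewrite lerDl -(offset0 w) offset_le.
by apply: lt_le_trans h2 _; rewrite lerD2l -offsetN offset_le.
Qed.

Let int_disj w i j t : int (rcons w i) t -> int (rcons w j) t -> i = j.
Proof.
wlog ij : i j / (i <= j)%N => [hw|].
  have [le|/ltnW le] := leqP i j; first exact: hw.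
  by move=> hi hj; apply/esym/hw.
rewrite !int_rcons => /andP [_ h1] /andP [h2 _]; apply/val_inj/eqP.
rewrite eqn_leq ij /= leqNgt; apply/negP => lt.
have := lt_le_trans (le_lt_trans h2 h1) (_ : lend w + offset w i.+1 <= lend w + offset w j).
by rewrite ltxx lerD2l offset_le // => /(_ isT).
Qed.

Let int_split w t : int w t -> exists i, int (rcons w i) t.
Proof.
move=> /andP [h1 h2].
have ex : exists k, t < lend w + offset w k.+1.
  by exists N.-1; rewrite prednK ?(ltnW N2) // offsetN.
case: (ex_minnP ex) => k hk kmin.
have kN : (k < N)%N.
  have := kmin N.-1; rewrite prednK ?(ltnW N2) // offsetN => /(_ h2) le.
  by rewrite (leq_ltn_trans le) // ltn_predL (ltnW N2).
exists (Ordinal kN); rewrite int_rcons /= hk andbT.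
case: k hk kmin kN => [|k] hk kmin kN; first by rewrite offset0 addr0.
by rewrite leNgt; apply/negP => /kmin; rewrite ltnn.
Qed.

Let default : letter := Ordinal (ltnW N2).
Let next w t : letter := odflt default [pick i | int (rcons w i) t].
Let stage := fix stage n t : seq letter :=
  if n is n'.+1 then rcons (stage n' t) (next (stage n' t) t) else [::].
Let digits t : S := fun n => next (stage n t) t.

Let mkseq_digits t n : mkseq (digits t) n = stage n t.
Proof. by elim: n => [|n IH] //; rewrite mkseqS IH. Qed.

Let stage_int n t : 0 <= t < 1 -> int (stage n t) t.
Proof.
move=> t01; elim: n => [|n IH]; first by rewrite /= int_nil.
rewrite /= /next; case: pickP => [i //|none].
by have [i hi] := int_split IH; have := none i; rewrite hi.
Qed.

Let int_stage w t : int w t -> stage (size w) t = w.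
Proof.
elim/last_ind: w => [|w i IH] // hi; rewrite size_rcons /= (IH (int_sub hi)); congr rcons.
rewrite /next; case: pickP => [j hj|none]; first exact: int_disj hj hi.
by have := none i; rewrite hi.
Qed.

Let int_unit w t : int w t -> 0 <= t < 1.
Proof.
elim/last_ind: w => [|w i IH]; first by rewrite int_nil.
by move=> /int_sub.
Qed.

Let stage_out n t : ~~ (0 <= t < 1) -> stage n t = nseq n default.
Proof.
move=> out; elim: n => [|n IH] //=; rewrite IH /next.
case: pickP => [i /int_unit h|_]; first by rewrite h in out.
by move=> /=; elim: (n) => //= m ->.
Qed.

Let stage_pre w : [set t | stage (size w) t = w] `&` `[0, 1[ = `[lend w, lend w + p w[%classic.
Proof.
apply/seteqP; split=> t /=; rewrite !in_itv /=.
  by move=> [<- t01]; exact: stage_int.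
by move=> h; split; [exact: int_stage | exact: (@int_unit w)].
Qed.

Let digits_measurable : @measurable_fun _ _ (measurableTypeR R) S setT digits.
Proof.
move=> _ B mB; rewrite setTI.
pose G : set (set S) := [set B | measurable (digits @^-1` B : set (measurableTypeR R))].
apply: (@borel_ind N N2 G) mB; last first.
  move=> w; rewrite /G /=.
  (* Outside [0, 1) all digits are [default], which adds the complement of the unit interval to the
     preimage exactly for constant words of that letter. *)
  have -> : digits @^-1` cyl w = `[lend w, lend w + p w[%classic `|`
      (if w == nseq (size w) default then ~` `[0 : R, 1[%classic else set0).
    rewrite -stage_pre; apply/seteqP; split=> t; rewrite /cylinder /= mkseq_digits.
      move=> e; have [t01|out] := boolP (0 <= t < 1); first by left; rewrite in_itv.
      right; rewrite -{1}e stage_out // eqxx /= in_itv /=; exact/negP.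
    case=> [[]//|]; case: eqP => // e /=; rewrite in_itv /= => /negP out.
    by rewrite stage_out // -e.
  apply: measurableU; first exact: measurable_itv.
  by case: ifP => // _; apply: measurableC; exact: measurable_itv.
split.
- by rewrite /G /= preimage_set0.
- move=> A mA; rewrite /G /= setTD preimage_setC; apply: measurableC; exact: mA.
- by move=> A mA; rewrite /G /= preimage_bigcup; apply: bigcup_measurable => i _; exact: mA.
Qed.

Lemma cylinder_measure_exists : exists mu : probability S R, forall w, prb mu (cyl w) = p w.
Proof.
pose digits' : measurableTypeR R -> S := digits.
pose phi : {mfun measurableTypeR R >-> S} := HB.pack digits'
  (isMeasurableFun.Build _ _ (measurableTypeR R) S digits digits_measurable).
exists (distribution (unit_lebesgue : probability _ R) phi) => w.
rewrite /prb /distribution /pushforward /= /unit_lebesgue /mrestr.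
have -> : digits @^-1` cyl w `&` `[0, 1[%classic = `[lend w, lend w + p w[%classic.
  by rewrite -stage_pre; congr (_ `&` _); apply/seteqP; split=> t; rewrite /cylinder /= mkseq_digits.
rewrite lebesgue_measure_itv /= lte_fin ltrDl; case: ltP => [_|le] /=.
  by rewrite addrAC subrr add0r.
by apply/eqP; rewrite eq_sym eq_le le p_ge0.
Qed.

End CylinderWeights.

(** * Quasi-multiplicative potentials *)

Section WordSums.
Context {R : realType} {T : finType}.
Implicit Types (F G : seq T -> R) (u v w : seq T).

(** Recursion on the length in place of a sum over tuples makes splitting a word into prefix and
    suffix free of casts. *)
Fixpoint wsum n F : R :=
  if n is n'.+1 then \sum_i wsum n' (fun w => F (i :: w)) else F [::].

Lemma eq_wsum n F G : (forall w, size w = n -> F w = G w) -> wsum n F = wsum n G.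
Proof.
elim: n F G => [|n IH] F G FG /=; first exact: FG.
by apply: eq_bigr => i _; apply: IH => w wn; apply: FG; rewrite /= wn.
Qed.

Lemma ler_wsum n F G : (forall w, size w = n -> F w <= G w) -> wsum n F <= wsum n G.
Proof.
elim: n F G => [|n IH] F G FG /=; first exact: FG.
by apply: ler_sum => i _; apply: IH => w wn; apply: FG; rewrite /= wn.
Qed.

Lemma wsumD m n F : wsum (m + n) F = wsum m (fun u => wsum n (fun v => F (u ++ v))).
Proof. by elim: m F => [|m IH] F //=; apply: eq_bigr => i _; rewrite IH. Qed.

Lemma wsum_scale n c F : wsum n (fun w => c * F w) = c * wsum n F.
Proof. by elim: n F => [|n IH] F //=; rewrite mulr_sumr; apply: eq_bigr => i _; rewrite IH. Qed.

Lemma wsum_scaler n c F : wsum n (fun w => F w * c) = wsum n F * c.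
Proof. by rewrite mulrC -wsum_scale; apply: eq_wsum => w _; rewrite mulrC. Qed.

Lemma wsum_add n F G : wsum n (fun w => F w + G w) = wsum n F + wsum n G.
Proof.
elim: n F G => [|n IH] F G //=; rewrite -big_split /=.
by apply: eq_bigr => i _; rewrite IH.
Qed.

Lemma wsum_ge0 n F : (forall w, 0 <= F w) -> 0 <= wsum n F.
Proof. by elim: n F => [|n IH] F F0 //=; apply: sumr_ge0 => i _; exact: IH. Qed.

Lemma wsum_term n F w : (forall w, 0 <= F w) -> size w = n -> F w <= wsum n F.
Proof.
elim: n F w => [|n IH] F w F0 /=; first by move/size0nil ->.
case: w => [//|i w] [wn]; apply: (le_trans (IH (fun w => F (i :: w)) w _ wn)) => //.
by rewrite (bigD1 i) //= lerDl; apply: sumr_ge0 => j _; exact: wsum_ge0.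
Qed.

Lemma wsum_sum (J : finType) m (F : J -> seq T -> R) :
  wsum m (fun v => \sum_j F j v) = \sum_j wsum m (F j).
Proof.
by elim: m F => [|m IH] F //=; under eq_bigr do rewrite IH; rewrite exchange_big.
Qed.

Lemma exchange_wsum m n (F : seq T -> seq T -> R) :
  wsum m (fun u => wsum n (F u)) = wsum n (fun v => wsum m (F^~ v)).
Proof.
elim: m F => [|m IH] F //=; under eq_bigr do rewrite IH.
by rewrite -wsum_sum.
Qed.

Lemma wsum_tuple n F : \sum_(t : n.-tuple T) F t = wsum n F.
Proof.
elim: n F => [|n IH] F /=.
  by rewrite (bigD1 [tuple]) //= big1 ?addr0 // => t; rewrite tuple0.
rewrite (reindex (fun it : T * n.-tuple T => [tuple of it.1 :: it.2])) /=; last first.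
  exists (fun t : n.+1.-tuple T => (thead t, [tuple of behead t])) => [[i t] _|t _].
    by congr pair; apply: val_inj.
  by apply: val_inj; rewrite [t in RHS]tuple_eta.
rewrite -(pair_bigA _ (fun i (t : n.-tuple T) => F (i :: t))) /=; apply: eq_bigr => i _.
exact: (IH (fun w => F (i :: w))).
Qed.

Lemma wsum_rev n F : wsum n (fun w => F (rev w)) = wsum n F.
Proof.
elim: n F => [|n IH] F //=.
transitivity (wsum n (fun u => wsum 1 (fun v => F (u ++ v)))).
  rewrite /= (exchange_wsum n 1 (fun u v => F (u ++ v))) /=; apply: eq_bigr => i _.
  by rewrite -(IH (fun w => F (w ++ [:: i]))); apply: eq_wsum => w _; rewrite rev_cons cats1.
by rewrite -wsumD addn1.
Qed.

End WordSums.

Section Potentials.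
Context {R : realType} {N : nat} (N2 : (2 <= N)%N).
Local Notation letter := 'I_N.
Implicit Types (u v w : seq letter).

(** [potential_low] keeps pressure and growth rates finite. The uniform length bound in
    [potential_connect] is what later turns mixing into a sum over finitely many gap lengths. *)
Record quasi_multiplicative (phi : seq letter -> R) : Prop := QuasiMultiplicative {
  potential_gt0 : forall w, 0 < phi w;
  potential_low : exists2 k, 0 < k & forall w, k ^+ size w <= phi w;
  potential_cat : forall u v, phi (u ++ v) <= phi u * phi v;
  potential_connect : exists L c, 0 < c /\ forall u v, exists2 w,
    (size w <= L)%N & c * (phi u * phi v) <= phi (u ++ w ++ v) }.

Lemma quasi_multiplicative_rev phi : quasi_multiplicative phi ->
  quasi_multiplicative (phi \o rev).
Proof.
move=> [p0 [k k0 pk] pc [L [c [c0 pq]]]]; split=> /=.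
- by move=> w.
- by exists k => // w; rewrite -(size_rev w).
- by move=> u v; rewrite rev_cat mulrC.
- exists L, c; split=> // u v; have [w wL h] := pq (rev v) (rev u).
  exists (rev w); first by rewrite size_rev.
  by rewrite !rev_cat revK -catA [phi (rev u) * _]mulrC.
Qed.

Variable phi : seq letter -> R.
Hypothesis phi_qm : quasi_multiplicative phi.
Let phi_gt0 := potential_gt0 phi_qm.
Let phi_ge0 w : 0 <= phi w. Proof. exact/ltW/phi_gt0. Qed.

Definition partition_fun n := wsum n phi.
Local Notation Z := partition_fun.

Lemma partition_fun_gt0 n : 0 < Z n.
Proof.
apply: (lt_le_trans (phi_gt0 (nseq n (Ordinal (ltnW N2))))).
by apply: wsum_term => //; rewrite size_nseq.
Qed.

Lemma partition_funD m n : Z (m + n) <= Z m * Z n.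
Proof.
rewrite /Z wsumD -wsum_scaler; apply: ler_wsum => u _.
by rewrite -wsum_scale; apply: ler_wsum => v _; exact: potential_cat.
Qed.

(** Connecting [x] to [v] inserts a word of some length [j <= L]. Regroup the letters after [x] as
    [n] letters followed by [j]: the last ones contribute at most [Z j], and [s] sums over the
    possible [j]. *)
Lemma extend_right : exists2 c, 0 < c & forall x n,
  c * phi x * Z n <= wsum n (fun v => phi (x ++ v)).
Proof.
have [L [c [c0 pq]]] := potential_connect phi_qm.
pose s := \sum_(j < L.+1) Z j.
have s0 : 0 < s.
  rewrite /s big_ord_recl /= ltr_pwDl ?partition_fun_gt0 //.
  by apply: sumr_ge0 => j _; exact/ltW/partition_fun_gt0.
exists (c / s) => [|x n]; first by rewrite divr_gt0.
have -> : c / s * phi x * Z n = c * (phi x * Z n) / s by ring.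
rewrite ler_pdivrMr // [leRHS]mulrC.
apply: (@le_trans _ _ (\sum_(j < L.+1) wsum (n + j) (fun t => phi (x ++ t)))).
  apply: (@le_trans _ _ (wsum n (fun v => \sum_(j < L.+1) wsum j (fun a => phi (x ++ a ++ v))))).
    rewrite -!wsum_scale; apply: ler_wsum => v _.
    have [w wL h] := pq x v; apply: le_trans h _.
    have wL' : (size w < L.+1)%N by [].
    rewrite (bigD1 (Ordinal wL')) //=.
    apply: (@le_trans _ _ (wsum (size w) (fun a => phi (x ++ a ++ v)))).
      by apply: (@wsum_term _ _ _ (fun a => phi (x ++ a ++ v))).
    by rewrite lerDl; apply: sumr_ge0 => j _; apply: wsum_ge0.
  rewrite wsum_sum; apply: ler_sum => j _.
  rewrite (exchange_wsum n j (fun v a => phi (x ++ a ++ v))) addnC.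
  by rewrite (wsumD j n (fun t => phi (x ++ t))).
rewrite mulr_suml; apply: ler_sum => j _; rewrite wsumD mulrC -wsum_scaler.
apply: ler_wsum => v _; rewrite -wsum_scale; apply: ler_wsum => b _.
by rewrite catA; exact: potential_cat.
Qed.

End Potentials.

Section Pressure.
Context {R : realType} {N : nat} (N2 : (2 <= N)%N).
Local Notation letter := 'I_N.
Implicit Types (u v w : seq letter).
Variable phi : seq letter -> R.
Hypothesis phi_qm : quasi_multiplicative phi.
Local Notation Z := (partition_fun phi).

Lemma extend_left : exists2 c, 0 < c & forall x n,
  c * phi x * Z n <= wsum n (fun v => phi (v ++ x)).
Proof.
have [c c0 h] := extend_right N2 (quasi_multiplicative_rev phi_qm).
exists c => // x n; have := h (rev x) n.
rewrite /= revK /partition_fun (wsum_rev n phi) => h1; apply: le_trans h1 _.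
rewrite -[leRHS]wsum_rev le_eqVlt; apply/orP; left; apply/eqP; apply: eq_wsum => w _.
by rewrite rev_cat revK.
Qed.

Definition pressure : R := limn (fun n => ln (Z n) / n%:R).

(** [Z] is submultiplicative, and supermultiplicative up to [c] by [extend_right]. Fekete's lemma
    applied to ln Z and to -(ln Z + ln c) gives limits of opposite sign, and the infimum property
    gives the two bounds. *)
Lemma pressure_bounds : exists2 c, 0 < c &
  forall n, expR (n%:R * pressure) <= Z n /\ c * Z n <= expR (n%:R * pressure).
Proof.
have [c c0 hc] := extend_right N2 phi_qm.
have Z0 n : 0 < Z n by exact: partition_fun_gt0.
have Zlow m n : c * (Z m * Z n) <= Z (m + n)%N.
  have -> : c * (Z m * Z n) = wsum m (fun u => c * phi u * Z n).
    by rewrite wsum_scaler wsum_scale mulrA.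
  rewrite {2}/partition_fun wsumD; apply: ler_wsum => u _.
  exact: hc.
have [k k0 pk] := potential_low phi_qm.
have Zk n : k ^+ n <= Z n.
  apply: le_trans (_ : phi (nseq n (Ordinal (ltnW N2))) <= _).
    by have := pk (nseq n (Ordinal (ltnW N2))); rewrite size_nseq.
  by apply: wsum_term => [w|]; [exact/ltW/(potential_gt0 phi_qm) | rewrite size_nseq].
have lnD m n : ln (Z (m + n)%N) <= ln (Z m) + ln (Z n).
  by rewrite -lnM ?posrE // ler_ln ?posrE ?mulr_gt0 // partition_funD.
have [|cv le1] := @subadditive_limit R (fun n => ln (Z n)) (- ln k) lnD.
  by move=> n; rewrite opprK mulr_natr -lnXn // ler_ln ?posrE ?exprn_gt0.
(* The linear lower bound in Fekete's lemma is also required at n = 0, where it asks for a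
   nonnegative value. *)
have Z0c : 0 <= - (ln (Z 0) + ln c).
  rewrite -lnM ?posrE // oppr_ge0 ln_le0 //.
  by have := Zlow 0%N 0%N; rewrite addn0 mulrA [c * _]mulrC -[leRHS]mul1r ler_pM2r.
have lnZ1 n : ln (Z n.+1) <= n.+1%:R * ln (Z 1%N).
  elim: n => [|n IH]; first by rewrite mul1r.
  by rewrite -addn1; apply: le_trans (lnD _ _) _; rewrite natrD mulrDl mul1r lerD2r.
have [||cv' le2] := @subadditive_limit R (fun n => - (ln (Z n) + ln c)) (`|ln (Z 1%N)| + `|ln c|).
- move=> m n; rewrite -opprD lerN2.
  have : ln (c * (Z m * Z n)) <= ln (Z (m + n)%N) by rewrite ler_ln ?posrE ?mulr_gt0.
  by rewrite !lnM ?posrE ?mulr_gt0 //; lra.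
- case=> [|n]; first by rewrite mulr0.
  have n1 : 1 <= n.+1%:R :> R by rewrite ler1n.
  have h1 := lnZ1 n; have h2 := ler_norm (ln (Z 1%N)); have h3 := ler_norm (ln c).
  have h4 : 0 <= `|ln c| by []. 
  rewrite mulNr lerN2 mulrDl lerD //.
    by apply: le_trans h1 _; rewrite mulrC ler_wpM2r.
  by apply: le_trans h3 _; rewrite ler_peMr.
have limE : limn (fun n => - (ln (Z n) + ln c) / n%:R) = - pressure.
  apply/cvg_lim => //.
  have h : (fun n => - (ln (Z n) / n%:R) - ln c / n%:R) @ \oo --> - pressure - 0.
    by apply: cvgB; [apply: cvgN | exact: cvg_div_nat].
  rewrite subr0 in h; apply: cvg_trans h; apply: near_eq_cvg; near=> n.
  by rewrite opprD mulrDl !mulNr.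
rewrite limE in le2.
exists c => // n; have [->|n0] := posnP n.
  rewrite mul0r expR0; split; last first.
    by rewrite -ler_ln ?posrE ?mulr_gt0 // lnM ?posrE // ln1; lra.
  have := partition_funD phi_qm 0 0; rewrite addn0 -{1}[Z 0]mulr1 ler_pM2l //.
have nR : 0 < n%:R :> R by rewrite ltr0n.
split.
  rewrite -[leRHS]lnK ?posrE // ler_expR mulrC -ler_pdivlMr //; exact: le1.
rewrite -[leLHS]lnK ?posrE ?mulr_gt0 // ler_expR lnM ?posrE //.
have := le2 n n0; rewrite ler_pdivlMr //; lra.
Unshelve. all: by end_near. Qed.

End Pressure.

Section UltrafilterLimits.
Context {R : realType} (U : set_system nat).
Hypothesis U_ultra : UltraFilter U.

Lemma ultra_fmap (f : nat -> R) : UltraFilter (f n @[n --> U]).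
Proof.
have UP : ProperFilter U by exact: ultra_proper.
split; first exact: fmap_proper_filter.
move=> G GP FG; apply/seteqP; split=> A; last exact: FG.
move=> GA; have [//|UC] := in_ultra_setVsetC (f @^-1` A) U_ultra.
have GC : G (~` A) by exact: FG.
by exfalso; apply: (@filter_not_empty _ G GP); rewrite -(setICr A); exact: filterI.
Qed.

(** One ultrafilter gives limits for the frequencies of all words at once, in place of a diagonal
    subsequence. *)
Lemma ultra_bounded_cvg (f : nat -> R) M :
  (\forall n \near U, 0 <= f n <= M) -> cvg (f n @[n --> U]).
Proof.
move=> fM; have := @segment_compact R 0 M; rewrite compact_ultra.
move=> /(_ (f n @[n --> U]) (ultra_fmap f)) [|l [_ fl]]; last by apply/cvg_ex; exists l.
by apply: filterS fM => n; rewrite /= in_itv.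
Qed.

End UltrafilterLimits.

(** * Construction of an invariant Gibbs measure *)

Section GibbsMeasure.
Context {R : realType} {N : nat} {N2 : (2 <= N)%N}.
Local Notation letter := 'I_N.
Local Notation S := (borel_Sigma N2).
Local Notation cyl := (@cylinder N N2).
Implicit Types (u v w : seq letter).
Variable phi : seq letter -> R.
Hypothesis phi_qm : quasi_multiplicative phi.
Local Notation Z := (partition_fun phi).
Local Notation P := (pressure phi).

Definition gibbs_weight w : R := phi w * expR (- ((size w)%:R * P)).

(** The probability that [w] stands at position [k] in a random word of length 2n with weights
    [phi]. The doubled length leaves room for [w] whenever k <= n and size w <= n. *)
Let occ n k w : R :=
  wsum k (fun u => wsum (n.*2 - k - size w) (fun v => phi (u ++ w ++ v))) / Z n.*2.

Let Z_gt0 n : 0 < Z n. Proof. exact: partition_fun_gt0. Qed.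
Let phi_gt0 := potential_gt0 phi_qm.
Let phi_ge0 w : 0 <= phi w. Proof. exact/ltW/phi_gt0. Qed.

Let occ_ge0 n k w : 0 <= occ n k w.
Proof. by rewrite divr_ge0 ?(ltW (Z_gt0 _)) //; do 2!apply: wsum_ge0 => ?. Qed.

Let occ_nil n k : (k <= n)%N -> occ n k [::] = 1.
Proof.
move=> kn; have kn2 : (k <= n.*2)%N by lia.
by rewrite /occ /= subn0 -(wsumD k (n.*2 - k) phi) subnKC // divff // (gt_eqF (Z_gt0 _)).
Qed.

Let occ_rcons n k w : (k <= n)%N -> (size w < n)%N ->
  \sum_i occ n k (rcons w i) = occ n k w.
Proof.
move=> kn wn; rewrite /occ -mulr_suml; congr (_ / _).
rewrite -wsum_sum; apply: eq_wsum => u _.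
have -> : (n.*2 - k - size w = (n.*2 - k - (size w).+1).+1)%N by lia.
by apply: eq_bigr => i _; rewrite size_rcons; apply: eq_wsum => v _; rewrite cat_rcons.
Qed.

Let occ_cons n k w : (k < n)%N -> (size w < n)%N ->
  \sum_i occ n k (i :: w) = occ n k.+1 w.
Proof.
move=> kn wn; rewrite /occ -mulr_suml; congr (_ / _).
rewrite -addn1 wsumD -wsum_sum; apply: eq_wsum => u _ /=; apply: eq_bigr => i _.
have -> : (n.*2 - k - (size w).+1 = n.*2 - (k + 1) - size w)%N by lia.
by apply: eq_wsum => v _; rewrite -catA.
Qed.

Let occ_bounds : exists c C, 0 < c /\ forall n k w, (k <= n)%N -> (size w <= n)%N ->
  c * gibbs_weight w <= occ n k w <= C * gibbs_weight w.
Proof.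
have [c0 c00 hZ] := pressure_bounds N2 phi_qm.
have [c1 c10 h1] := extend_right N2 phi_qm; have [c2 c20 h2] := extend_left N2 phi_qm.
(* Lower bound: [c1] and [c2] extend [w] on its two sides and [c0] bounds the normalisation
   [Z n.*2]. Upper bound: one factor [c0] for each of the two flanking partition sums. *)
exists (c0 * c1 * c2), (c0 ^- 2); split; first by rewrite !mulr_gt0.
move=> n k w kn wn; set l := (n.*2 - k - size w)%N.
have nE : (n.*2 = k + size w + l)%N by rewrite /l; lia.
pose e m := expR (m%:R * P); have e0 m : 0 < e m by exact: expR_gt0.
have eE : e n.*2 = e k * e (size w) * e l by rewrite /e nE !natrD !mulrDl !expRD.
have wE : gibbs_weight w = phi w / e (size w) by rewrite /gibbs_weight expRN.
have zk1 : e k <= Z k := (hZ k).1; have zl1 : e l <= Z l := (hZ l).1.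
have zn1 : e n.*2 <= Z n.*2 := (hZ n.*2).1.
have zk2 : c0 * Z k <= e k := (hZ k).2; have zl2 : c0 * Z l <= e l := (hZ l).2.
have zn2 : c0 * Z n.*2 <= e n.*2 := (hZ n.*2).2.
have es0 : e (size w) != 0 by rewrite gt_eqF.
have e0' m : 0 <= e m by exact: ltW.
rewrite /occ -/l; apply/andP; split.
  rewrite ler_pdivlMr //.
  apply: (@le_trans _ _ (c1 * c2 * phi w * (Z k * Z l))).
    have a0 : 0 <= c1 * c2 * phi w by rewrite !mulr_ge0 // ltW.
    have -> : c0 * c1 * c2 * gibbs_weight w * Z n.*2 =
        c1 * c2 * phi w / e (size w) * (c0 * Z n.*2) by rewrite wE; ring.
    apply: (@le_trans _ _ (c1 * c2 * phi w / e (size w) * e n.*2)).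
      by rewrite ler_wpM2l // divr_ge0.
    have -> : c1 * c2 * phi w / e (size w) * e n.*2 = c1 * c2 * phi w * (e k * e l).
      by rewrite eE; field.
    by rewrite ler_wpM2l // ler_pM.
  apply: (@le_trans _ _ (wsum k (fun u => c1 * phi (u ++ w) * Z l))).
    rewrite wsum_scaler wsum_scale !mulrA ler_wpM2r ?(ltW (Z_gt0 _)) //.
    by rewrite -!mulrA ler_wpM2l ?(ltW c10) // mulrA h2.
  by apply: ler_wsum => u _; have := h1 (u ++ w) l; under eq_wsum do rewrite -catA.
rewrite ler_pdivrMr //.
apply: (@le_trans _ _ (phi w * (Z k * Z l))).
  have -> : phi w * (Z k * Z l) = wsum k (fun u => wsum l (fun v => phi u * (phi w * phi v))).
    by under eq_wsum => u _ do rewrite wsum_scale wsum_scale; rewrite wsum_scaler mulrCA.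
  apply: ler_wsum => u _; apply: ler_wsum => v _.
  apply: le_trans (potential_cat phi_qm _ _) _; rewrite ler_wpM2l //.
  exact: potential_cat.
have -> : c0 ^- 2 * gibbs_weight w * Z n.*2 = phi w / e (size w) * Z n.*2 / c0 ^+ 2.
  by rewrite wE; ring.
rewrite ler_pdivlMr ?exprn_gt0 //.
have -> : phi w * (Z k * Z l) * c0 ^+ 2 = phi w * ((c0 * Z k) * (c0 * Z l)) by ring.
apply: (@le_trans _ _ (phi w * (e k * e l))).
  by rewrite ler_wpM2l // ler_pM // mulr_ge0 ?(ltW c00) ?(ltW (Z_gt0 _)).
have -> : phi w * (e k * e l) = phi w / e (size w) * e n.*2 by rewrite eE; field.
by rewrite ler_wpM2l // divr_ge0.
Qed.

(** Averaging over positions as in Krylov-Bogolyubov, so that the limit is shift invariant. *)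
Let avg n w : R := (\sum_(k < n) occ n k w) / n%:R.

Lemma gibbs_measure_exists : exists mu : probability S R, shift_invariant mu /\
  exists c C, 0 < c /\ forall w, c * gibbs_weight w <= prb mu (cyl w) <= C * gibbs_weight w.
Proof.
have [c [C [c0 hb]]] := occ_bounds.
have [U [Uu sU]] := @ultraFilterLemma _ (\oo : set_system nat) _.
have UP : ProperFilter U by exact: ultra_proper.
have w0 w : 0 <= gibbs_weight w by rewrite mulr_ge0 // expR_ge0.
have avg_bounds w : \forall n \near U, c * gibbs_weight w <= avg n w <= C * gibbs_weight w.
  apply: sU; near=> n.
  have n0 : (0 < n)%N by near: n; exists 1%N.
  have nR : 0 < n%:R :> R by rewrite ltr0n.
  have wn : (size w <= n)%N by near: n; exists (size w).
  rewrite ler_pdivlMr // ler_pdivrMr //; apply/andP; split.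
    rewrite mulr_natr -[n in _ *+ n]card_ord -sumr_const; apply: ler_sum => k _.
    by have /andP [] := hb n k w (ltnW (ltn_ord k)) wn.
  rewrite mulr_natr -[n in _ *+ n]card_ord -sumr_const; apply: ler_sum => k _.
  by have /andP [] := hb n k w (ltnW (ltn_ord k)) wn.
pose p w : R := lim (avg n w @[n --> U]).
have pc w : avg n w @[n --> U] --> p w.
  apply: (@ultra_bounded_cvg _ _ Uu (fun n => avg n w) (C * gibbs_weight w)).
  apply: filterS (avg_bounds w) => n /andP [h1 h2]; rewrite h2 andbT.
  by apply: le_trans h1; rewrite mulr_ge0 // ltW.
have pcv w : cvg (avg n w @[n --> U]) by apply/cvg_ex; exists (p w).
have pb w : c * gibbs_weight w <= p w <= C * gibbs_weight w.
  apply/andP; split.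
    by apply: limr_ge => //; apply: filterS (avg_bounds w) => n /andP [].
  by apply: limr_le => //; apply: filterS (avg_bounds w) => n /andP [].
have pS (f : letter -> seq letter) : \sum_i avg n (f i) @[n --> U] --> \sum_i p (f i).
  by apply: cvg_big => [|i _]; [exact: add_continuous | exact: pc].
have lim_eq (f g : nat -> R) (a b : R) : (\forall n \near \oo, f n = g n) ->
    f n @[n --> U] --> a -> g n @[n --> U] --> b -> a = b.
  move=> fg fa gb; refine (@cvg_unique R (@Rhausdorff R) (f @ U) _ a b fa _).
  apply: cvg_trans gb; apply: near_eq_cvg; apply: sU.
  by apply: filterS fg => n /= ->.
have p1 : p [::] = 1.
  apply: (lim_eq _ (fun=> 1) _ _ _ (pc [::])); last exact: cvg_cst.
  exists 1%N => // n /= n0.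
  rewrite /avg (eq_bigr (fun=> 1)) ?sumr_const ?card_ord ?divff ?pnatr_eq0 -?lt0n //.
  by move=> k _; rewrite occ_nil // ltnW.
have p_rcons w : \sum_i p (rcons w i) = p w.
  apply: (lim_eq _ _ _ _ _ (pS (rcons w)) (pc w)).
  exists (size w).+1 => // n /= wn.
  rewrite /avg -mulr_suml exchange_big; congr (_ / _); apply: eq_bigr => k _.
  by rewrite occ_rcons // ltnW.
have p_cons w : \sum_i p (i :: w) = p w.
  (* Prepending a letter moves the window from positions 0, ..., n-1 to 1, ..., n; only this
     boundary term changes, and it vanishes in the limit. *)
  have d0 : (occ n n w - occ n 0 w) / n%:R @[n --> \oo] --> (0 : R).
    have h (a : R) : a / n%:R @[n --> \oo] --> (0 : R) by exact: cvg_div_nat.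
    apply: (@squeeze_cvgr _ _ _ _ 
      (fun n : nat => (- (C * gibbs_weight w)) / n%:R)
      (fun n : nat => (C * gibbs_weight w) / n%:R)) => //.
    exists (size w) => // n /= wn.
    have /andP [_ h1] := hb n n w (leqnn n) wn.
    have /andP [_ h2] := hb n 0%N w (leq0n n) wn.
    have h3 := occ_ge0 n n w; have h4 := occ_ge0 n 0 w.
    by apply/andP; split; rewrite ler_wpM2r ?invr_ge0 ?ler0n //; lra.
  have h : avg n w + (occ n n w - occ n 0 w) / n%:R @[n --> U] --> p w + 0.
    by apply: cvgD => //; apply: cvg_trans d0; exact: cvg_app.
  rewrite addr0 in h; apply: (lim_eq _ _ _ _ _ (pS (cons^~ w)) h).
  exists (size w).+1 => // n /= wn.
  rewrite /avg -mulr_suml exchange_big -mulrDl; congr (_ / _).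
  rewrite /= (eq_bigr (fun k : 'I_n => occ n k.+1 w)); last by move=> k _; rewrite occ_cons.
  have e : occ n 0 w + \sum_(k < n) occ n k.+1 w = \sum_(k < n) occ n k w + occ n n w.
    transitivity (\sum_(k < n.+1) occ n k w); first by rewrite big_ord_recl.
    by rewrite big_ord_recr.
  by rewrite addrA -e addrAC subrr add0r.
have p0 w : 0 <= p w.
  by have /andP [+ _] := pb w; apply: le_trans; rewrite mulr_ge0 // ltW.
have [mu muE] := cylinder_measure_exists (N2 := N2) p0 p1 p_rcons.
exists mu; split.
  apply: shift_invariant_cyl => w; rewrite muE -p_cons.
  by apply: eq_bigr => i _; rewrite muE.
by exists c, C; split=> // w; rewrite muE.
Unshelve. all: by end_near.
Qed.

End GibbsMeasure.

(** * The variational principle *)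

Section WordMarginals.
Context {R : realType} {N : nat} {N2 : (2 <= N)%N}.
Local Notation letter := 'I_N.
Local Notation S := (borel_Sigma N2).
Local Notation cyl := (@cylinder N N2).
Implicit Types (u v w : seq letter) (mu : probability S R).

Lemma cyl_cons i w : cyl (i :: w) = [set x : S | x 0%N = i] `&` fullshift N2 @^-1` cyl w.
Proof.
apply/seteqP; split=> x; rewrite /cylinder /= /mkseq /=.
  by case=> -> <-; split=> //; rewrite size_map size_iota -[1%N]addn0 iotaDl -map_comp.
by move=> [-> <-]; rewrite size_map size_iota -[1%N]addn0 iotaDl -map_comp.
Qed.

Lemma prb_coord_sum mu (k : nat) (B : set S) : measurable B ->
  \sum_i prb mu (B `&` [set x : S | x k = i]) = prb mu B.
Proof.
move=> mB; rewrite -(@prb_bigU _ _ _ mu _ _ xpredT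
  (fun i => B `&` [set x : S | x k = i]) (index_enum_uniq _)) //.
- congr prb; rewrite -bigcup_seq; apply/seteqP; split=> [x [i _ [//]]|x Bx].
  by exists (x k) => //=; rewrite mem_index_enum.
- move=> i; apply: measurableI => //; apply: sub_sigma_algebra; exact: coord_open.
- by move=> i j x [_ <-] [_ <-].
Qed.

Lemma prb_cyl_rcons mu w : \sum_i prb mu (cyl (rcons w i)) = prb mu (cyl w).
Proof.
rewrite -(prb_coord_sum mu (size w) (cyl_measurable w)).
by apply: eq_bigr => i _; rewrite cyl_rcons.
Qed.

Lemma prb_cyl_cons mu w : shift_invariant mu ->
  \sum_i prb mu (cyl (i :: w)) = prb mu (cyl w).
Proof.
move=> inv; have mB : measurable (fullshift N2 @^-1` cyl w).
  by rewrite -[X in measurable X]setTI; apply: shift_measurable => //; exact: cyl_measurable.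
rewrite -(shift_invariant_prb inv (cyl_measurable w)) -(prb_coord_sum mu 0 mB).
apply: eq_bigr => i _; by rewrite cyl_cons setIC.
Qed.

Lemma wsum_cyl_right mu u n : wsum n (fun v => prb mu (cyl (u ++ v))) = prb mu (cyl u).
Proof.
elim: n u => [|n IH] u /=; first by rewrite cats0.
by under eq_bigr do under eq_wsum do rewrite -cat_rcons; under eq_bigr do rewrite IH;
  rewrite prb_cyl_rcons.
Qed.

Lemma wsum_cyl_left mu v n : shift_invariant mu ->
  wsum n (fun u => prb mu (cyl (u ++ v))) = prb mu (cyl v).
Proof.
move=> inv; elim: n => [//|n IH] /=.
by rewrite -wsum_sum -[RHS]IH; apply: eq_wsum => u _; rewrite prb_cyl_cons.
Qed.

Definition mean_log (psi : seq letter -> R) mu n : R :=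
  wsum n (fun w => prb mu (cyl w) * ln (psi w)).

Definition word_growth psi mu : R := limn (fun n => mean_log psi mu n / n%:R).

Lemma wsum_cyl mu n : wsum n (fun w => prb mu (cyl w)) = 1.
Proof. by rewrite (wsum_cyl_right mu [::]) cyl_nil prbT. Qed.

Lemma le_mean_log psi chi c mu n : (forall w, size w = n -> ln (psi w) <= c + ln (chi w)) ->
  mean_log psi mu n <= c + mean_log chi mu n.
Proof.
move=> h; rewrite -[c]mulr1 -(wsum_cyl mu n) -wsum_scale -wsum_add.
apply: ler_wsum => w wn; rewrite [c * _]mulrC -mulrDr ler_wpM2l ?prb_ge0 //; exact: h.
Qed.

(** Fekete's lemma for the mean logarithm; invariance of [mu] identifies the marginal of the second
    block with that of a prefix. *)
Lemma submultiplicative_growth psi mu (k : R) : (forall w, 0 < psi w) ->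
  0 < k -> (forall w, k ^+ size w <= psi w) ->
  (forall u v, psi (u ++ v) <= psi u * psi v) -> shift_invariant mu ->
  cvgn (fun n => mean_log psi mu n / n%:R) /\
  forall n, (0 < n)%N -> word_growth psi mu <= mean_log psi mu n / n%:R.
Proof.
move=> p0 k0 pk pc inv.
apply: (@subadditive_limit _ _ (- ln k)) => [m n|n].
  rewrite /mean_log wsumD.
  apply: (@le_trans _ _ (wsum m (fun u => wsum n (fun v =>
      prb mu (cyl (u ++ v)) * ln (psi u) + prb mu (cyl (u ++ v)) * ln (psi v))))).
    apply: ler_wsum => u _; apply: ler_wsum => v _.
    rewrite -mulrDr ler_wpM2l ?prb_ge0 // -lnM ?posrE // ler_ln ?posrE ?mulr_gt0 //.
  under eq_wsum do rewrite wsum_add wsum_scaler wsum_cyl_right.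
  rewrite wsum_add lerD2l exchange_wsum; under eq_wsum do rewrite wsum_scaler wsum_cyl_left //.
  exact: lexx.
rewrite opprK.
have := @le_mean_log (fun w => k ^+ size w) psi 0 mu n _; rewrite add0r => h.
apply: le_trans (h _); last first.
  by move=> w _; rewrite add0r ler_ln ?posrE ?exprn_gt0.
rewrite /mean_log (eq_wsum (G := fun w => prb mu (cyl w) * (ln k * n%:R))); last first.
  by move=> w ->; rewrite lnXn // mulr_natr.
by rewrite wsum_scaler wsum_cyl mul1r.
Qed.

Lemma word_growth_cvg psi mu : quasi_multiplicative psi -> shift_invariant mu ->
  cvgn (fun n => mean_log psi mu n / n%:R) /\
  forall n, (0 < n)%N -> word_growth psi mu <= mean_log psi mu n / n%:R.
Proof. by move=> [p0 [k k0 pk] pc _]; exact: submultiplicative_growth pk pc. Qed.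

Lemma le_word_growth psi chi c mu : 0 < c -> (forall w, 0 < psi w) -> (forall w, 0 < chi w) ->
  (forall w, psi w <= c * chi w) ->
  cvgn (fun n => mean_log psi mu n / n%:R) -> cvgn (fun n => mean_log chi mu n / n%:R) ->
  word_growth psi mu <= word_growth chi mu.
Proof.
move=> c0 p0 q0 h cp cq.
have L : ln c / n%:R + mean_log chi mu n / n%:R @[n --> \oo] --> 0 + word_growth chi mu.
  by apply: cvgD => //; exact: cvg_div_nat.
rewrite add0r in L; apply: ler_cvg_to cp L _; exists 1%N => // n /= n0.
rewrite -mulrDl ler_wpM2r ?invr_ge0 //; apply: le_mean_log => w _.
by rewrite -lnM ?posrE // ler_ln ?posrE // mulr_gt0.
Qed.

Lemma comparable_growth psi chi c mu : 0 < c -> (forall w, 0 < psi w) -> (forall w, 0 < chi w) ->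
  (forall w, psi w <= c * chi w) -> (forall w, chi w <= c * psi w) ->
  cvgn (fun n => mean_log chi mu n / n%:R) ->
  cvgn (fun n => mean_log psi mu n / n%:R) /\ word_growth psi mu = word_growth chi mu.
Proof.
move=> c0 p0 q0 h1 h2 cq.
suff L : mean_log psi mu n / n%:R @[n --> \oo] --> word_growth chi mu.
  by split; [apply/cvg_ex; exists (word_growth chi mu) | exact/cvg_lim].
apply: (@squeeze_cvgr _ _ _ _ (fun n => mean_log chi mu n / n%:R - ln c / n%:R)
   (fun n => mean_log chi mu n / n%:R + ln c / n%:R)).
- exists 1%N => // n /= n0; rewrite -mulrBl -mulrDl; apply/andP; split;
    rewrite ler_wpM2r ?invr_ge0 //.
    rewrite lerBlDl; apply: le_mean_log => w _.
    by rewrite -lnM ?posrE // ler_ln ?posrE // mulr_gt0.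
  rewrite addrC; apply: le_mean_log => w _.
  by rewrite -lnM ?posrE // ler_ln ?posrE // mulr_gt0.
- by rewrite -[X in _ --> X]subr0; apply: cvgB => //; exact: cvg_div_nat.
- by rewrite -[X in _ --> X]addr0; apply: cvgD => //; exact: cvg_div_nat.
Qed.

Lemma mean_log_powR psi chi (p q : R) mu n : (forall w, 0 < psi w) -> (forall w, 0 < chi w) ->
  mean_log (fun w => psi w `^ p * chi w `^ q) mu n = p * mean_log psi mu n + q * mean_log chi mu n.
Proof.
move=> p0 q0; rewrite /mean_log -!wsum_scale -wsum_add; apply: eq_wsum => w _.
by rewrite lnM ?posrE ?powR_gt0 // !ln_powR; ring.
Qed.

Lemma word_growth_powR psi chi (p q : R) mu : (forall w, 0 < psi w) -> (forall w, 0 < chi w) ->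
  cvgn (fun n => mean_log psi mu n / n%:R) -> cvgn (fun n => mean_log chi mu n / n%:R) ->
  cvgn (fun n => mean_log (fun w => psi w `^ p * chi w `^ q) mu n / n%:R) /\
  word_growth (fun w => psi w `^ p * chi w `^ q) mu =
    p * word_growth psi mu + q * word_growth chi mu.
Proof.
move=> p0 q0 cp cq.
suff L : mean_log (fun w => psi w `^ p * chi w `^ q) mu n / n%:R @[n --> \oo] -->
    p * word_growth psi mu + q * word_growth chi mu.
  split; last exact/cvg_lim.
  by apply/cvg_ex; exists (p * word_growth psi mu + q * word_growth chi mu).
under eq_fun do rewrite mean_log_powR // mulrDl -!mulrA.
by apply: cvgD; apply: cvgMr.
Qed.

Lemma growth_rate_words d (F : 'M[R]_d -> R) (A : letter -> 'M[R]_d) mu :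
  growth_rate F A mu = word_growth (fun w => F (mxword A w)) mu.
Proof.
rewrite /growth_rate /word_growth; congr (limn _); apply/funext => n.
by rewrite (integral_words mu n (fun w => ln (F (mxword A w)))) mulrC /mean_log -wsum_tuple.
Qed.

End WordMarginals.

Section VariationalPrinciple.
Context {R : realType} {N : nat} {N2 : (2 <= N)%N}.
Local Notation letter := 'I_N.
Local Notation S := (borel_Sigma N2).
Local Notation cyl := (@cylinder N N2).
Implicit Types (u v w : seq letter) (mu nu : probability S R).
Variable phi : seq letter -> R.
Hypothesis phi_qm : quasi_multiplicative phi.
Local Notation Z := (partition_fun phi).
Local Notation P := (pressure phi).
Let phi_gt0 := potential_gt0 phi_qm.

Definition shift_entropy mu : R := entropy_rate mu (fullshift N2) (@coord N N2).

Definition word_entropy mu n : R := - wsum n (fun w => prb mu (cyl w) * ln (prb mu (cyl w))).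

Definition gibbs mu := exists c C, 0 < c /\
  forall w, c * gibbs_weight phi w <= prb mu (cyl w) <= C * gibbs_weight phi w.

Lemma shift_entropy_cvg mu : shift_invariant mu ->
  cvgn (fun n => word_entropy mu n / n%:R) /\
  limn (fun n => word_entropy mu n / n%:R) = shift_entropy mu /\
  forall n, (0 < n)%N -> shift_entropy mu <= word_entropy mu n / n%:R.
Proof.
move=> inv.
have e n : word_entropy mu n = entropy mu (itinerary (fullshift N2) (@coord N N2) n).
  by rewrite entropy_words /word_entropy -wsum_tuple.
have -> : (fun n => word_entropy mu n / n%:R) =
  (fun n => entropy mu (itinerary (fullshift N2) (@coord N N2) n) / n%:R).
  by apply/funext => n; rewrite e.
have [c h] := entropy_rate_cvg (@shift_measurable N N2) inv (@coord_fmeas N N2).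
by split=> //; split=> // n n0; rewrite e; exact: h.
Qed.

Let le_div_nat (a b : R) : (forall n : nat, (0 < n)%N -> n%:R * a <= b) -> a <= 0.
Proof.
move=> h; rewrite leNgt; apply/negP => a0.
have b0 : 0 <= `|b| / a by rewrite divr_ge0 // ltW.
have := archi_boundP b0; set n := Num.Def.archi_bound _ => hn.
have n0 : (0 < n)%N by rewrite -(ltr_nat R); exact: le_lt_trans hn.
have := h n n0; rewrite leNgt => /negP; apply.
by rewrite ltr_pdivrMr // in hn; exact: le_lt_trans (ler_norm b) hn.
Qed.

Lemma gibbs_weight_gt0 w : 0 < gibbs_weight phi w.
Proof. by rewrite mulr_gt0 // expR_gt0. Qed.

Lemma ln_gibbs_weight w : ln (gibbs_weight phi w) = ln (phi w) - (size w)%:R * P.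
Proof. by rewrite lnM ?posrE // ?expR_gt0 // expRK. Qed.

(** Gibbs' inequality against the weights phi / Z n bounds entropy plus mean logarithm at length [n]
    by ln (Z n). Since rates are infima, an excess over [P] would grow linearly in [n] while staying
    bounded by - ln c. *)
Lemma variational_le mu : shift_invariant mu -> shift_entropy mu + word_growth phi mu <= P.
Proof.
move=> inv; have [c c0 hZ] := pressure_bounds N2 phi_qm.
have [hc [hl hle]] := shift_entropy_cvg inv.
have [gc gle] := word_growth_cvg phi_qm inv.
have key n : (0 < n)%N -> n%:R * (shift_entropy mu + word_growth phi mu - P) <= - ln c.
  move=> n0; have nR : 0 < n%:R :> R by rewrite ltr0n.
  have Zn := partition_fun_gt0 N2 phi_qm n.
  have lnZ : ln c + ln (Z n) <= n%:R * P.
    rewrite -lnM ?posrE // -[n%:R * P]expRK ler_ln ?posrE ?mulr_gt0 ?expR_gt0 //.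
    exact: (hZ n).2.
  have h1 : shift_entropy mu * n%:R <= word_entropy mu n by rewrite -ler_pdivlMr ?hle.
  have h2 : word_growth phi mu * n%:R <= mean_log phi mu n by rewrite -ler_pdivlMr ?gle.
  have h3 : word_entropy mu n + mean_log phi mu n <= ln (Z n).
    have h : wsum n (fun w => prb mu (cyl w) * ln (phi w / Z n)) <=
        wsum n (fun w => prb mu (cyl w) * ln (prb mu (cyl w))).
      rewrite -!wsum_tuple; apply: gibbs_inequality => [t|t|t|].
      - exact: prb_ge0.
      - by rewrite divr_ge0 ?ltW.
      - by move/eqP; rewrite gt_eqF // divr_gt0.
      - by rewrite (wsum_tuple n (fun w => phi w / Z n)) wsum_scaler divff ?gt_eqF // sum_cyl.
    move: h; rewrite (eq_wsum (G := fun w =>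
      prb mu (cyl w) * ln (phi w) + prb mu (cyl w) * (- ln (Z n)))); last first.
      by move=> w _; rewrite ln_div ?posrE // mulrDr.
    rewrite wsum_add wsum_scaler wsum_cyl mul1r /word_entropy /mean_log; lra.
  lra.
by have := le_div_nat key; rewrite subr_le0.
Qed.

(** The upper Gibbs bound makes -ln mu(w) at least nP - ln phi(w) - ln C on words of length n;
    average over the words. *)
Lemma gibbs_variational mu : shift_invariant mu -> gibbs mu ->
  shift_entropy mu + word_growth phi mu = P.
Proof.
move=> inv [c [C [c0 hmu]]]; apply/eqP; rewrite eq_le variational_le //=.
have [hc [hl hle]] := shift_entropy_cvg inv.
have [gc gle] := word_growth_cvg phi_qm inv.
have key n : (0 < n)%N -> P - ln C / n%:R <= word_entropy mu n / n%:R + mean_log phi mu n / n%:R.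
  move=> n0; have nR : 0 < n%:R :> R by rewrite ltr0n.
  rewrite -mulrDl ler_pdivlMr // mulrBl divfK ?gt_eqF // /word_entropy.
  have h : wsum n (fun w => prb mu (cyl w) * ln (prb mu (cyl w))) <=
      wsum n (fun w => prb mu (cyl w) * ln (phi w) + prb mu (cyl w) * (ln C - n%:R * P)).
    apply: ler_wsum => w wn; rewrite -mulrDr ler_wpM2l ?prb_ge0 //.
    have /andP [h1 h2] := hmu w; have g0 := gibbs_weight_gt0 w.
    have m0 : 0 < prb mu (cyl w) by apply: lt_le_trans h1; rewrite mulr_gt0.
    have C0 : 0 < C by rewrite -(pmulr_lgt0 _ g0); exact: lt_le_trans h2.
    rewrite -wn addrCA -ln_gibbs_weight -lnM ?posrE // ler_ln ?posrE //.
    exact: mulr_gt0.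
  by move: h; rewrite wsum_add wsum_scaler wsum_cyl mul1r /mean_log; lra.
have L1 : P - ln C / n%:R @[n --> \oo] --> P - 0.
  by apply: cvgB; [exact: cvg_cst | exact: cvg_div_nat].
have L2 : word_entropy mu n / n%:R + mean_log phi mu n / n%:R @[n --> \oo] -->
    shift_entropy mu + word_growth phi mu by apply: cvgD => //; rewrite -hl.
rewrite subr0 in L1; apply: ler_cvg_to L1 L2 _; exists 1%N => // n; exact: key.
Qed.

(** Rates being infima, entropy plus mean logarithm of [nu] is at least nP at each length; the lower
    Gibbs bound for [mu] turns this into a relative entropy at most - ln c. *)
Lemma equilibrium_relative_entropy mu nu : gibbs mu -> shift_invariant nu ->
  P <= shift_entropy nu + word_growth phi nu ->
  exists K, forall n, (0 < n)%N ->
    wsum n (fun w => prb nu (cyl w) * ln (prb nu (cyl w))) <=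
    K + wsum n (fun w => prb nu (cyl w) * ln (prb mu (cyl w))).
Proof.
move=> [c [C [c0 hmu]]] inv hP; exists (- ln c) => n n0.
have nR : 0 < n%:R :> R by rewrite ltr0n.
have [_ [_ /(_ n n0)]] := shift_entropy_cvg inv; rewrite ler_pdivlMr // => h1.
have [_ /(_ n n0)] := word_growth_cvg phi_qm inv; rewrite ler_pdivlMr // => h2.
have h3 : P * n%:R <= word_entropy nu n + mean_log phi nu n.
  by apply: le_trans (lerD h1 h2); rewrite -mulrDl ler_wpM2r // ltW.
have h : wsum n (fun w => prb nu (cyl w) * ln (phi w) + prb nu (cyl w) * (ln c - n%:R * P)) <=
    wsum n (fun w => prb nu (cyl w) * ln (prb mu (cyl w))).
  apply: ler_wsum => w wn; rewrite -mulrDr ler_wpM2l ?prb_ge0 //.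
  have /andP [h4 _] := hmu w; have g0 := gibbs_weight_gt0 w.
  have m0 : 0 < prb mu (cyl w) by apply: lt_le_trans h4; rewrite mulr_gt0.
  by rewrite -wn addrCA -ln_gibbs_weight -lnM ?posrE // ler_ln ?posrE // mulr_gt0.
by move: h h3; rewrite wsum_add wsum_scaler wsum_cyl mul1r /mean_log /word_entropy; lra.
Qed.

(* Donsker-Varadhan duality for the test function s 1_F. *)
Lemma clopen_entropy_bound mu nu K n (Q : pred (seq letter)) (s : R) :
  (forall w, 0 < prb mu (cyl w)) -> 0 < s ->
  wsum n (fun w => prb nu (cyl w) * ln (prb nu (cyl w))) <=
    K + wsum n (fun w => prb nu (cyl w) * ln (prb mu (cyl w))) ->
  s * prb nu [set x : S | Q (mkseq x n)] <= K + expR s * prb mu [set x : S | Q (mkseq x n)].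
Proof.
move=> mu0 s0 hK; set F := [set x : S | Q (mkseq x n)].
pose f w : R := (Q w)%:R.
have prF (la : probability S R) : prb la F = wsum n (fun w => prb la (cyl w) * f w).
  rewrite prb_clopen -(wsum_tuple n (fun w => prb la (cyl w) * f w)) big_mkcond /=.
  by apply: eq_bigr => t _; rewrite /f; case: (Q t); rewrite ?mulr1 ?mulr0.
pose q w := prb mu (cyl w) * expR (s * f w).
pose T := wsum n q.
have q0 w : 0 < q w by rewrite mulr_gt0 // expR_gt0.
have T1 : 1 <= T <= 1 + expR s * prb mu F.
  apply/andP; split.
    rewrite -(wsum_cyl mu n); apply: ler_wsum => w _.
    rewrite /q ler_peMr ?prb_ge0 // -expR0 ler_expR mulr_ge0 ?(ltW s0) //.
  rewrite prF -wsum_scale -(wsum_cyl mu n) -wsum_add; apply: ler_wsum => w _.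
  rewrite /q /f; case: (Q w); rewrite ?mulr1 ?mulr0 ?expR0 ?addr0 ?mulr1 //.
  by rewrite [expR s * _]mulrC lerDr prb_ge0.
have T0 : 0 < T by have /andP [h _] := T1; exact: lt_le_trans h.
have h : wsum n (fun w => prb nu (cyl w) * ln (q w / T)) <=
    wsum n (fun w => prb nu (cyl w) * ln (prb nu (cyl w))).
  rewrite -!wsum_tuple; apply: gibbs_inequality => [t|t|t|].
  - exact: prb_ge0.
  - by rewrite divr_ge0 ?ltW.
  - by move/eqP; rewrite gt_eqF // divr_gt0.
  - by rewrite (wsum_tuple n (fun w => q w / T)) wsum_scaler divff ?gt_eqF // sum_cyl.
move: h; rewrite (eq_wsum (G := fun w => prb nu (cyl w) * ln (prb mu (cyl w)) +
   (s * (prb nu (cyl w) * f w) + prb nu (cyl w) * (- ln T)))); last first.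
  by move=> w _; rewrite ln_div ?posrE // /q lnM ?posrE ?expR_gt0 // expRK; ring.
rewrite !wsum_add wsum_scale wsum_scaler wsum_cyl mul1r -prF => h.
have lnT : ln T <= expR s * prb mu F.
  have /andP [_ T2] := T1.
  apply: (@le_trans _ _ (ln (1 + expR s * prb mu F))).
    by rewrite ler_ln ?posrE //; exact: lt_le_trans T2.
  by apply: le_ln1Dx; apply: (@lt_le_trans _ _ 0); rewrite ?ltrN10 ?mulr_ge0 ?expR_ge0 ?prb_ge0.
lra.
Qed.

End VariationalPrinciple.

(** * Ergodicity and uniqueness *)

Section Ergodicity.
Context {R : realType} {N : nat} {N2 : (2 <= N)%N}.
Local Notation letter := 'I_N.
Local Notation S := (borel_Sigma N2).
Local Notation cyl := (@cylinder N N2).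
Local Notation shift := (fullshift N2).
Implicit Types (u v w : seq letter) (mu nu : probability S R).
Variable phi : seq letter -> R.
Hypothesis phi_qm : quasi_multiplicative phi.

Lemma measurable_preshift n (B : set S) : measurable B -> measurable (iter n shift @^-1` B).
Proof.
move=> mB; elim: n => [//|n IH].
rewrite (_ : _ @^-1` _ = shift @^-1` (iter n shift @^-1` B)); last first.
  by apply/seteqP; split=> x; rewrite /= -iterSr.
by rewrite -[X in measurable X]setTI; exact: shift_measurable.
Qed.

Lemma prb_preshift mu n (B : set S) : shift_invariant mu -> measurable B ->
  prb mu (iter n shift @^-1` B) = prb mu B.
Proof.
move=> inv mB; elim: n => [//|n IH].
rewrite -IH -[RHS](shift_invariant_prb inv); last exact: measurable_preshift.
by congr prb; apply/seteqP; split=> x; rewrite /= -iterSr.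
Qed.

(** A point leaving [A] within the orbit does so at the first step or after it; invariance makes
    both events null. *)
Lemma null_preshift mu n (A : set S) : shift_invariant mu -> measurable A ->
  prb mu (A `\` shift @^-1` A) = 0 -> prb mu (A `\` iter n shift @^-1` A) = 0.
Proof.
move=> inv mA A0; have mn k : measurable (iter k shift @^-1` A) by exact: measurable_preshift.
have m1 : measurable (shift @^-1` A) := mn 1%N.
elim: n => [|n IH]; first by rewrite [X in prb _ X](_ : _ = set0) ?prb0 //; exact: setDv.
apply/eqP; rewrite eq_le prb_ge0 andbT.
have mB : measurable (A `\` iter n shift @^-1` A) by exact: measurableD.
apply: (@le_trans _ _ (prb mu ((A `\` shift @^-1` A) `|`
    shift @^-1` (A `\` iter n shift @^-1` A)))).
  have mS : measurable (shift @^-1` (A `\` iter n shift @^-1` A)) := measurable_preshift 1 mB.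
  apply: prb_le => [||x /= [Ax nAx]].
  - exact: measurableD.
  - by apply: measurableU => //; exact: measurableD.
  have [h|h] := pselect (A (shift x)); last by left.
  by right; split=> //; rewrite -iterSr.
apply: le_trans (prbU_le _ _ _) _; [exact: measurableD | exact: (measurable_preshift 1 mB) |].
by rewrite A0 (shift_invariant_prb inv mB) IH addr0.
Qed.

Lemma gibbs_mixing mu : gibbs phi mu -> exists L c, 0 < c /\ forall u v, exists2 w,
  (size w <= L)%N & c * (prb mu (cyl u) * prb mu (cyl v)) <= prb mu (cyl (u ++ w ++ v)).
Proof.
move=> [c [C [c0 hmu]]]; have [L [k [k0 hk]]] := potential_connect phi_qm.
have g0 := gibbs_weight_gt0 phi_qm.
have C0 : 0 < C.
  have /andP [h1 h2] := hmu [::]; rewrite -(pmulr_lgt0 _ (g0 [::])).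
  by apply: lt_le_trans h2; apply: lt_le_trans h1; rewrite mulr_gt0.
(* [m] bounds the normalising factor of the connecting word from below, whatever the sign of the
   pressure. *)
pose P := pressure phi; pose m := expR (- (L%:R * `|P|)).
exists L, (c * k * m / C ^+ 2); split.
  by rewrite divr_gt0 ?exprn_gt0 // !mulr_gt0 // expR_gt0.
move=> u v; have [w wL h] := hk u v; exists w => //.
have /andP [h1 _] := hmu (u ++ w ++ v); apply: le_trans h1.
have /andP [_ hu] := hmu u; have /andP [_ hv] := hmu v.
have hm : m <= expR (- ((size w)%:R * P)).
  rewrite ler_expR lerN2; apply: (@le_trans _ _ ((size w)%:R * `|P|)).
    by rewrite ler_wpM2l // ler_norm.
  by rewrite ler_wpM2r // ler_nat.
have e0 := expR_ge0; have p0 := potential_gt0 phi_qm.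
have -> : gibbs_weight phi (u ++ w ++ v) = phi (u ++ w ++ v) * (expR (- ((size u)%:R * P)) *
    expR (- ((size w)%:R * P)) * expR (- ((size v)%:R * P))).
  rewrite /gibbs_weight; congr (_ * _); rewrite -!expRD !size_cat !natrD -/P; congr expR; ring.
apply: (@le_trans _ _ (c * k * m / C ^+ 2 * ((C * gibbs_weight phi u) * (C * gibbs_weight phi v)))).
  have k1 : 0 <= c * k * m / C ^+ 2.
    by rewrite divr_ge0 ?exprn_ge0 ?(ltW C0) // !mulr_ge0 ?(ltW c0) ?(ltW k0) // expR_ge0.
  by apply: (ler_wpM2l k1); rewrite ler_pM // prb_ge0.
have -> : c * k * m / C ^+ 2 * ((C * gibbs_weight phi u) * (C * gibbs_weight phi v)) =
   c * ((k * (phi u * phi v)) * (expR (- ((size u)%:R * P)) * m * expR (- ((size v)%:R * P)))).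
  rewrite /gibbs_weight -/P; field; exact: lt0r_neq0.
rewrite ler_wpM2l ?(ltW c0) //; apply: ler_pM => //.
- by rewrite !mulr_ge0 ?(ltW k0) ?(ltW (p0 _)).
- by rewrite !mulr_ge0 ?expR_ge0.
- by rewrite ler_wpM2r ?expR_ge0 // ler_wpM2l ?expR_ge0.
Qed.

Lemma clopen_preshift n m (Q : pred (seq letter)) :
  iter n shift @^-1` [set x : S | Q (mkseq x m)] =
  [set x : S | Q (drop n (mkseq x (n + m)))].
Proof.
suff e (x : S) : mkseq (iter n shift x) m = drop n (mkseq x (n + m)).
  by apply/seteqP; split=> x; rewrite /= e.
rewrite /mkseq -map_drop drop_iota add0n addKn -[in RHS](addn0 n) iotaDl -[RHS]map_comp.
by apply: eq_map => j; rewrite /= iter_shift.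
Qed.

(** The connecting word varies with the pair of cylinders, so all gap lengths up to [L] are summed;
    the shift by n + j skips the first block and the gap. *)
Lemma clopen_mixing mu : gibbs phi mu -> exists L c, 0 < c /\ forall n (Q Q' : pred (seq letter)),
  c * (prb mu [set x : S | Q (mkseq x n)] * prb mu [set x : S | Q' (mkseq x n)]) <=
  \sum_(j < L.+1) prb mu ([set x : S | Q (mkseq x n)] `&`
                 iter (n + j)%N shift @^-1` [set x : S | Q' (mkseq x n)]).
Proof.
move=> hg; have [L [c [c0 h]]] := gibbs_mixing hg; exists L, c; split=> // n Q Q'.
have prF (P : pred (seq letter)) m : prb mu [set x : S | P (mkseq x m)] =
    wsum m (fun w => (P w)%:R * prb mu (cyl w)).
  rewrite prb_clopen -(wsum_tuple m (fun w => (P w)%:R * prb mu (cyl w))) big_mkcond /=.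
  by apply: eq_bigr => t _; case: (P t); rewrite ?mul1r ?mul0r.
have e j : prb mu ([set x : S | Q (mkseq x n)] `&`
                 iter (n + j)%N shift @^-1` [set x : S | Q' (mkseq x n)]) =
  wsum n (fun u => wsum n (fun v => wsum j (fun w =>
    (Q u)%:R * (Q' v)%:R * prb mu (cyl (u ++ w ++ v))))).
  rewrite clopen_preshift [X in prb _ X](_ : _ = [set x : S |
      [pred t | Q (take n t) && Q' (drop (n + j) t)] (mkseq x (n + j + n))]); last first.
    have tk (x : S) : take n (mkseq x (n + j + n)) = mkseq x n.
      by rewrite /mkseq -map_take take_iota; congr (map _ (iota _ _)); lia.
    by apply/seteqP; split=> x /=; rewrite tk; [case=> -> -> | move=> /andP].
  rewrite prF -addnA wsumD; apply: eq_wsum => u un.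
  rewrite wsumD exchange_wsum; apply: eq_wsum => v vn; apply: eq_wsum => w wn /=.
  rewrite take_size_cat // catA drop_size_cat ?size_cat ?un ?wn // -catA.
  by case: (Q u); case: (Q' v); rewrite /= !(mul0r, mul1r).
under eq_bigr do rewrite e; rewrite !prF -wsum_scaler -wsum_scale -wsum_sum.
apply: ler_wsum => u un; rewrite -!wsum_scale -wsum_sum; apply: ler_wsum => v vn.
have -> : c * ((Q u)%:R * prb mu (cyl u) * ((Q' v)%:R * prb mu (cyl v))) =
   (Q u)%:R * (Q' v)%:R * (c * (prb mu (cyl u) * prb mu (cyl v))) by ring.
have [w wL hw] := h u v; have wL' : (size w < L.+1)%N by [].
apply: le_trans (ler_wpM2l _ hw) _; first by rewrite mulr_ge0.
rewrite (bigD1 (Ordinal wL')) //=.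
have F0 w' : 0 <= (Q u)%:R * (Q' v)%:R * prb mu (cyl (u ++ w' ++ v)).
  by rewrite !mulr_ge0 // prb_ge0.
apply: le_trans (wsum_term F0 (erefl (size w))) _.
by rewrite lerDl; apply: sumr_ge0 => j _; exact: wsum_ge0.
Qed.

(** If 0 < mu A < 1, mixing sends a definite mass from a clopen approximation of [A] into its
    complement, whereas almost no point of [A] ever leaves [A]. *)
Lemma gibbs_ergodic mu (A : set S) : shift_invariant mu -> gibbs phi mu -> measurable A ->
  prb mu (A `\` shift @^-1` A) = 0 -> prb mu A = 0 \/ prb mu A = 1.
Proof.
move=> inv hg mA A0; have [L [c [c0 h]]] := clopen_mixing hg.
have [->|a0] := eqVneq (prb mu A) 0; [by left | right; apply/eqP].
rewrite eq_le prb_le1 //= leNgt; apply/negP => a1.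
have {}a0 : 0 < prb mu A by rewrite lt_neqAle eq_sym a0 prb_ge0.
set a := prb mu A in a0 a1.
(* With errors at most [k] the escaping mass, less than 2 k for each of the [L.+1] gaps, totals at
   most half of what mixing demands. *)
pose k := c * (a / 2) * ((1 - a) / 2) / 4 / L.+1%:R.
have L0 : 0 < L.+1%:R :> R by rewrite ltr0n.
have k0 : 0 < k by rewrite !(divr_gt0, mulr_gt0) // subr_gt0.
pose e := Num.min k (Num.min (a / 2) ((1 - a) / 2)).
have e0 : 0 < e by rewrite !lt_min k0 !divr_gt0 // subr_gt0.
have [n [Q]] := clopen_approx mu mA e0.
set F := [set x : S | Q (mkseq x n)] => /= -[AF FA].
have mF : measurable F by exact: clopen_measurable.
have FC : [set x : S | predC Q (mkseq x n)] = ~` F.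
  by apply/seteqP; split=> x /=; move/negP.
have := h n Q (predC Q); rewrite -/F FC => hF.
have ek : e <= k by rewrite ge_min lexx.
have ea : e <= a / 2 by rewrite !ge_min lexx orbT.
have ea' : e <= (1 - a) / 2 by rewrite !ge_min lexx !orbT.
have pF1 : a - e <= prb mu F.
  have := prbD mu mA mF; have := prb_le mu (measurableI _ _ mA mF) mF (@subIsetr _ A F).
  rewrite -/a; lra.
have pF2 : 1 - a - e <= prb mu (~` F).
  have := prbD mu mF mA; have := prb_le mu (measurableI _ _ mF mA) mA (@subIsetr _ F A).
  rewrite prbC // -/a; lra.
have up j : prb mu (F `&` iter (n + j)%N shift @^-1` (~` F)) < 2 * e.
  have mB := measurable_preshift (n + j) (measurableD mA mF).
  have mC := measurable_preshift (n + j) mA.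
  have mD := measurable_preshift (n + j) (measurableC mF).
  have m1 : measurable (F `\` A) := measurableD mF mA.
  have m2 := measurableD mA mC.
  (* A point that goes from [F] to its complement starts outside [A], leaves [A], or arrives in [A]
     outside [F]. *)
  apply: (@le_lt_trans _ _ (prb mu ((F `\` A) `|` ((A `\` iter (n + j) shift @^-1` A) `|`
       iter (n + j) shift @^-1` (A `\` F))))).
    apply: prb_le => [||x /= [Fx nFx]].
    - exact: measurableI.
    - by apply: measurableU => //; exact: measurableU.
    - have [Ax|] := pselect (A x); last by left.
      by right; have [Ay|] := pselect (A (iter (n + j) shift x)); [right | left].
  apply: le_lt_trans (prbU_le mu m1 (measurableU _ _ m2 mB)) _.
  apply: le_lt_trans (lerD (lexx _) (prbU_le mu m2 mB)) _.
  rewrite (null_preshift (n + j) inv mA A0) (prb_preshift _ inv (measurableD mA mF)).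
  lra.
have low : c * (a / 2 * ((1 - a) / 2)) <= c * (prb mu F * prb mu (~` F)).
  rewrite (ler_wpM2l (ltW c0)) // ler_pM //; lra.
have : c * (a / 2 * ((1 - a) / 2)) <= L.+1%:R * (2 * e).
  apply: le_trans low _; apply: le_trans hF _.
  rewrite mulr_natl -[X in _ *+ X]card_ord -sumr_const; apply: ler_sum => j _; exact/ltW/up.
rewrite leNgt => /negP; apply.
apply: (@le_lt_trans _ _ (L.+1%:R * (2 * k))); first by rewrite !ler_wpM2l.
have -> : L.+1%:R * (2 * k) = c * (a / 2 * ((1 - a) / 2)) / 2.
  by rewrite /k; field; rewrite addrC natr1 gt_eqF.
have q0 : 0 < c * (a / 2 * ((1 - a) / 2)) by rewrite !(mulr_gt0, divr_gt0) // subr_gt0.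
lra.
Qed.

End Ergodicity.

(** * Comparison of two probability measures *)

Section SignedDecomposition.
Context {R : realType} {disp : measure_display} {T : measurableType disp}.
Implicit Types (mu nu : probability T R).

(** Approximation with respect to the midpoint measure is good for [mu] and [nu] at the same
    time. *)
Lemma mixture_exists mu nu : exists la : probability T R, forall A, measurable A ->
  prb la A = (prb mu A + prb nu A) / 2.
Proof.
have h0 : (0 : R) <= 2^-1 by rewrite invr_ge0.
pose la0 : {measure set T -> \bar R} := mscale (NngNum h0) (measure_add mu nu).
have la0E A : measurable A -> la0 A = ((prb mu A + prb nu A) / 2)%:E.
  move=> mA; transitivity ((2^-1)%:E * measure_add mu nu A)%E; first by [].
  rewrite measure_addE [X in (_ * (X + _))%E](_ : _ = (prb mu A)%:E); last exact: prbE.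
  rewrite [X in (_ * (_ + X))%E](_ : _ = (prb nu A)%:E); last exact: prbE.
  by rewrite -EFinD -EFinM mulrC.
have la1 : la0 setT = 1%E by rewrite la0E // !prbT; congr EFin; rewrite divff.
pose la : probability T R := HB.pack (mscale (NngNum h0) (measure_add mu nu))
  (Measure_isProbability.Build _ _ _ (mscale (NngNum h0) (measure_add mu nu)) la1).
by exists la => A mA; rewrite /prb [la A]la0E.
Qed.

Lemma hahn_prb mu nu (t : R) : exists A : set T, [/\ measurable A,
  forall B, measurable B -> B `<=` A -> t * prb mu B <= prb nu B
  & forall B, measurable B -> B `<=` ~` A -> prb nu B <= t * prb mu B].
Proof.
pose ch := cadd (charge_of_finite_measure nu) (cscale (- t) (charge_of_finite_measure mu)).
have [A [C [[mA pA] [mC nC] AC AC0]]] := Hahn_decomposition ch.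
have chE B : measurable B -> ch B = (prb nu B - t * prb mu B)%:E.
  move=> mB; transitivity (nu B + (- t)%:E * mu B)%E; first by [].
  rewrite (prbE nu mB) (prbE mu mB).
  by rewrite -EFinM -EFinD mulNr.
exists A; split=> // B mB BA.
  by have := pA B mB BA; rewrite [X in (_ <= X)%E](chE B mB) lee_fin subr_ge0.
have BC : B `<=` C.
  move=> x Bx; have : (A `|` C) x by rewrite AC.
  by case=> // Ax; case: (BA x Bx).
by have := nC B mB BC; rewrite [X in (X <= _)%E](chE B mB) lee_fin subr_le0.
Qed.

End SignedDecomposition.

Section Uniqueness.
Context {R : realType} {N : nat} {N2 : (2 <= N)%N}.
Local Notation letter := 'I_N.
Local Notation S := (borel_Sigma N2).
Local Notation cyl := (@cylinder N N2).
Local Notation shift := (fullshift N2).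
Implicit Types (u v w : seq letter) (mu nu : probability S R).

(** A [mu]-null set charged by [nu] is approximated by clopen sets of tiny [mu]-mass and substantial
    [nu]-mass, which [clopen_entropy_bound] forbids for large [s]. *)
Lemma entropy_abs_continuous mu nu K : (forall w, 0 < prb mu (cyl w)) ->
  (forall n, (0 < n)%N -> wsum n (fun w => prb nu (cyl w) * ln (prb nu (cyl w))) <=
    K + wsum n (fun w => prb nu (cyl w) * ln (prb mu (cyl w)))) ->
  forall B, measurable B -> prb mu B = 0 -> prb nu B = 0.
Proof.
move=> mu0 hK B mB B0; apply/eqP; rewrite eq_le prb_ge0 andbT leNgt; apply/negP => b0.
set b := prb nu B in b0.
have [la laE] := mixture_exists mu nu.
(* As nu(F) exceeds b / 2, the left side of the duality bound exceeds 2 (|K| + 1), while [e] is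
   chosen so that the right side is at most K + 1. *)
pose s := 4 * (`|K| + 1) / b.
have K1 : 0 < `|K| + 1 by rewrite ltr_pwDr.
have s0 : 0 < s by rewrite divr_gt0 // mulr_gt0.
pose e := Num.min (b / 4) ((2 * expR s)^-1).
have e0 : 0 < e by rewrite lt_min divr_gt0 // invr_gt0 mulr_gt0 ?expR_gt0.
have [n [Q]] := clopen_approx la mB e0.
set F := [set x : S | Q (mkseq x n)] => /= -[BF FB].
have mF : measurable F by exact: clopen_measurable.
rewrite laE in BF; last exact: measurableD.
rewrite laE in FB; last exact: measurableD.
have p1 := prb_ge0 mu (B `\` F); have p2 := prb_ge0 nu (B `\` F).
have p3 := prb_ge0 mu (F `\` B); have p4 := prb_ge0 nu (F `\` B).
have muF : prb mu F < 2 * e.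
  have := prbD mu mF mB; have := prb_le mu (measurableI _ _ mF mB) mB (@subIsetr _ F B).
  rewrite B0; lra.
have eb : e <= b / 4 by rewrite ge_min lexx.
have nuF : b / 2 < prb nu F.
  have := prbD nu mB mF; have := prb_le nu (measurableI _ _ mB mF) mF (@subIsetr _ B F).
  rewrite -/b; lra.
(* The approximation may use [n = 0] letters, while the entropy bound is given for positive
   lengths. *)
have hn := hK n.+1 isT.
have Fn : F = [set x : S | Q (take n (mkseq x n.+1))].
  by apply/seteqP; split=> x; rewrite /F /= /mkseq -map_take take_iota (minn_idPl _).
have := clopen_entropy_bound (fun t => Q (take n t)) mu0 s0 hn.
rewrite -Fn => h.
have he : expR s * prb mu F <= 1.
  have ee : e <= (2 * expR s)^-1 by rewrite ge_min lexx orbT.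
  apply: (@le_trans _ _ (expR s * (2 * (2 * expR s)^-1))).
    by rewrite ler_wpM2l ?expR_ge0 //; lra.
  have E0 := expR_gt0 s.
  by have -> : expR s * (2 * (2 * expR s)^-1) = 1 by field; rewrite lt0r_neq0.
have hs : s * (b / 2) < s * prb nu F by rewrite ltr_pM2l.
have sE : s * (b / 2) = 2 * (`|K| + 1) by rewrite /s; field; rewrite lt0r_neq0.
have := ler_norm K; have := normr_ge0 K; lra.
Qed.

(* Given nu << mu with mu ergodic, the set A where d nu / d mu > 1 is invariant
   modulo mu: the signed measure nu - mu is invariant, positive on mu-nonnull
   subsets of A and nonpositive off A, so A minus its shift preimage is null. *)
Lemma ergodic_unique mu nu : shift_invariant mu -> shift_invariant nu ->
  (forall B, measurable B -> prb mu B = 0 -> prb nu B = 0) ->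
  (forall A : set S, measurable A -> prb mu (A `\` shift @^-1` A) = 0 ->
     prb mu A = 0 \/ prb mu A = 1) ->
  forall B, measurable B -> nu B = mu B.
Proof.
move=> imu inu ac erg.
(* Thresholds decreasing to 1: the union of the Hahn sets is where the density exceeds 1 strictly,
   and off it no threshold is passed. *)
pose t (n : nat) : R := 1 + n.+1%:R^-1.
have /choice [P hP] n := hahn_prb mu nu (t n).
pose A := \bigcup_n P n.
have mP n : measurable (P n) by have [] := hP n.
have mA : measurable A by exact: bigcup_measurable.
have off B : measurable B -> B `<=` ~` A -> prb nu B <= prb mu B.
  move=> mB BA; rewrite leNgt; apply/negP => hlt.
  have d0 : 0 < prb nu B - prb mu B by rewrite subr_gt0.
  pose n := Num.Def.archi_bound (prb nu B - prb mu B)^-1.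
  have hn : (prb nu B - prb mu B)^-1 < n%:R by apply: archi_boundP; rewrite invr_ge0 ltW.
  have n0 : 0 < n.+1%:R :> R by rewrite ltr0n.
  have BP : B `<=` ~` P n by move=> x Bx Px; apply: (BA x Bx); exists n.
  have [_ _ /(_ B mB BP)] := hP n; rewrite /t mulrDl mul1r => h.
  have : prb nu B - prb mu B <= n.+1%:R^-1.
    rewrite lerBlDl; apply: le_trans h _; rewrite lerD2l.
    by rewrite ler_piMr ?prb_le1 // invr_ge0 ltW.
  rewrite -[leLHS]invrK lef_pV2 ?posrE ?invr_gt0 // leNgt => /negP; apply.
  by apply: lt_trans hn _; rewrite ltr_nat.
pose U n := \big[setU/set0]_(i < n) P i.
have mU n : measurable (U n) by exact: bigsetU_measurable.
have US n : U n.+1 = U n `|` P n by rewrite /U big_ord_recr.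
have tail B e : measurable B -> 0 < e -> B `<=` A -> exists n, prb mu (B `\` U n) < e.
  move=> mB e0 BA; have [n hn] := prb_bigcup_tail mu mP e0; exists n.
  apply: le_lt_trans hn; apply: prb_le.
  - exact: measurableD.
  - by apply: measurableD => //; exact: mU.
  - by move=> x [Bx nU]; split=> //; exact: BA.
have le_on B : measurable B -> B `<=` A -> prb mu B <= prb nu B.
  move=> mB BA; have fin n : prb mu (B `&` U n) <= prb nu (B `&` U n).
    elim: n => [|n IH]; first by rewrite /U big_ord0 setI0 !prb0.
    have mI := measurableI _ _ mB (mU n.+1).
    rewrite (prbD mu mI (mU n)) (prbD nu mI (mU n)).
    have -> : B `&` U n.+1 `&` U n = B `&` U n.
      by rewrite US; apply/seteqP; split=> x /= [] => [[]|] //; split=> //; split=> //; left.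
    apply: lerD => //; set C := _ `\` _.
    have mC : measurable C by exact: measurableD.
    have CP : C `<=` P n by rewrite /C US => x [[_ []]].
    have [_ /(_ C mC CP) + _] := hP n; apply: le_trans.
    by rewrite ler_peMl ?prb_ge0 // /t lerDl invr_ge0.
  apply/ler_addgt0Pr => e e0; have [n hn] := tail B e mB e0 BA.
  have mI := measurableI _ _ mB (mU n).
  have := prbD mu mB (mU n); have := fin n; have := prb_le nu mI mB (@subIsetl _ _ _); lra.
have on B : measurable B -> B `<=` A -> 0 < prb mu B -> prb mu B < prb nu B.
  move=> mB BA B0.
  have [n hn] : exists n, 0 < prb mu (B `&` P n).
    apply: contrapT => h.
    have z n : prb mu (B `&` P n) <= 0 by rewrite leNgt; apply/negP => hn; apply: h; exists n.
    have zU n : prb mu (B `&` U n) <= 0.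
      elim: n => [|n IH]; first by rewrite /U big_ord0 setI0 prb0.
      rewrite US setIUr; apply: le_trans (prbU_le mu _ _) _; [exact: measurableI..|].
      by rewrite -[leRHS]addr0 lerD.
    have [n hn] := tail B _ mB B0 BA; have mUn := mU n.
    by have := prbD mu mB mUn; have := zU n; lra.
  have m1 := measurableI _ _ mB (mP n); have m2 := measurableD mB (mP n).
  rewrite (prbD mu mB (mP n)) (prbD nu mB (mP n)); apply: ltr_leD.
    have [_ /(_ _ m1 (@subIsetr _ B (P n))) + _] := hP n; apply: lt_le_trans.
    by rewrite /t mulrDl mul1r ltrDl mulr_gt0 // invr_gt0 ltr0n.
  by apply: le_on => // x [Bx _]; exact: BA.
have mSA : measurable (shift @^-1` A) by exact: (measurable_preshift 1 mA).
(* An invariant measure gives equal mass to the points leaving [A] and to those entering it; for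
   [nu] and [mu] this contradicts the opposite signs of [nu - mu] on the two sets. *)
have balance (la : probability S R) : shift_invariant la ->
    prb la (A `\` shift @^-1` A) = prb la (shift @^-1` A `\` A).
  move=> ila; have := shift_invariant_prb ila mA.
  rewrite (prbD la mSA mA) (prbD la mA mSA) setIC => /addrI; exact: esym.
have mD := measurableD mA mSA; have mD' := measurableD mSA mA.
have A0 : prb mu (A `\` shift @^-1` A) = 0.
  apply/eqP; rewrite eq_le prb_ge0 andbT leNgt; apply/negP => h.
  have := on _ mD (@subDsetl _ _ _) h.
  rewrite (balance mu imu) (balance nu inu) ltNge => /negP; apply.
  by apply: off => // x [].
have null : prb mu A = 0.
  (* Full measure is impossible, as [nu A] would exceed 1. *)
  have [//|A1] := erg A mA A0; have := on A mA (@subset_refl _ A).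
  by rewrite A1 ltr01 ltNge (prb_le1 nu mA) => /(_ isT).
have le B : measurable B -> prb nu B <= prb mu B.
  move=> mB; rewrite (prbD nu mB mA) (prbD mu mB mA).
  have mI := measurableI _ _ mB mA.
  have I0 : prb mu (B `&` A) = 0.
    by apply/eqP; rewrite eq_le prb_ge0 andbT -null prb_le.
  by rewrite I0 (ac _ mI I0) lerD2l; apply: off; [exact: measurableD | move=> x []].
move=> B mB; have h1 := le B mB; have h2 := le _ (measurableC mB).
rewrite !prbC // lerD2l lerN2 in h2.
by rewrite (prbE nu mB) (prbE mu mB); congr EFin; apply/eqP; rewrite eq_le h1.
Qed.

End Uniqueness.

Section Equilibrium.
Context {R : realType} {N : nat} {N2 : (2 <= N)%N}.
Local Notation letter := 'I_N.
Local Notation S := (borel_Sigma N2).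
Local Notation cyl := (@cylinder N N2).
Implicit Types (mu nu : probability S R) (phi : seq letter -> R).

Lemma gibbs_gt0 phi mu : quasi_multiplicative phi -> gibbs phi mu -> forall w, 0 < prb mu (cyl w).
Proof.
move=> qm [c [C [c0 h]]] w; have /andP [+ _] := h w; apply: lt_le_trans.
by rewrite mulr_gt0 // gibbs_weight_gt0.
Qed.

Lemma equilibrium_unique phi mu nu : quasi_multiplicative phi ->
  shift_invariant mu -> gibbs phi mu -> shift_invariant nu ->
  pressure phi <= shift_entropy nu + word_growth phi nu ->
  forall B, measurable B -> nu B = mu B.
Proof.
move=> qm imu gmu inu hnu; apply: ergodic_unique => //.
  have [K hK] := equilibrium_relative_entropy qm gmu inu hnu.
  exact: entropy_abs_continuous (gibbs_gt0 qm gmu) hK.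
by move=> A mA; exact: (gibbs_ergodic qm).
Qed.

(** With h the entropy and g1, g2 the growth rates: P1 = h(mu) + g1(mu) <= h(mu) + g2(mu) <= P2 =
    h(mu2) + g2(mu2) <= h(mu2) + g1(mu2) <= P1. Hence [mu] is an equilibrium state for [phi2] and
    equals [mu2]; comparing the two Gibbs bounds bounds [phi1] by [phi2]. *)
Lemma equilibrium_comparison phi1 phi2 (C : R) mu :
  quasi_multiplicative phi1 -> quasi_multiplicative phi2 -> 0 < C ->
  (forall w, phi2 w <= C * phi1 w) ->
  shift_invariant mu -> gibbs phi1 mu -> word_growth phi1 mu <= word_growth phi2 mu ->
  exists D, forall w, phi1 w <= D * phi2 w.
Proof.
move=> qm1 qm2 C0 h12 imu gmu hle.
have [mu2 [imu2 gmu2]] := @gibbs_measure_exists R N N2 _ qm2.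
have e1 := gibbs_variational qm1 imu gmu; have e2 := gibbs_variational qm2 imu2 gmu2.
have v1 := variational_le qm1 imu2.
have l12 : word_growth phi2 mu2 <= word_growth phi1 mu2.
  apply: (le_word_growth C0) => //; [exact: potential_gt0 | exact: potential_gt0 | |].
    by have [] := word_growth_cvg qm2 imu2.
  by have [] := word_growth_cvg qm1 imu2.
have v2 := variational_le qm2 imu.
have PP : pressure phi1 = pressure phi2 by apply/eqP; rewrite eq_le; apply/andP; split; lra.
have hmu : forall B, measurable B -> mu B = mu2 B.
  by apply: (equilibrium_unique qm2) => //; lra.
case: gmu => c1 [C1 [c10 hc1]]; case: gmu2 => c2 [C2 [c20 hc2]].
exists (C2 / c1) => w.
have /andP [a1 _] := hc1 w; have /andP [_ a2] := hc2 w.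
have E0 : 0 < expR (- ((size w)%:R * pressure phi2)) by exact: expR_gt0.
have e : prb mu (cyl w) = prb mu2 (cyl w) by rewrite /prb hmu //; exact: cyl_measurable.
have : c1 * gibbs_weight phi1 w <= C2 * gibbs_weight phi2 w by rewrite (le_trans a1) // e.
rewrite /gibbs_weight PP !mulrA ler_pM2r // => h.
by rewrite mulrAC ler_pdivlMr // mulrC.
Qed.

End Equilibrium.

Section Interpolation.
Context {R : realType} {N : nat} (N2 : (2 <= N)%N).
Local Notation letter := 'I_N.
Implicit Types (u v w : seq letter).

Definition mxnorm a (X : letter -> 'M[R]_a) w : R := norm1 (mxword X w).

Section MatrixWords.
Context {a : nat} (X : letter -> 'M[R]_a).
Hypotheses (a0 : (0 < a)%N) (uX : forall i, X i \in unitmx).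

Lemma norm1_1_ge1 : 1 <= norm1 (1%:M : 'M[R]_a).
Proof.
have n0 : 0 < norm1 (1%:M : 'M[R]_a).
  apply: norm1_gt0; apply/eqP => /matrixP /(_ (Ordinal a0) (Ordinal a0)).
  by rewrite !mxE eqxx; move/eqP; rewrite oner_eq0.
have := norm1M (1%:M : 'M[R]_a) (1%:M : 'M[R]_a); rewrite mul1mx.
by rewrite ler_pMr.
Qed.

Lemma mxnorm_gt0 w : 0 < mxnorm X w.
Proof.
rewrite /mxnorm; apply: norm1_gt0; apply/eqP => h.
have := mxword_unit w uX; rewrite h => u0.
have /matrixP /(_ (Ordinal a0) (Ordinal a0)) := mulmxV u0.
by rewrite mul0mx !mxE eqxx; move/esym/eqP; rewrite oner_eq0.
Qed.

Lemma mxnorm_cat u v : mxnorm X (u ++ v) <= mxnorm X u * mxnorm X v.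
Proof. by rewrite /mxnorm mxword_cat mulrC norm1M. Qed.

(** Removing a letter multiplies by an inverse matrix, whose norm is at most [s]. *)
Lemma mxnorm_low : exists2 k, 0 < k & forall w, k ^+ size w <= mxnorm X w.
Proof.
pose s := 1 + \sum_i norm1 (invmx (X i)).
have s0 : 0 < s by rewrite ltr_pwDl // sumr_ge0 // => i _; exact: norm1_ge0.
exists s^-1; first by rewrite invr_gt0.
elim/last_ind => [|w i IH]; first by rewrite expr0; exact: norm1_1_ge1.
rewrite size_rcons exprS mulrC; apply: le_trans (ler_wpM2r _ IH) _; first by rewrite invr_ge0 ltW.
rewrite ler_pdivrMr // /mxnorm mxword_rcons.
rewrite -[leLHS](congr1 _ (mulKmx (uX i) (mxword X w))).
apply: le_trans (norm1M _ _) _; rewrite mulrC ler_wpM2l ?norm1_ge0 //.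
rewrite /s (bigD1 i) //= addrCA lerDl addr_ge0 // sumr_ge0 // => j _; exact: norm1_ge0.
Qed.

End MatrixWords.

Lemma interpolation_quasi_multiplicative a b (X : letter -> 'M[R]_a) (Y : letter -> 'M[R]_b)
    (p q : R) : (0 < a)%N -> (0 < b)%N ->
  (forall i, X i \in unitmx) -> (forall i, Y i \in unitmx) ->
  irreducible (fun i => linfun (mulmx (X i) : 'cV_a -> 'cV_a)) ->
  strongly_irreducible (fun i => linfun (mulmx (Y i) : 'cV_b -> 'cV_b)) ->
  0 <= p -> 0 <= q ->
  quasi_multiplicative (fun w => mxnorm X w `^ p * mxnorm Y w `^ q).
Proof.
move=> a0 b0 uX uY iX sY p0 q0.
have X0 := mxnorm_gt0 a0 uX; have Y0 := mxnorm_gt0 b0 uY.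
split.
- by move=> w; rewrite mulr_gt0 // powR_gt0.
- have [k k0 hk] := mxnorm_low a0 uX; have [l l0 hl] := mxnorm_low b0 uY.
  exists (k `^ p * l `^ q); first by rewrite mulr_gt0 // powR_gt0.
  move=> w; have e (x r : R) : 0 < x -> (x `^ r) ^+ size w = (x ^+ size w) `^ r.
    by move=> x0; rewrite -!powR_mulrn ?powR_ge0 ?(ltW x0) // powRAC.
  rewrite exprMn !e //; apply: ler_pM; rewrite ?powR_ge0 // ge0_ler_powR //;
    by rewrite nnegrE ?exprn_ge0 // ltW.
- move=> u v; have -> : mxnorm X u `^ p * mxnorm Y u `^ q * (mxnorm X v `^ p * mxnorm Y v `^ q) =
    (mxnorm X u * mxnorm X v) `^ p * (mxnorm Y u * mxnorm Y v) `^ q.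
    by rewrite !powRM ?(ltW (X0 _)) ?(ltW (Y0 _)) //; ring.
  by apply: ler_pM; rewrite ?powR_ge0 // ge0_ler_powR ?mxnorm_cat // nnegrE ?mulr_ge0 // ltW.
- have [L [c [c0 h]]] := joint_quasi_multiplicative a0 b0 uX uY iX sY.
  exists L, (c `^ p * c `^ q); split=> [|u v]; first by rewrite mulr_gt0 // powR_gt0.
  (* [mxword] reverses concatenation, so the word [v] supplies the left factor. *)
  have [w [wL h1 h2]] := h (mxword X v) (mxword X u) (mxword Y v) (mxword Y u).
  exists w => //.
  have e d (M : letter -> 'M[R]_d) :
      mxword M v *m mxword M w *m mxword M u = mxword M (u ++ w ++ v).
    by rewrite !mxword_cat.
  rewrite !e -!/(mxnorm _ _) in h1 h2.
  have c0' := ltW c0.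
  have -> : c `^ p * c `^ q *
      (mxnorm X u `^ p * mxnorm Y u `^ q * (mxnorm X v `^ p * mxnorm Y v `^ q)) =
    (c * (mxnorm X v * mxnorm X u)) `^ p * (c * (mxnorm Y v * mxnorm Y u)) `^ q.
    by rewrite !powRM ?mulr_ge0 ?(ltW (X0 _)) ?(ltW (Y0 _)) //; ring.
  by apply: ler_pM; rewrite ?powR_ge0 // ge0_ler_powR // nnegrE ?mulr_ge0 // ltW.
Qed.

End Interpolation.

(** * Equilibrium states of matrix tuples *)

Section PowerComparison.
Context {R : realType}.
Implicit Types (a b c p q x y z D t : R).

Lemma powR_mul_le a a' b b' c c' p q : 0 < a -> 0 < b -> 0 < a' -> 0 < b' -> 0 < c -> 0 < c' ->
  0 <= p -> 0 <= q -> a <= c * a' -> b <= c' * b' ->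
  a `^ p * b `^ q <= c `^ p * c' `^ q * (a' `^ p * b' `^ q).
Proof.
move=> a0 b0 a0' b0' c0 c0' p0 q0 ha hb.
have -> : c `^ p * c' `^ q * (a' `^ p * b' `^ q) = (c * a') `^ p * (c' * b') `^ q.
  by rewrite !powRM ?ltW //; ring.
by apply: ler_pM; rewrite ?powR_ge0 // ge0_ler_powR // nnegrE ?mulr_ge0 // ltW.
Qed.

Lemma geometric_mean_split x z t : 0 < x -> 0 < z ->
  x `^ (1 - t / 2) * z `^ (t / 2) = x `^ (1 - t) * (x * z) `^ (t / 2).
Proof.
move=> x0 z0; rewrite powRM ?ltW // mulrA -powRD ?(gt_eqF x0) ?implybT //.
by congr (x `^ _ * _); field.
Qed.

Lemma powR_sqr_half y t : 0 < y -> (y ^+ 2) `^ (t / 2) = y `^ t.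
Proof.
move=> y0; rewrite -powR_mulrn ?ltW // -powRrM; congr (y `^ _).
by field.
Qed.

Lemma interpolation_le c x y z t : 0 < c -> 0 < x -> 0 < y -> 0 < z -> 0 < t ->
  x * z <= c * y ^+ 2 ->
  x `^ (1 - t / 2) * z `^ (t / 2) <= c `^ (t / 2) * (x `^ (1 - t) * y `^ t).
Proof.
move=> c0 x0 y0 z0 t0 h; rewrite geometric_mean_split // mulrCA ler_wpM2l ?powR_ge0 //.
have y2 : 0 < y ^+ 2 by rewrite exprn_gt0.
rewrite -(powR_sqr_half t y0) -powRM ?(ltW c0) ?(ltW y2) //.
have xz0 : 0 < x * z by rewrite mulr_gt0.
have cy0 : 0 < c * y ^+ 2 by rewrite mulr_gt0.
by apply: ge0_ler_powR; rewrite ?nnegrE ?(ltW xz0) ?(ltW cy0) // divr_ge0 // ltW.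
Qed.

Lemma interpolation_ge D x y z t : 0 < D -> 0 < x -> 0 < y -> 0 < z -> 0 < t ->
  x `^ (1 - t) * y `^ t <= D * (x `^ (1 - t / 2) * z `^ (t / 2)) ->
  y ^+ 2 <= D `^ (2 / t) * (x * z).
Proof.
move=> D0 x0 y0 z0 t0; rewrite geometric_mean_split // mulrCA ler_pM2l ?powR_gt0 //.
have xz0 : 0 < x * z by rewrite mulr_gt0.
have D1 : D = (D `^ (2 / t)) `^ (t / 2).
  by rewrite -powRrM (_ : 2 / t * (t / 2) = 1) ?powRr1 ?(ltW D0) //; field; rewrite gt_eqF.
rewrite {1}D1 -(powR_sqr_half t y0) -powRM ?powR_ge0 ?(ltW xz0) // => h.
rewrite leNgt; apply/negP => h'; move: h; rewrite leNgt => /negP; apply.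
have Dxz0 : 0 <= D `^ (2 / t) * (x * z) by rewrite mulr_ge0 ?powR_ge0 // ltW.
by apply: gt0_ltr_powR; rewrite ?nnegrE ?divr_gt0 ?exprn_ge0 // ltW.
Qed.

End PowerComparison.

Section Gap.
Context {R : realType} {N : nat} {N2 : (2 <= N)%N}.
Local Notation letter := 'I_N.
Local Notation S := (borel_Sigma N2).
Implicit Types (mu nu : probability S R).

Lemma growth_gap (f g h : seq letter -> R) (t c : R) mu :
  (forall w, 0 < f w) -> (forall w, 0 < g w) -> (forall w, 0 < h w) -> 0 < t -> 0 < c ->
  (forall w, f w * h w <= c * g w ^+ 2) ->
  (forall C, exists w, C * (f w * h w) < g w ^+ 2) ->
  quasi_multiplicative (fun w => f w `^ (1 - t) * g w `^ t) ->
  quasi_multiplicative (fun w => f w `^ (1 - t / 2) * h w `^ (t / 2)) ->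
  cvgn (fun n => mean_log f mu n / n%:R) -> cvgn (fun n => mean_log g mu n / n%:R) ->
  cvgn (fun n => mean_log h mu n / n%:R) ->
  shift_invariant mu -> gibbs (fun w => f w `^ (1 - t) * g w `^ t) mu ->
  word_growth f mu + word_growth h mu < 2 * word_growth g mu.
Proof.
move=> f0 g0 h0 t0 c0 conc unb qm1 qm2 cf cg ch imu gmu.
rewrite ltNge; apply/negP => le.
have [_ e1] := word_growth_powR (1 - t) t f0 g0 cf cg.
have [_ e2] := word_growth_powR (1 - t / 2) (t / 2) f0 h0 cf ch.
have C0 : 0 < c `^ (t / 2) by rewrite powR_gt0.
have hle w : f w `^ (1 - t / 2) * h w `^ (t / 2) <= c `^ (t / 2) * (f w `^ (1 - t) * g w `^ t).
  exact: interpolation_le.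
have [|D hD] := equilibrium_comparison qm1 qm2 C0 hle imu gmu.
  rewrite e1 e2 -subr_ge0.
  (* The growth rates of the two products differ by t / 2 times the concavity defect, nonnegative
     under the assumption to be refuted. *)
  have -> : (1 - t / 2) * word_growth f mu + t / 2 * word_growth h mu -
     ((1 - t) * word_growth f mu + t * word_growth g mu) =
     t / 2 * (word_growth f mu + word_growth h mu - 2 * word_growth g mu) by field.
  by rewrite mulr_ge0 ?subr_ge0 // divr_ge0 // ltW.
have D0 : 0 < D.
  have p2 : 0 < f [::] `^ (1 - t / 2) * h [::] `^ (t / 2) by rewrite mulr_gt0 ?powR_gt0.
  by rewrite -(pmulr_lgt0 _ p2); apply: lt_le_trans (hD [::]); rewrite mulr_gt0 ?powR_gt0.
have [w hw] := unb (D `^ (2 / t)); move: hw; rewrite ltNge => /negP; apply.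
exact: interpolation_ge.
Qed.

Lemma equilibrium_state_exists d (A : letter -> 'M[R]_d) (s c : R) (psi : seq letter -> R) :
  quasi_multiplicative psi -> 0 < c -> (forall w, 0 < phi s (mxword A w)) ->
  (forall w, phi s (mxword A w) <= c * psi w) -> (forall w, psi w <= c * phi s (mxword A w)) ->
  exists mu, [/\ shift_invariant mu, gibbs psi mu, equilibrium_state s A mu &
    forall nu, equilibrium_state s A nu -> forall B, measurable B -> nu B = mu B].
Proof.
move=> qm c0 p0 h1 h2.
have [mu [imu gmu]] := @gibbs_measure_exists R N N2 _ qm.
have pE nu : shift_invariant nu ->
    pressure_at s A nu = (shift_entropy nu + word_growth psi nu)%:E.
  move=> inu; rewrite /pressure_at ks_entropy_coord // EFinD; congr (_ + _%:E)%E.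
  rewrite growth_rate_words; have [cp _] := word_growth_cvg qm inu.
  by have [_ ->] := comparable_growth c0 p0 (potential_gt0 qm) h1 h2 cp.
have emu := gibbs_variational qm imu gmu.
exists mu; split=> //.
  split=> // nu inu; rewrite !pE // lee_fin emu; exact: variational_le.
move=> nu [inu hnu]; apply: (equilibrium_unique qm) => //.
by have := hnu mu imu; rewrite !pE // lee_fin emu.
Qed.

End Gap.

Section SingularValueFunction.
Context {R : realType} {d : nat}.
Implicit Types (M : 'M[R]_d) (s : R) (k : nat).

Lemma sing_prod_gt0 M l : M \in unitmx -> (l <= d)%N -> 0 < sing_prod l M.
Proof.
move=> uM ld; apply: prodr_gt0 => j _; apply: sing_gt0 => //.
exact: leq_trans (ltn_ord j) ld.
Qed.

Lemma sing_prodS M l : sing_prod l.+1 M = sing_prod l M * sing l.+1 M.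
Proof. by rewrite /sing_prod big_ord_recr. Qed.

Lemma phi_interpolation s k M : M \in unitmx -> k%:R <= s <= k.+1%:R -> (k.+1 <= d)%N ->
  phi s M = sing_prod k M `^ (1 - (s - k%:R)) * sing_prod k.+1 M `^ (s - k%:R).
Proof.
move=> uM /andP [ks sk] kd.
have s0 : 0 <= s by apply: le_trans ks.
have p0 := sing_prod_gt0 uM (ltnW kd); have p1 := sing_prod_gt0 uM kd.
have prodE l : \prod_(1 <= j < l.+1) sing j M = sing_prod l M.
  by rewrite big_add1 /= big_mkord.
rewrite /phi prodE; have [sE|sk'] := eqVneq s k.+1%:R.
  have tE : Num.truncn s = k.+1 by rewrite sE natrK.
  rewrite tE sE subrr powRr0 mulr1 -natr1 addrAC subrr add0r subrr powRr0 mul1r powRr1 //.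
  exact: ltW.
have {}sk : s < k.+1%:R by rewrite lt_neqAle sk' sk.
have tE : Num.truncn s = k by apply/eqP; rewrite truncn_eq // ks.
rewrite tE; have [sE|ks'] := eqVneq s k%:R.
  by rewrite sE subrr subr0 !powRr0 !mulr1 powRr1 // ltW.
have cE : `|Num.ceil s|%N = k.+1.
  have -> : Num.ceil s = k.+1%:Z.
    have e1 : k.+1%:Z - 1 = k%:Z by rewrite -addn1 PoszD addrK.
    apply/eqP; rewrite ceil_eq e1; apply/andP; split.
      by rewrite -pmulrn lt_neqAle eq_sym ks'.
    by rewrite -pmulrn ltW.
  by [].
have s1 : 0 < sing k.+1 M by exact: sing_gt0.
rewrite cE sing_prodS powRM ?ltW // mulrA -powRD ?(gt_eqF p0) ?implybT // subrK powRr1 //.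
exact: ltW.
Qed.

Lemma phi_comparable s k : k%:R <= s <= k.+1%:R -> (k.+1 <= d)%N ->
  exists2 c, 0 < c & forall M, M \in unitmx ->
    let b := cnorm k M `^ (1 - (s - k%:R)) * cnorm k.+1 M `^ (s - k%:R) in
    phi s M <= c * b /\ b <= c * phi s M.
Proof.
move=> hs kd; have /andP [ks sk] := hs.
have [c c0 hc] := @compound_sing R d k (ltnW kd); have [c' c0' hc'] := @compound_sing R d k.+1 kd.
exists (c `^ (1 - (s - k%:R)) * c' `^ (s - k%:R)) => [|M uM]; first by rewrite mulr_gt0 ?powR_gt0.
have q0 : 0 <= s - k%:R by rewrite subr_ge0.
have p0 : 0 <= 1 - (s - k%:R) by rewrite -natr1 in sk; lra.
rewrite /= (phi_interpolation uM hs kd).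
have [h1 h2] := hc M; have [h1' h2'] := hc' M.
have a0 := sing_prod_gt0 uM (ltnW kd); have a1 := sing_prod_gt0 uM kd.
have b0 := cnorm_gt0 (ltnW kd) uM; have b1 := cnorm_gt0 kd uM.
by split; apply: powR_mul_le.
Qed.

End SingularValueFunction.

Section CompoundPotentials.
Context {R : realType} {N : nat} {N2 : (2 <= N)%N} {d : nat}.
Local Notation letter := 'I_N.
Local Notation S := (borel_Sigma N2).
Implicit Types (mu nu : probability S R) (l : nat) (w : seq letter).
Variable A : letter -> 'M[R]_d.
Hypothesis A_unit : forall i, A i \in unitmx.

Definition word_cnorm l w : R := cnorm l (mxword A w).

Let uA w : mxword A w \in unitmx. Proof. exact: mxword_unit. Qed.

Lemma word_cnorm_gt0 l : (l <= d)%N -> forall w, 0 < word_cnorm l w.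
Proof. by move=> ld w; exact: cnorm_gt0. Qed.

Let word_cnormE l : word_cnorm l = mxnorm (fun i => compound l (A i)).
Proof. by apply/funext => w; rewrite /mxnorm mxword_compound. Qed.

Let compound_units l i : compound l (A i) \in unitmx.
Proof. exact: compound_unit. Qed.

Lemma word_cnorm_growth l mu : (l <= d)%N -> shift_invariant mu ->
  cvgn (fun n => mean_log (word_cnorm l) mu n / n%:R).
Proof.
move=> ld inv; have a0 := @compound_card_gt0 d l ld.
have [k k0 hk] := mxnorm_low a0 (@compound_units l).
have hc u v : word_cnorm l (u ++ v) <= word_cnorm l u * word_cnorm l v.
  by rewrite !word_cnormE; exact: mxnorm_cat.
rewrite -word_cnormE in hk.
by have [] := submultiplicative_growth (word_cnorm_gt0 ld) k0 hk hc inv.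
Qed.

(** A singular value is comparable to the quotient of consecutive compound norms, written with
    exponents 1 and -1 to fit [word_growth_powR]. *)
Lemma lyapunov_word_cnorm j mu : (j < d)%N -> shift_invariant mu ->
  lyapunov j.+1 A mu = word_growth (word_cnorm j.+1) mu - word_growth (word_cnorm j) mu.
Proof.
move=> jd inv; rewrite /lyapunov growth_rate_words.
have [c c0 hc] := @compound_sing R d j (ltnW jd); have [c' c0' hc'] := @compound_sing R d j.+1 jd.
have n0 := word_cnorm_gt0 (ltnW jd); have n1 := word_cnorm_gt0 jd.
have [cv e] := word_growth_powR 1 (- 1) n1 n0
  (word_cnorm_growth jd inv) (word_cnorm_growth (ltnW jd) inv).
have cc : 0 < c' * c by rewrite mulr_gt0.
have s0 w : 0 < sing j.+1 (mxword A w) by exact: sing_gt0.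
have r0 w : 0 < word_cnorm j.+1 w `^ 1 * word_cnorm j w `^ (-1) by rewrite mulr_gt0 ?powR_gt0.
have rE w : word_cnorm j.+1 w `^ 1 * word_cnorm j w `^ (-1) = word_cnorm j.+1 w / word_cnorm j w.
  by rewrite powRr1 ?(ltW (n1 _)) // powR_inv1 // ltW.
have p0 w := sing_prod_gt0 (uA w) (ltnW jd).
have [|||_ ->] := @comparable_growth _ _ N2 (fun w => sing j.+1 (mxword A w))
  (fun w => word_cnorm j.+1 w `^ 1 * word_cnorm j w `^ (-1)) (c' * c) mu cc s0 r0.
- move=> w; rewrite rE mulrA ler_pdivlMr //.
  have [_ h2] := hc (mxword A w); have [h1 _] := hc' (mxword A w).
  rewrite -(ler_pM2l (p0 w)) mulrA -sing_prodS.
  apply: le_trans (ler_pM _ _ h1 h2) _; rewrite ?(ltW (sing_prod_gt0 _ _)) ?(ltW (n0 _)) //.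
  by rewrite le_eqVlt; apply/orP; left; apply/eqP; rewrite /word_cnorm /cnorm; ring.
- move=> w; rewrite rE ler_pdivrMr //.
  have [h1 _] := hc (mxword A w); have [_ h2] := hc' (mxword A w).
  apply: le_trans h2 _; rewrite sing_prodS.
  have -> : c' * c * sing j.+1 (mxword A w) * word_cnorm j w =
    c' * (c * word_cnorm j w * sing j.+1 (mxword A w)) by ring.
  by rewrite ler_wpM2l ?(ltW c0') // ler_wpM2r ?(ltW (s0 _)).
- exact: cv.
- by rewrite e mul1r mulN1r.
Qed.

Lemma word_cnorm_interpolation x y p q : (x <= d)%N -> (y <= d)%N ->
  ext_irreducible x A -> ext_irreducible y A ->
  strongly_ext_irreducible x A \/ strongly_ext_irreducible y A -> 0 <= p -> 0 <= q ->
  quasi_multiplicative (fun w => word_cnorm x w `^ p * word_cnorm y w `^ q).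
Proof.
move=> xd yd ix iy sxy p0 q0; rewrite !word_cnormE.
have x0 := @compound_card_gt0 d x xd; have y0 := @compound_card_gt0 d y yd.
case: sxy => [sx|sy]; last first.
  apply: interpolation_quasi_multiplicative => //; first exact: compound_irreducible.
  exact: compound_strongly_irreducible.
rewrite (_ : (fun w => _) = (fun w => mxnorm (fun i => compound y (A i)) w `^ q *
    mxnorm (fun i => compound x (A i)) w `^ p)); last by apply/funext => w; rewrite mulrC.
apply: interpolation_quasi_multiplicative => //; first exact: compound_irreducible.
exact: compound_strongly_irreducible.
Qed.

(** Common form of the two cases, which run through the levels in opposite directions. The strong
    irreducibility alternative is symmetric in [y] and [z] but not in [x]. *)
Lemma three_levels x y z s t c c' : (x <= d)%N -> (y <= d)%N -> (z <= d)%N ->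
  ext_irreducible x A -> ext_irreducible y A -> ext_irreducible z A ->
  strongly_ext_irreducible x A \/ (strongly_ext_irreducible y A /\ strongly_ext_irreducible z A) ->
  0 < t <= 1 -> 0 < c -> (forall w, word_cnorm x w * word_cnorm z w <= c * word_cnorm y w ^+ 2) ->
  (forall C, exists w, C * (word_cnorm x w * word_cnorm z w) < word_cnorm y w ^+ 2) ->
  0 < c' -> (forall w, let b := word_cnorm x w `^ (1 - t) * word_cnorm y w `^ t in
    phi s (mxword A w) <= c' * b /\ b <= c' * phi s (mxword A w)) ->
  exists mu, [/\ equilibrium_state s A mu,
    forall nu, equilibrium_state s A nu -> forall B : set S, measurable B -> nu B = mu B,
    shift_invariant mu &
    word_growth (word_cnorm x) mu + word_growth (word_cnorm z) mu <
      2 * word_growth (word_cnorm y) mu].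
Proof.
move=> xd yd zd ix iy iz st /andP [t0 t1] c0 conc unb c0' cmp.
have sxy : strongly_ext_irreducible x A \/ strongly_ext_irreducible y A.
  by case: st => [|[]]; [left | right].
have sxz : strongly_ext_irreducible x A \/ strongly_ext_irreducible z A.
  by case: st => [|[]]; [left | right].
have qm1 : quasi_multiplicative (fun w => word_cnorm x w `^ (1 - t) * word_cnorm y w `^ t).
  by apply: word_cnorm_interpolation => //; lra.
have qm2 : quasi_multiplicative (fun w =>
    word_cnorm x w `^ (1 - t / 2) * word_cnorm z w `^ (t / 2)).
  by apply: word_cnorm_interpolation => //; lra.
have p0 w : 0 < phi s (mxword A w).
  have [_ h] := cmp w; rewrite -(pmulr_rgt0 _ c0'); apply: lt_le_trans h.
  exact: (potential_gt0 qm1 w).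
have [mu [imu gmu emu umu]] := @equilibrium_state_exists R N N2 d A s c' _ qm1 c0' p0
  (fun w => (cmp w).1) (fun w => (cmp w).2).
exists mu; split=> //.
by apply: (growth_gap _ _ _ t0 c0 conc unb qm1 qm2) => //;
  by [exact: word_cnorm_gt0 | exact: word_cnorm_growth].
Qed.

End CompoundPotentials.

Theorem theorem1p2 (R : realType) (N : nat) (N2 : (2 <= N)%N) (d : nat)
    (A : 'I_N -> 'M[R]_d) (s : R) (k : nat)
    (A_unit : forall i, A i \in unitmx) (s_gt0 : 0 < s) (s_lt_d : s < d%:R) :
  (k%:R < s <= k.+1%:R -> (k.+1 < d)%N ->
   ext_irreducible k A -> ext_irreducible k.+1 A -> ext_irreducible k.+2 A ->
   proximal k.+1 A ->
   strongly_ext_irreducible k A \/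
     (strongly_ext_irreducible k.+1 A /\ strongly_ext_irreducible k.+2 A) ->
   exists mu : probability (borel_Sigma N2) R,
     [/\ equilibrium_state s A mu,
         forall nu : probability (borel_Sigma N2) R, equilibrium_state s A nu ->
           forall B, measurable B -> nu B = mu B
       & lyapunov k.+1 A mu > lyapunov k.+2 A mu])
  /\
  ((0 < k)%N -> k%:R <= s < k.+1%:R -> (k.+1 <= d)%N ->
   ext_irreducible k.-1 A -> ext_irreducible k A -> ext_irreducible k.+1 A ->
   proximal k A ->
   strongly_ext_irreducible k.+1 A \/
     (strongly_ext_irreducible k.-1 A /\ strongly_ext_irreducible k A) ->
   exists mu : probability (borel_Sigma N2) R,
     [/\ equilibrium_state s A mu,
         forall nu : probability (borel_Sigma N2) R, equilibrium_state s A nu ->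
           forall B, measurable B -> nu B = mu B
       & lyapunov k A mu > lyapunov k.+1 A mu]).
Proof.
split=> [/andP [ks sk] kd i0 i1 i2 prox st | k0 /andP [ks sk] kd i0 i1 i2 prox st].
  have hk : (0 < k.+1 < d)%N by [].
  have [c c0 conc] := @cnorm_log_concave R d k.+1 hk.
  have [|c' c0' cmp] := @phi_comparable R d s k _ (ltnW kd); first by rewrite ltW.
  have [] := @three_levels R N N2 d A A_unit k k.+1 k.+2 s (s - k%:R) c c' _ _ kd i0 i1 i2 st
    _ c0 _ _ c0' _ => //.
  - exact: ltnW (ltnW kd).
  - exact: ltnW.
  - by rewrite -natr1 in sk; apply/andP; split; lra.
  - by move=> w; exact: conc.
  - by move=> C; exact: (proximal_unbounded A_unit C hk prox).
  - by move=> w; apply: cmp; exact: mxword_unit.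
  move=> mu [emu umu imu gap]; exists mu; split=> //.
  (* The difference of the two exponents is twice the middle growth rate minus the outer two. *)
  by rewrite !lyapunov_word_cnorm //; [lra | exact: ltnW].
have hk : (0 < k < d)%N by rewrite k0.
have [c c0 conc] := @cnorm_log_concave R d k hk.
have [|c' c0' cmp] := @phi_comparable R d s k _ kd; first by rewrite ks ltW.
have st' : strongly_ext_irreducible k.+1 A \/
    (strongly_ext_irreducible k A /\ strongly_ext_irreducible k.-1 A).
  by case: st => [|[]]; [left | right].
(* The levels descend, so that [k.+1] is the one shared by both products; s < k + 1 makes 1 - (s -
   k) positive. *)
have [] := @three_levels R N N2 d A A_unit k.+1 k k.-1 s (1 - (s - k%:R)) c c' kd _ _ i2 i1 i0 st'
    _ c0 _ _ c0' _ => //.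
- exact: ltnW.
- by rewrite (leq_trans (leq_pred k)) // ltnW.
- by rewrite -natr1 in sk; apply/andP; split; lra.
- by move=> w; rewrite mulrC; exact: conc.
- move=> C; have [w hw] := proximal_unbounded A_unit C hk prox; exists w.
  by rewrite [X in C * X]mulrC.
- by move=> w; rewrite opprB [1 + _]addrC subrK mulrC; apply: cmp; exact: mxword_unit.
move=> mu [emu umu imu gap]; exists mu; split=> //.
(* Writing [k] as a successor makes the exponent at [k] the difference of levels [k] and [k.-1]. *)
move: gap; rewrite -(prednK k0) /= in kd * => gap.
by rewrite !lyapunov_word_cnorm //; [lra | exact: ltnW].
Qed.
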